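(* Suppose Assumptions (A1)–(A5) described in the context hold, and let $\theta(t)$ be the policy parameters generated by the Scalable Actor-Critic algorithm (described in the context) with parameter $\kappa\ge1$. Then, almost surely, \[\liminf_{T\to\infty}\|\nabla J(\theta(T))\|\le L\,\frac{c\,\rho^{\kappa+1}}{1-\mu_D}.\]
   Context: Model. Let $\mathcal G=(\mathcal N,\mathcal E)$ be an undirected graph with $\mathcal N=\{1,\dots,n\}$ (the agents). $N_i$ is the set consisting of $i$ and its neighbours; for an integer $\kappa\ge1$, $N_i^\kappa$ is the set of nodes at graph distance at most $\kappa$ from $i$ (including $i$), and $N_{-i}^\kappa=\mathcal N\setminus N_i^\kappa$. Agent $i$ has finite state set $\mathcal S_i$ and finite action set $\mathcal A_i$; $\mathcal S=\prod_i\mathcal S_i$, $\mathcal A=\prod_i\mathcal A_i$, $\mathcal Z_i=\mathcal S_i\times\mathcal A_i$, $\mathcal Z=\mathcal S\times\mathcal A$, $z=(s,a)$. For $M\subset\mathcal N$, a subscript $M$ denotes the coordinates in $M$ ($s_M$, $a_M$, $z_M=(s_M,a_M)\in\mathcal Z_M$). Transitions factorize: $P(s(t+1)|s(t),a(t))=\prod_iP_i(s_i(t+1)|s_{N_i}(t),a_i(t))$. Localized policies $\zeta_i^{\theta_i}(a_i|s_i)$ are parameterized by $\theta_i$ in a Euclidean space; $\theta=(\theta_1,\dots,\theta_n)$, $\zeta^\theta(a|s)=\prod_i\zeta_i^{\theta_i}(a_i|s_i)$. $P^\theta$ is the transition matrix on $\mathcal Z$: $P^\theta(s',a'|s,a)=P(s'|s,a)\zeta^\theta(a'|s')$,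 with stationary distribution $\pi^\theta$. Rewards $r_i:\mathcal Z_i\to\mathbb R$; $J_i(\theta)=\mathbb E_{z\sim\pi^\theta}r_i(z_i)$, $J=\frac1n\sum_iJ_i$; $Q_i^\theta(z)=\sum_{t=0}^\infty(\mathbb E_\theta[r_i(z_i(t))|z(0)=z]-J_i(\theta))$. The $(c,\rho)$ exponential decay property ($c>0$, $\rho\in(0,1)$) means: for all $\theta$, $i$, integers $\kappa\ge1$, and all $z,z'\in\mathcal Z$ with $z_{N_i^\kappa}=z'_{N_i^\kappa}$, $|Q_i^\theta(z)-Q_i^\theta(z')|\le c\rho^{\kappa+1}$. Assumptions. (A1) $0\le r_i(s_i,a_i)\le\bar r$ for all $i,s_i,a_i$. (A2) The $(c,\rho)$ exponential decay property holds. (A3) The positive step sizes $\alpha_t,\eta_t$ are deterministic, non-increasing, each is square summable but not summable, and $\sum_{t}(\eta_t/\alpha_t)^d<\infty$ for some $d>0$. (A4) For every $\theta$, the chain $P^\theta$ is ergodic with stationary distribution $\pi^\theta$; there are constants $\sigma>0$, $\mu_D\in(0,1)$ (independent of $\theta$) with (a) $\pi^\theta(z)\ge\sigma$ for all $z\in\mathcal Z$, and (b) $\|P^\theta-\mathbf 1(\pi^\theta)^\top\|_{D^\theta}\le\mu_D$, where $D^\theta=\mathrm{diag}(\pi^\theta)$, $\|x\|_{D^\theta}=\sqrt{x^\top D^\theta x}$, with the induced matrix norm. (A5) $\|\nabla_{\theta_i}\log\zeta_i^{\theta_i}(a_i|s_i)\|\le L_i$ for all $i,a_i,s_i$ and all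 $\theta_i$; $L:=\sqrt{\sum_iL_i^2}$; $\nabla_{\theta_i}\log\zeta_i^{\theta_i}(a_i|s_i)$ is $L_i'$-Lipschitz in $\theta_i$; $\nabla J(\theta)$ is $L'$-Lipschitz in $\theta$. Scalable Actor-Critic algorithm. For each $i$ fix an arbitrary dummy $\tilde z_{N_i^\kappa}\in\mathcal Z_{N_i^\kappa}$ and let $\hat{\mathcal Z}_{N_i^\kappa}=\mathcal Z_{N_i^\kappa}\setminus\{\tilde z_{N_i^\kappa}\}$. Variables: $\hat\mu_i^t\in\mathbb R$, $\hat Q_i^t\in\mathbb R^{\hat{\mathcal Z}_{N_i^\kappa}}$, with the convention $\hat Q_i^t(\tilde z_{N_i^\kappa})=0$. Initialize $\hat\mu_i^0=0$, $\hat Q_i^0=0$, arbitrary $\theta(0)$, random $z(0)$. For $t=0,1,2,\dots$, for all $i$: receive $r_i(t)=r_i(s_i(t),a_i(t))$; the next state $s(t+1)$ is drawn from $P(\cdot|s(t),a(t))$ and $a_i(t+1)\sim\zeta_i^{\theta_i(t)}(\cdot|s_i(t+1))$ independently across $i$. Critic: $\hat\mu_i^{t+1}=(1-\alpha_t)\hat\mu_i^t+\alpha_tr_i(t)$; if $z_{N_i^\kappa}(t)=\tilde z_{N_i^\kappa}$ then $\hat Q_i^{t+1}=\hat Q_i^t$; otherwise $\hat Q_i^{t+1}(z_{N_i^\kappa}(t))=(1-\alpha_t)\hat Q_i^t(z_{N_i^\kappa}(t))+\alpha_t(r_i(t)-\hat\mu_i^t+\hat Q_i^t(z_{N_i^\kappa}(t+1)))$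 and all other entries of $\hat Q_i^{t+1}$ equal those of $\hat Q_i^t$. Actor: $\hat g_i(t)=\nabla_{\theta_i}\log\zeta_i^{\theta_i(t)}(a_i(t)|s_i(t))\,\frac1n\sum_{j\in N_i^\kappa}\hat Q_j^t(z_{N_j^\kappa}(t))$ and $\theta_i(t+1)=\theta_i(t)+\beta_t\hat g_i(t)$, where $\beta_t=\eta_t\Gamma(\hat{\mathbf Q}^t)$, $\Gamma(\hat{\mathbf Q}^t)=\frac1{1+\max_j\|\hat Q_j^t\|_\infty}$. *)

(* Defs.v *)
From HB Require Import structures.
From mathcomp Require Import all_boot all_order all_algebra.
From mathcomp Require Import all_classical all_reals all_analysis.

Set Implicit Arguments.
Unset Strict Implicit.
Unset Printing Implicit Defensive.

Import Order.TTheory GRing.Theory Num.Theory.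
Import numFieldNormedType.Exports.

Local Open Scope classical_set_scope.
Local Open Scope ring_scope.

Section Euclidean.
Context {R : realType}.

(* The library norm on 'rV[R]_d is the sup norm.  Both norms induce the same
   topology, so [differentiable] and 'D_v are the usual notions. *)
Definition enorm d (v : 'rV[R]_d) : R := Num.sqrt (\sum_j v 0 j ^+ 2).

Definition gradient d (f : 'rV[R]_d -> R) (x : 'rV[R]_d) : 'rV[R]_d :=
  \row_j 'D_(delta_mx 0 j) f x.

Definition elipschitz d d' (k : R) (f : 'rV[R]_d -> 'rV[R]_d') : Prop :=
  forall x y, enorm (f x - f y) <= k * enorm (x - y).

End Euclidean.

(* Square matrices indexed by a finite type, as two-argument functions. *)
Section FiniteChain.
Context {R : realType} {Z : finType}.
Implicit Types (M : Z -> Z -> R) (p x : Z -> R).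

Definition mapply M x : Z -> R := fun z => \sum_z' M z z' * x z'.

Fixpoint mpow M (t : nat) : Z -> Z -> R :=
  if t is t'.+1 then fun z z' => \sum_y M z y * mpow M t' y z'
  else fun z z' => (z == z')%:R.

Definition distribution_on p : Prop :=
  (forall z, 0 <= p z) /\ \sum_z p z = 1.

Definition stationary M p : Prop :=
  distribution_on p /\ forall z', \sum_z p z * M z z' = p z'.

Definition irreducible_chain M : Prop :=
  forall z z', exists t, 0 < mpow M t z z'.

Definition aperiodic_chain M : Prop :=
  forall z (g : nat),
    (forall t, (0 < t)%N -> 0 < mpow M t z z -> (g %| t)%N) -> g = 1%N.

Definition ergodic_chain M : Prop := irreducible_chain M /\ aperiodic_chain M.

(* ||x||_D = sqrt (x^T D x) with D = diag p. *)
Definition Dnorm p x : R := Num.sqrt (\sum_z x z * p z * x z).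

(* Operator norm induced by [Dnorm p]. *)
Definition Dopnorm p M : \bar R :=
  ereal_sup [set (Dnorm p (mapply M x))%:E | x in [set x | Dnorm p x <= 1]].

End FiniteChain.

Section Configurations.
Variable n : nat.

Definition conf (T : 'I_n -> finType) := {dffun forall i, T i}.

Definition sub_conf (T : 'I_n -> finType) (M : {set 'I_n}) :=
  {dffun forall j : {j : 'I_n | j \in M}, T (val j)}.

Definition restr (T : 'I_n -> finType) (M : {set 'I_n}) (s : conf T) :
  sub_conf T M := finfun (fun j : {j : 'I_n | j \in M} => s (val j)).

Definition closed_nbhd (e : rel 'I_n) (i : 'I_n) : {set 'I_n} :=
  [set j | (j == i) || e i j].

(* Nodes joined to i by a walk of length at most k, that is, at graph distance
   at most k from i. *)
Definition nbhdk (e : rel 'I_n) (k : nat) (i : 'I_n) : {set 'I_n} :=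
  [set j | [exists m : 'I_k.+1,
            exists p : m.-tuple 'I_n, path e i p && (last i p == j)]].

End Configurations.

Record networked_mdp (R : realType) (n : nat) := NetworkedMDP {
  edge : rel 'I_n;
  edge_sym : symmetric edge;
  St : 'I_n -> finType;
  Ac : 'I_n -> finType;
  (* ptrans sN a s' is the probability P_i(s' | sN, a). *)
  ptrans : forall i, sub_conf St (closed_nbhd edge i) -> Ac i -> St i -> R;
  ptrans_distr : forall i sN a, distribution_on (@ptrans i sN a);
  dim : 'I_n -> nat;
  (* policy th s a is the probability zeta_i^th(a | s). *)
  policy : forall i, 'rV[R]_(dim i) -> St i -> Ac i -> R;
  policy_distr : forall i th s, distribution_on (@policy i th s);
  reward : forall i, St i -> Ac i -> R
}.

Section Model.
Context {R : realType} {n : nat}.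
Variable G : networked_mdp R n.

Definition state_action : finType := (conf (St G) * conf (Ac G))%type.

Definition local_state_action (k : nat) (i : 'I_n) : finType :=
  (sub_conf (St G) (nbhdk (edge G) k i) *
   sub_conf (Ac G) (nbhdk (edge G) k i))%type.

Definition zloc (k : nat) (i : 'I_n) (z : state_action) :
  local_state_action k i :=
  (restr (nbhdk (edge G) k i) z.1, restr (nbhdk (edge G) k i) z.2).

Definition rew (i : 'I_n) (z : state_action) : R := reward (z.1 i) (z.2 i).

(* theta = (theta_1, ..., theta_n) is the concatenation of its blocks; the
   block theta_i is [submxrow theta i]. *)
Definition params := 'rV[R]_(\sum_(i < n) dim G i).

Definition joint_trans (z : state_action) (s' : conf (St G)) : R :=
  \prod_i ptrans (restr (closed_nbhd (edge G) i) z.1) (z.2 i) (s' i).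

Definition joint_policy (theta : params) (s : conf (St G)) (a : conf (Ac G)) :
  R := \prod_i policy (submxrow theta i) (s i) (a i).

Definition Ptheta (theta : params) (z z' : state_action) : R :=
  joint_trans z z'.1 * joint_policy theta z'.1 z'.2.

Definition log_policy (i : 'I_n) (s : St G i) (a : Ac G i)
  (th : 'rV[R]_(dim G i)) : R := ln (policy th s a).

Definition score (i : 'I_n) (s : St G i) (a : Ac G i) :=
  gradient (log_policy s a).

Section Objective.
(* pi theta is the stationary distribution of [Ptheta theta]. *)
Variable pi : params -> state_action -> R.

Definition Jloc (i : 'I_n) (theta : params) : R :=
  \sum_z pi theta z * rew i z.

Definition J (theta : params) : R := n%:R^-1 * \sum_i Jloc i theta.

(* mapply (mpow (Ptheta theta) t) (rew i) z is
   E_theta [r_i(z_i(t)) | z(0) = z]. *)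
Definition Qfun (i : 'I_n) (theta : params) (z : state_action) : R :=
  limn (series (fun t =>
    mapply (mpow (Ptheta theta) t) (rew i) z - Jloc i theta)).

Definition bounded_rewards (rbar : R) : Prop :=
  forall i (s : St G i) (a : Ac G i), 0 <= reward s a <= rbar.

Definition exp_decay (c rho : R) : Prop :=
  [/\ 0 < c, 0 < rho < 1 &
    forall theta i (k : nat) (z z' : state_action), (1 <= k)%N ->
      zloc k i z = zloc k i z' ->
      `|Qfun i theta z - Qfun i theta z'| <= c * rho ^+ k.+1].

Definition uniformly_ergodic (sigma muD : R) : Prop :=
  [/\ 0 < sigma, 0 < muD < 1 &
    forall theta,
      [/\ ergodic_chain (Ptheta theta),
          stationary (Ptheta theta) (pi theta),
          forall z, sigma <= pi theta z &
          (Dopnorm (pi theta) (fun z z' => (Ptheta theta z z' - pi theta z')%R)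
             <= muD%:E)%E]].

(* The differentiability clauses make explicit what is presupposed by the
   gradients being bounded and Lipschitz. *)
Definition smooth (Li Li' : 'I_n -> R) (L' : R) : Prop :=
  [/\ forall i (s : St G i) (a : Ac G i) th,
        differentiable (log_policy s a) th,
      forall i (s : St G i) (a : Ac G i) th, enorm (score s a th) <= Li i,
      forall i (s : St G i) (a : Ac G i), elipschitz (Li' i) (score s a),
      forall theta, differentiable J theta &
      elipschitz L' (gradient J)].

End Objective.

Section ActorCritic.
Variables (kappa : nat) (alpha eta : nat -> R).
Variable dummy : forall i, local_state_action kappa i.

(* Q_hat i is total on the local state-action space; its value at [dummy i] is
   never updated, hence stays equal to the initial value 0. *)
Record ac_state := ACState {
  mu_hat : 'I_n -> R;
  Q_hat : forall i, local_state_action kappa i -> R;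
  param : params
}.

Definition Qnorm (st : ac_state) (i : 'I_n) : R :=
  \big[Num.max/0]_(x | x != dummy i) `|Q_hat st x|.

Definition Gam (st : ac_state) : R :=
  (1 + \big[Num.max/0]_i Qnorm st i)^-1.

Definition g_hat (st : ac_state) (z : state_action) (i : 'I_n) :
  'rV[R]_(dim G i) :=
  (n%:R^-1 * \sum_(j in nbhdk (edge G) kappa i) Q_hat st (zloc kappa j z))
    *: score (z.1 i) (z.2 i) (submxrow (param st) i).

Definition ac_step (t : nat) (st : ac_state) (z z' : state_action) : ac_state :=
  ACState
    (fun i => (1 - alpha t) * mu_hat st i + alpha t * rew i z)
    (fun i x =>
       if zloc kappa i z == dummy i then Q_hat st x
       else if x == zloc kappa i z then
         (1 - alpha t) * Q_hat st x +
         alpha t * (rew i z - mu_hat st i + Q_hat st (zloc kappa i z'))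
       else Q_hat st x)
    (\mxrow_i (submxrow (param st) i + (eta t * Gam st) *: g_hat st z i)).

(* Iterates of the algorithm along the trajectory h(0), h(1), ...; the state at
   time t only depends on h(0), ..., h(t). *)
Fixpoint ac_run (theta0 : params) (h : nat -> state_action) (t : nat) :
  ac_state :=
  if t is t'.+1 then ac_step t' (ac_run theta0 h t') (h t') (h t)
  else ACState (fun=> 0) (fun i x => 0) theta0.

(* z is the random trajectory of the algorithm: given z(0), ..., z(t), the law
   of z(t+1) is Ptheta theta(t) z(t), with theta(t) computed from the past.
   The law of z(0) is unconstrained. *)
Definition ac_trajectory (theta0 : params) d (Om : measurableType d)
    (P : probability Om R) (z : nat -> Om -> state_action) : Prop :=
  (forall t x, measurable [set w | z t w = x]) /\
  (forall (h : nat -> state_action) (t : nat),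
     P [set w | forall k, (k <= t.+1)%N -> z k w = h k] =
     (P [set w | forall k, (k <= t)%N -> z k w = h k] *
      (Ptheta (param (ac_run theta0 h t)) (h t) (h t.+1))%:E)%E).

End ActorCritic.
End Model.

Section StepSizes.
Context {R : realType}.

Definition step_size (a : nat -> R) : Prop :=
  [/\ forall t, 0 < a t,
      forall t, a t.+1 <= a t,
      cvgn (series (fun t => a t ^+ 2)) &
      ~ cvgn (series a)].

Definition step_sizes (alpha eta : nat -> R) : Prop :=
  [/\ step_size alpha, step_size eta &
    exists2 p : R, 0 < p &
      cvgn (series (fun t => (eta t / alpha t) `^ p))].

End StepSizes.

(* Main.v *)
(* Only the lower limit of the gradient norm is claimed, so no martingale
   convergence is needed: it suffices that, for all m and delta > 0, the event
   {|grad J(theta(T))| > eps + delta for all T >= m} is null.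

   The state space is finite, so expectations of functions of z(0), ..., z(t) are
   finite sums over histories.  Markov noise is removed by the solution u of the
   Poisson equation u - P u = f - pi f, which is Lipschitz in theta, and theta
   moves by at most L eta_t, which is o(alpha_t).  Applied to the critic, this
   makes (squared distance to the limit of the frozen-theta critic) + alpha_t u a
   Lyapunov function whose expectation contracts, so the critic error vanishes in
   L^2.  The limit of the critic is within c rho^(kappa+1) / (1 - mu_D) of the true
   Q-function in the centered D-norm, by Pythagoras and the contraction.

   Applied to the actor, with - J(theta) + eta_t u restricted to the event that
   the gradient has stayed large, it gives a bounded quantity whose expectation
   decreases by at least a constant times eta_t: indeed Gamma = 1 / (1 + max |Q|)
   is bounded below in mean by convexity.  Since sum eta_t diverges, the event is
   null. *)
Require Import Defs.
From mathcomp Require Import all_boot all_order all_algebra.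
From mathcomp Require Import all_classical all_reals all_analysis.
From mathcomp Require Import ring lra.

Set Implicit Arguments.
Unset Strict Implicit.
Unset Printing Implicit Defensive.

Import Order.TTheory GRing.Theory Num.Theory.
Import numFieldNormedType.Exports.

Local Open Scope classical_set_scope.
Local Open Scope ring_scope.

(** * Real sequences, expansions and row vectors *)

(** No pathwise bound on the critic is established. Its one-step changes are bounded only through
    its own error, so the error terms of the actor carry a random factor whose expectation is
    eventually at most 2, while the scaling Gamma keeps both the parameter steps and the products
    Gamma * Q_hat bounded.

    Given the state, the score of an agent has mean zero. Hence an additive constant in each Q_hat
    is invisible to the actor, which is why a centered norm suffices. Restricting the sum over j to
    the neighbourhood of i also costs nothing, since Q_hat of a distant j does not depend on the
    action of i. The remaining bias is the projection error of the critic, multiplied by L through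
    Cauchy-Schwarz.

    The stationary law is never differentiated: an exact identity compares J at two parameters
    through a Poisson solution, and the policy gradient formula is its first-order part. *)

Section Sequences.
Context {R : realType}.
Implicit Types (u v w a : nat -> R).

(** One-sided, so that any smaller sequence inherits it; for nonnegative sequences it is convergence
    to zero. *)
Definition vanishing u := forall e : R, 0 < e -> \forall t \near \oo, u t <= e.

Lemma vanishing_le u v : (\forall t \near \oo, u t <= v t) ->
  vanishing v -> vanishing u.
Proof.
move=> uv v0 e e0; near=> t.
by apply: (@le_trans _ _ (v t)); near: t => //; exact: v0.
Unshelve. all: by end_near. Qed.

Lemma vanishingD u v : vanishing u -> vanishing v -> vanishing (fun t => u t + v t).
Proof.
move=> u0 v0 e e0; near=> t.
rewrite [e]splitr lerD//; near: t; [apply: u0|apply: v0]; by rewrite divr_gt0.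
Unshelve. all: by end_near. Qed.

Lemma vanishingZ k u : 0 <= k -> vanishing u -> vanishing (fun t => k * u t).
Proof.
rewrite le_eqVlt => /predU1P[<- _ e e0|k0 u0 e e0].
  by near=> t; rewrite mul0r ltW.
near=> t; rewrite mulrC -ler_pdivlMr//; near: t; apply: u0.
by rewrite divr_gt0.
Unshelve. all: by end_near. Qed.

Lemma vanishing_sum (I : finType) (u : I -> nat -> R) :
  (forall i, vanishing (u i)) -> vanishing (fun t => \sum_i u i t).
Proof.
move=> u0; elim: (index_enum I) => [|i s IHs].
  by move=> e e0; near=> t; rewrite big_nil ltW.
apply: (@vanishing_le _ (fun t => u i t + \sum_(j <- s) u j t)).
  by near=> t; rewrite big_cons.
exact: vanishingD.
Unshelve. all: by end_near. Qed.

Lemma cvg0_vanishing u : u @ \oo --> (0 : R) -> vanishing u.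
Proof.
move=> u0 e e0; near=> t.
suff: `|0 - u t| <= e by rewrite sub0r normrN; apply: le_trans; exact: ler_norm.
by near: t; move/cvgrPdist_le : u0; exact.
Unshelve. all: by end_near. Qed.

Lemma diverging_tail a (N : nat) (B : R) : (forall t, 0 < a t) ->
  ~ cvgn (series a) -> exists2 n, (N <= n)%N & B < \sum_(N <= k < n) a k.
Proof.
move=> a0 da; apply: contrapT => H; apply: da.
apply: nondecreasing_is_cvgn.
  apply/nondecreasing_seqP => n; rewrite /series/= big_nat_recr//= lerDl; exact: ltW.
exists (\sum_(0 <= k < N) a k + `|B|) => _ [n _ <-]; rewrite /series/=.
have [nN|Nn] := leqP n N.
  rewrite (big_cat_nat _ nN)//= -addrA lerDl addr_ge0// sumr_ge0// => k _; exact: ltW.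
rewrite (big_cat_nat _ (ltnW Nn))//= lerD2l (le_trans _ (ler_norm _))// leNgt.
by apply/negP => BN; apply: H; exists n => //; exact: ltnW.
Qed.

(** Partial sums of [a] are unbounded, so the accumulated decrements would push [h] below zero. It
    serves both the contraction lemma and the final contradiction for the actor. *)
Lemma descent_unbounded h a (k : R) : (forall t, 0 < a t) ->
  ~ cvgn (series a) -> 0 < k -> (forall t, 0 <= h t) ->
  ~ \forall t \near \oo, h t.+1 <= h t - k * a t.
Proof.
move=> a0 da k0 h0 [N _ hN].
have [n Nn] := diverging_tail N (h N / k) a0 da.
rewrite ltr_pdivrMr// ltNge => /negP; apply.
suff : h n <= h N - k * \sum_(N <= j < n) a j.
  by move/(le_trans (h0 n)); rewrite mulrC subr_ge0.
elim: n Nn => [|n IHn].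
  by rewrite leqn0 => /eqP ->; rewrite big_geq// mulr0 subr0.
rewrite leq_eqVlt => /predU1P[<-|Nn]; first by rewrite big_geq// mulr0 subr0.
rewrite big_nat_recr//= mulrDr opprD addrA.
by apply: (le_trans (hN _ Nn)); rewrite lerD2r IHn.
Qed.

(** Once [c * a t <= 1] and [err t <= c * e / 2], the level [e] is a trap: the recursion cannot
    leave it from below. Above it each step loses at least [c * e / 2 * a t], which cannot go on
    forever. *)
Lemma contraction_vanishing w a err (c : R) : 0 < c -> (forall t, 0 <= w t) ->
  (forall t, 0 < a t) -> ~ cvgn (series a) -> vanishing a -> vanishing err ->
  (\forall t \near \oo, w t.+1 <= (1 - c * a t) * w t + err t * a t) ->
  vanishing w.
Proof.
move=> c0 w0 a0 da va ve hw e e0.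
have ce : 0 < c * e / 2 by rewrite !mulr_gt0.
have ci : 0 < c^-1 by rewrite invr_gt0.
have [N _ HN] : \forall t \near \oo, [/\ a t <= c^-1, err t <= c * e / 2 &
    w t.+1 <= (1 - c * a t) * w t + err t * a t].
  near=> t; split; near: t; [exact: va|exact: ve|exact: hw].
have step t : (N <= t)%N -> w t <= e -> w t.+1 <= e.
  move=> /HN[/= at1 et wt] we; apply: (le_trans wt).
  have at0 := a0 t; have : c * a t <= 1.
    by rewrite mulrC -ler_pdivlMr// mul1r.
  move=> cat.
  have : err t * a t <= c * e / 2 * a t by rewrite ler_wpM2r// ltW.
  have : (1 - c * a t) * w t <= (1 - c * a t) * e.
    by rewrite ler_wpM2l// subr_ge0.
  have : 0 < c * e / 2 * a t by rewrite mulr_gt0.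
  lra.
have [[n Nn we]|none] := pselect (exists2 n, (N <= n)%N & w n <= e).
  exists n => // t /= nt; rewrite -(subnKC nt); elim: (t - n)%N => [|k IHk].
    by rewrite addn0.
  by rewrite addnS; apply: step => //; rewrite (leq_trans Nn)// leq_addr.
exfalso; apply: (@descent_unbounded w a (c * e / 2) a0 da ce w0).
exists N => // t /= Nt; have [/= at1 et wt] := HN _ Nt.
have we : e < w t by rewrite ltNge; apply/negP => we; apply: none; exists t.
apply: (le_trans wt).
have at0 := a0 t.
have : err t * a t <= c * e / 2 * a t by rewrite ler_wpM2r// ltW.
have : (c * a t) * e <= (c * a t) * w t by rewrite ler_wpM2l ?ltW// mulr_gt0.
lra.
Unshelve. all: by end_near. Qed.

Lemma vanishing_sqr a : (forall t, 0 <= a t) ->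
  cvgn (series (fun t => a t ^+ 2)) -> vanishing a.
Proof.
move=> a0 /cvg_series_cvg_0/cvg0_vanishing va e e0; near=> t.
have e0' := ltW e0; rewrite -(@ler_pXn2r _ 2) ?nnegrE ?a0//; near: t; apply: va.
by rewrite exprn_gt0.
Unshelve. all: by end_near. Qed.

(** Turns the summability of powers of [eta t / alpha t] into the separation of time scales. *)
Lemma vanishing_powR a (p : R) : 0 < p -> (forall t, 0 <= a t) ->
  cvgn (series (fun t => a t `^ p)) -> vanishing a.
Proof.
move=> p0 a0 /cvg_series_cvg_0/cvg0_vanishing va e e0; near=> t.
rewrite leNgt; apply/negP => ea.
have : a t `^ p <= (e / 2) `^ p.
  by near: t; apply: va; rewrite powR_gt0// divr_gt0.
rewrite leNgt => /negP; apply; rewrite gt0_ltr_powR// ?nnegrE ?divr_ge0 ?(ltW e0)//.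
by apply: lt_trans ea; lra.
Unshelve. all: by end_near. Qed.

End Sequences.

(** * First-order expansion of the exponential *)

Section Expansion.
Context {R : realType}.

(** Everything follows from [1 + x <= expR x] at [x] and at [- x]; the latter gives
    [expR x - 1 <= x * expR x]. *)
Lemma expR_expansion2 (x : R) : `|expR x - 1 - x| <= x ^+ 2 * expR `|x|.
Proof.
have e1 := expR_ge1Dx x; have e2 := expR_ge1Dx (- x).
have e0 := expR_gt0 x.
rewrite ger0_norm; last lra.
have e3 : expR x - 1 <= x * expR x.
  have : (1 - x) * expR x <= 1.
    have E : expR (- x) * expR x = 1 by rewrite -expRD addNr expR0.
    by rewrite -[leRHS]E ler_wpM2r// ltW.
  lra.
have [x0|x0] := leP 0 x.
  rewrite ger0_norm//.
  have : x * (expR x - 1) <= x * (x * expR x) by rewrite ler_wpM2l.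
  rewrite expr2; lra.
have eN : 1 <= expR `|x| by rewrite -expR0 ler_expR.
apply: (@le_trans _ _ (x ^+ 2)).
  have : (- x) * (1 - expR x) <= (- x) * (- x).
    by rewrite ler_wpM2l//; lra.
  rewrite expr2; lra.
by rewrite ler_peMr// sqr_ge0.
Qed.

(** Here [x] stands for a log-ratio of probabilities, [y] for its linear part and [d] for the
    displacement of the parameter. Since [d <= 1], [x] is at most [2 * K * d] in size, which makes
    the remainder uniform. *)
Lemma expR_linearization (K : R) : 0 <= K -> exists2 C, 0 <= C &
  forall x y d, 0 <= d <= 1 -> `|x - y| <= K * d ^+ 2 -> `|y| <= K * d ->
  `|expR x - 1 - y| <= C * d ^+ 2.
Proof.
move=> K0; exists (4 * K ^+ 2 * expR (2 * K) + K).
  by rewrite addr_ge0// !mulr_ge0 ?sqr_ge0 ?expR_ge0.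
move=> x y d /andP[d0 d1] xy yd.
have d2 : K * d ^+ 2 <= K * d.
  by rewrite ler_wpM2l// expr2 ler_piMr.
have xd : `|x| <= 2 * K * d.
  have -> : x = x - y + y by rewrite subrK.
  by apply: (le_trans (ler_normD _ _)); lra.
have -> : expR x - 1 - y = (expR x - 1 - x) + (x - y) by ring.
apply: (le_trans (ler_normD _ _)); rewrite mulrDl lerD//.
apply: (le_trans (expR_expansion2 x)).
have -> : 4 * K ^+ 2 * expR (2 * K) * d ^+ 2 = (2 * K * d) ^+ 2 * expR (2 * K).
  by ring.
apply: ler_pM; rewrite ?sqr_ge0 ?expR_ge0//.
  by rewrite -(real_normK (num_real x)) ler_pXn2r// nnegrE !mulr_ge0.
rewrite ler_expR (le_trans xd)// ler_piMr//; lra.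
Qed.

Lemma linear_le_quadratic (S C : R) : 0 <= C ->
  (forall t, 0 < t <= 1 -> `|t * S| <= C * t ^+ 2) -> S = 0.
Proof.
move=> C0 H; apply/eqP; rewrite -normr_le0; apply/ler_addgt0Pl => e e0.
rewrite addr0.
have CS : 0 < C + e + 1 by lra.
(* This value is at most 1 and makes [C * t] at most [e]. *)
set t := e / (C + e + 1).
have t0 : 0 < t by rewrite divr_gt0.
have t1 : t <= 1 by rewrite ler_pdivrMr// mul1r; lra.
have := H t; rewrite t0 t1 => /(_ isT).
rewrite normrM gtr0_norm// expr2 mulrCA ler_pM2l// => /le_trans; apply.
by rewrite mulrCA ler_piMr ?(ltW e0)// ler_pdivrMr// mul1r; lra.
Qed.

End Expansion.

(** * Euclidean inner product and its block decomposition *)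

Section Dot.
Context {R : realType}.

Definition dot d (u v : 'rV[R]_d) : R := \sum_j u 0 j * v 0 j.

Lemma dotC d (u v : 'rV[R]_d) : dot u v = dot v u.
Proof. by apply: eq_bigr => j _; rewrite mulrC. Qed.

Lemma dotDr d (u v w : 'rV[R]_d) : dot u (v + w) = dot u v + dot u w.
Proof. by rewrite -big_split; apply: eq_bigr => j _; rewrite mxE mulrDr. Qed.

Lemma dotZr d (k : R) (u v : 'rV[R]_d) : dot u (k *: v) = k * dot u v.
Proof. by rewrite mulr_sumr; apply: eq_bigr => j _; rewrite mxE mulrCA. Qed.

Lemma dotBr d (u v w : 'rV[R]_d) : dot u (v - w) = dot u v - dot u w.
Proof. by rewrite dotDr -scaleN1r dotZr mulN1r. Qed.

Lemma dot_sumr d (u : 'rV[R]_d) (I : finType) (F : I -> 'rV[R]_d) :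
  dot u (\sum_i F i) = \sum_i dot u (F i).
Proof.
by rewrite /dot exchange_big; apply: eq_bigr => j _; rewrite summxE mulr_sumr.
Qed.

Lemma dot_enorm d (v : 'rV[R]_d) : dot v v = enorm v ^+ 2.
Proof.
rewrite sqr_sqrtr; first by apply: eq_bigr => j _; rewrite expr2.
by apply: sumr_ge0 => j _; rewrite sqr_ge0.
Qed.

Lemma enorm_ge0 d (v : 'rV[R]_d) : 0 <= enorm v.
Proof. exact: sqrtr_ge0. Qed.

Lemma enormZ d (k : R) (v : 'rV[R]_d) : enorm (k *: v) = `|k| * enorm v.
Proof.
apply/eqP; rewrite -(@eqrXn2 _ 2)// ?mulr_ge0 ?enorm_ge0//.
by rewrite exprMn -!dot_enorm dotZr dotC dotZr mulrA -expr2 real_normK// num_real.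
Qed.

Lemma dot_le_enorm d (u v : 'rV[R]_d) : `|dot u v| <= enorm u * enorm v.
Proof.
have [v0|v0] := eqVneq (enorm v) 0.
  suff -> : dot u v = 0 by rewrite normr0 mulr_ge0 ?enorm_ge0.
  have : dot v v == 0 by rewrite dot_enorm v0 expr0n.
  rewrite psumr_eq0; last by move=> j _; rewrite -expr2 sqr_ge0.
  move=> /allP vj; apply: big1 => j _.
  have := vj j; rewrite mem_index_enum mulf_eq0 orbb => /(_ isT)/= /eqP ->.
  by rewrite mulr0.
rewrite -(@ler_pXn2r _ 2)// ?nnegrE ?mulr_ge0 ?enorm_ge0//.
rewrite real_normK ?num_real// exprMn.
have v2 : 0 < enorm v ^+ 2 by rewrite exprn_gt0// lt_neqAle eq_sym v0 enorm_ge0.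
have := sqr_ge0 (enorm (u - (dot u v / enorm v ^+ 2) *: v)).
rewrite -(dot_enorm (u - _)); set k := dot u v / _.
have kv : k * dot v v = dot u v by rewrite /k dot_enorm divfK// gt_eqF.
rewrite dotBr dotZr !(dotC (u - _)) !dotBr !dotZr (dotC v u) kv subrr mulr0 subr0.
rewrite dot_enorm subr_ge0 /k.
by rewrite mulrAC ler_pdivrMr// -expr2.
Qed.

Lemma enorm_triangle d (u v : 'rV[R]_d) : enorm (u + v) <= enorm u + enorm v.
Proof.
rewrite -(@ler_pXn2r _ 2)// ?nnegrE ?addr_ge0 ?enorm_ge0//.
rewrite -dot_enorm dotDr (dotC (u + v) u) (dotC (u + v) v) !dotDr !dot_enorm (dotC v u).
have := ler_norm (dot u v); have := dot_le_enorm u v.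
rewrite sqrrD; lra.
Qed.

Lemma dot_delta d (u : 'rV[R]_d) j : dot u (delta_mx 0 j) = u 0 j.
Proof.
rewrite /dot (bigD1 j)//= big1 ?addr0 ?mxE ?eqxx ?mulr1// => k /negbTE kj.
by rewrite !mxE kj mulr0.
Qed.

Lemma dot_diff_le d (u u' v v' : 'rV[R]_d) :
  `|dot u v - dot u' v'| <= enorm (u - u') * enorm v + enorm u' * enorm (v - v').
Proof.
have -> : dot u v - dot u' v' = dot v (u - u') + dot u' (v - v').
  by rewrite !dotBr (dotC v u) (dotC v u'); ring.
apply: (le_trans (ler_normD _ _)); rewrite mulrC.
by apply: lerD; rewrite dot_le_enorm.
Qed.

Lemma submxrowZ p (q : 'I_p -> nat) (k : R) (v : 'rV[R]_(\sum_i q i)) i :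
  submxrow (k *: v) i = k *: submxrow v i.
Proof. by apply/rowP => j; rewrite !mxE. Qed.

Lemma dot_block p (q : 'I_p -> nat) (u v : 'rV[R]_(\sum_i q i)) :
  dot u v = \sum_i dot (submxrow u i) (submxrow v i).
Proof.
have E m (a b : 'rV[R]_m) : dot a b = (a *m b^T) 0 0.
  by rewrite mxE; apply: eq_bigr => j _; rewrite mxE.
rewrite E -{1}(submxrowK u) -{1}(submxrowK v) tr_mxrow mul_mxrow_mxcol summxE.
by apply: eq_bigr => i _; rewrite E.
Qed.

Lemma enorm_block p (q : 'I_p -> nat) (v : 'rV[R]_(\sum_i q i)) :
  enorm v ^+ 2 = \sum_i enorm (submxrow v i) ^+ 2.
Proof. by rewrite -dot_enorm dot_block; apply: eq_bigr => i _; rewrite dot_enorm. Qed.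

Lemma enorm_submxrow p (q : 'I_p -> nat) (v : 'rV[R]_(\sum_i q i)) i :
  enorm (submxrow v i) <= enorm v.
Proof.
rewrite -(@ler_pXn2r _ 2)// ?nnegrE ?enorm_ge0// enorm_block (bigD1 i)//= lerDl.
by apply: sumr_ge0 => j _; rewrite sqr_ge0.
Qed.

End Dot.

(** * Finite Markov chains and the Poisson equation *)

Section WeightedMean.
Context {R : realType} {Z : finType}.
Implicit Types (M : Z -> Z -> R) (p x y : Z -> R).

Definition mean p x : R := \sum_z p z * x z.

Lemma eq_mean y p x : (forall z, x z = y z) -> mean p x = mean p y.
Proof. by move=> xy; apply: eq_bigr => z _; rewrite xy. Qed.

Arguments eq_mean y [p x].

Lemma meanD p x y : mean p (fun z => x z + y z) = mean p x + mean p y.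
Proof. by rewrite -big_split; apply: eq_bigr => z _; rewrite mulrDr. Qed.

Lemma meanZ p k x : mean p (fun z => k * x z) = k * mean p x.
Proof. by rewrite mulr_sumr; apply: eq_bigr => z _; rewrite mulrCA. Qed.

Lemma meanN p x : mean p (fun z => - x z) = - mean p x.
Proof. by rewrite -sumrN; apply: eq_bigr => z _; rewrite mulrN. Qed.

Lemma meanB p x y : mean p (fun z => x z - y z) = mean p x - mean p y.
Proof. by rewrite meanD meanN. Qed.

Lemma mean_sum p (I : finType) (Q : pred I) (x : I -> Z -> R) :
  mean p (fun z => \sum_(i | Q i) x i z) = \sum_(i | Q i) mean p (x i).
Proof.
by rewrite exchange_big; apply: eq_bigr => z _; rewrite mulr_sumr.
Qed.

Section Distribution.
Variables (p : Z -> R) (dp : distribution_on p).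

Lemma mean_cst k : mean p (fun=> k) = k.
Proof. by rewrite /mean -mulr_suml; case: dp => _ ->; rewrite mul1r. Qed.

Lemma le_mean x y : (forall z, x z <= y z) -> mean p x <= mean p y.
Proof. by move=> xy; apply: ler_sum => z _; rewrite ler_wpM2l//; case: dp. Qed.

Lemma norm_mean x : `|mean p x| <= mean p (fun z => `|x z|).
Proof.
apply: (le_trans (ler_norm_sum _ _ _)); apply: ler_sum => z _.
by rewrite normrM ger0_norm//; case: dp.
Qed.

Lemma norm_mean_le x (B : R) : (forall z, `|x z| <= B) -> `|mean p x| <= B.
Proof.
by move=> xB; apply: (le_trans (norm_mean _)); rewrite -[leRHS]mean_cst; exact: le_mean.
Qed.

(** Weighting by the square root of [p] makes [Dnorm p] a Euclidean norm, so the triangle and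
    Cauchy-Schwarz inequalities carry over from [enorm]. *)
Let wrow x : 'rV[R]_#|Z| :=
  \row_j (Num.sqrt (p (enum_val j)) * x (enum_val j)).

Let dot_wrow x y : dot (wrow x) (wrow y) = mean p (fun z => x z * y z).
Proof.
rewrite /mean (reindex (@enum_val Z (mem Z)))/=; last first.
  by apply/onW_bij; exists enum_rank; [exact: enum_valK|exact: enum_rankK].
apply: eq_bigr => j _.
rewrite !mxE mulrACA -expr2 sqr_sqrtr//; by case: dp.
Qed.

Let Dnorm_wrow x : Dnorm p x = enorm (wrow x).
Proof.
rewrite /Dnorm; have -> : \sum_z x z * p z * x z = mean p (fun z => x z * x z).
  by apply: eq_bigr => z _; rewrite -mulrA mulrCA.
by rewrite -dot_wrow dot_enorm sqrtr_sqr ger0_norm// enorm_ge0.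
Qed.

Lemma Dnorm_ge0 x : 0 <= Dnorm p x.
Proof. exact: sqrtr_ge0. Qed.

Lemma sqr_Dnorm x : Dnorm p x ^+ 2 = mean p (fun z => x z ^+ 2).
Proof. by rewrite Dnorm_wrow -dot_enorm dot_wrow; apply: eq_mean. Qed.

Lemma DnormD x y : Dnorm p (fun z => x z + y z) <= Dnorm p x + Dnorm p y.
Proof.
rewrite !Dnorm_wrow; apply: le_trans (enorm_triangle _ _).
rewrite le_eqVlt; apply/orP; left; apply/eqP; congr enorm.
by apply/rowP => j; rewrite !mxE mulrDr.
Qed.

Lemma eq_Dnorm x y : (forall z, x z = y z) -> Dnorm p x = Dnorm p y.
Proof. by move=> xy; congr Dnorm; apply: funext. Qed.

Lemma DnormZ k x : Dnorm p (fun z => k * x z) = `|k| * Dnorm p x.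
Proof.
rewrite !Dnorm_wrow -enormZ; congr enorm.
by apply/rowP => j; rewrite !mxE mulrCA.
Qed.

Lemma norm_mean_prod x y : `|mean p (fun z => x z * y z)| <= Dnorm p x * Dnorm p y.
Proof. by rewrite -dot_wrow !Dnorm_wrow dot_le_enorm. Qed.

Lemma mean_norm_Dnorm x : mean p (fun z => `|x z|) <= Dnorm p x.
Proof.
have := norm_mean_prod (fun z => `|x z|) (fun=> 1).
have -> : Dnorm p (fun=> 1) = 1.
  apply/eqP; rewrite -(@eqrXn2 _ 2)// ?Dnorm_ge0// sqr_Dnorm.
  by rewrite (eq_mean (fun=> 1)) ?mean_cst ?expr1n.
have -> : Dnorm p (fun z => `|x z|) = Dnorm p x.
  apply/eqP; rewrite -(@eqrXn2 _ 2)// ?Dnorm_ge0// !sqr_Dnorm.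
  by apply/eqP; apply: eq_mean => z; rewrite real_normK ?num_real.
rewrite mulr1 (eq_mean (fun z => `|x z|)); last by move=> z; rewrite mulr1.
by apply: le_trans; exact: ler_norm.
Qed.

Lemma Dnorm_le x (B : R) : 0 <= B -> (forall z, `|x z| <= B) -> Dnorm p x <= B.
Proof.
move=> B0 xB; rewrite -(@ler_pXn2r _ 2) ?nnegrE ?Dnorm_ge0// sqr_Dnorm.
rewrite -[leRHS]mean_cst; apply: le_mean => z.
by rewrite -(real_normK (num_real (x z))) ler_pXn2r ?nnegrE.
Qed.

End Distribution.

Lemma mapplyZ M k x z : mapply M (fun z => k * x z) z = k * mapply M x z.
Proof. exact: meanZ. Qed.

Lemma mapplyB M x y z : mapply M (fun z => x z - y z) z = mapply M x z - mapply M y z.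
Proof. exact: meanB. Qed.

End WeightedMean.

Arguments eq_mean {R Z} y [p x].

(** * Poisson equation of a uniformly ergodic kernel *)

Section Kernel.
Context {R : realType} {Z : finType}.
Implicit Types (f g w x : Z -> R).

Definition uniform_kernel (sigma mu : R) (P : Z -> Z -> R) (p : Z -> R) :=
  (0 < sigma /\ 0 < mu < 1) /\
  [/\ forall z, distribution_on (P z), stationary P p, forall z, sigma <= p z &
    forall x, Dnorm p (mapply (fun z z' => P z z' - p z') x) <= mu * Dnorm p x].

Variables (sigma mu : R).
(** The factor [1 - mu] comes from inverting the contraction on centered functions, the square root
    of [sigma] from passing from [Dnorm p] to the sup norm. *)
Definition poisson_const : R := ((1 - mu) * Num.sqrt sigma)^-1.

Lemma poisson_const_ge0 : 0 < mu < 1 -> 0 <= poisson_const.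
Proof.
by case/andP=> m0 m1; rewrite invr_ge0 mulr_ge0 ?sqrtr_ge0//; lra.
Qed.

(** Convertible to [Qfun] when [f] is the reward of an agent, so every fact below is also one about
    Q-functions. *)
Definition poisson (P : Z -> Z -> R) (p : Z -> R) f z : R :=
  limn (series (fun t => mapply (mpow P t) f z - mean p f)).

Section OneKernel.
Variables (P : Z -> Z -> R) (p : Z -> R).
Hypothesis uK : uniform_kernel sigma mu P p.

Let sigma0 : 0 < sigma. Proof. by case: uK => -[]. Qed.
Let mu01 : 0 < mu < 1. Proof. by case: uK => -[]. Qed.
Let dP z : distribution_on (P z). Proof. by case: (proj2 uK). Qed.
Let dp : distribution_on p. Proof. by case: (proj2 uK) => _ []. Qed.
Let mu_lt1 : 0 < 1 - mu. Proof. by case/andP: mu01; lra. Qed.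

Lemma mean_mapply f : mean p (mapply P f) = mean p f.
Proof.
case: (proj2 uK) => _ [_ st] _ _.
rewrite /mean /mapply; under eq_bigr do rewrite mulr_sumr.
rewrite exchange_big/=; apply: eq_bigr => z _.
by rewrite -st mulr_suml; apply: eq_bigr => y _; rewrite mulrA.
Qed.

Lemma mapply_cst k z : mapply P (fun=> k) z = k.
Proof. exact: (mean_cst (dP z)). Qed.

Lemma norm_mapply_le f (B : R) z : (forall z, `|f z| <= B) -> `|mapply P f z| <= B.
Proof. exact: (norm_mean_le (dP z)). Qed.

(** On centered functions the subtracted stationary projection is zero, so the operator bound is a
    contraction of [P] itself. *)
Lemma mapply_contract x : mean p x = 0 -> Dnorm p (mapply P x) <= mu * Dnorm p x.
Proof.
case: (proj2 uK) => _ _ _ /(_ x) + x0; congr (_ <= _); apply: eq_Dnorm => z.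
rewrite /mapply; under eq_bigr do rewrite mulrBl.
by rewrite sumrB; move: x0; rewrite /mean => ->; rewrite subr0.
Qed.

Lemma norm_le_Dnorm x z : `|x z| <= Dnorm p x / Num.sqrt sigma.
Proof.
rewrite ler_pdivlMr ?sqrtr_gt0// -(@ler_pXn2r _ 2) ?nnegrE ?mulr_ge0 ?Dnorm_ge0 ?sqrtr_ge0//.
rewrite exprMn sqr_sqrtr ?(ltW sigma0)// real_normK ?num_real// sqr_Dnorm// mulrC.
rewrite /mean (bigD1 z)//=; case: (proj2 uK) => _ _ /(_ z) sz _.
apply: (@le_trans _ _ (p z * x z ^+ 2)); first by rewrite ler_wpM2r ?sqr_ge0.
by rewrite lerDl sumr_ge0// => y _; rewrite mulr_ge0 ?sqr_ge0//; case: dp.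
Qed.

(** The centered part of [w] satisfies [Dnorm <= mu * Dnorm + B]. This a priori estimate, rather
    than the series, yields size, linearity and perturbation of Poisson solutions. *)
Lemma poisson_equation_bound w g (B : R) : (forall z, w z - mapply P w z = g z) ->
  (forall z, `|g z| <= B) -> forall z, `|w z - mean p w| <= B * poisson_const.
Proof.
move=> wg gB z.
have B0 : 0 <= B by apply: le_trans (gB z).
set w0 := fun z => w z - mean p w.
have w00 : mean p w0 = 0 by rewrite meanB mean_cst// subrr.
have w0E y : w0 y = mapply P w0 y + g y.
  by rewrite /w0 mapplyB mapply_cst -wg; ring.
have : Dnorm p w0 <= mu * Dnorm p w0 + B.
  rewrite [X in X <= _](eq_Dnorm _ w0E); apply: (le_trans (DnormD dp _ _)).
  by rewrite lerD// ?mapply_contract// Dnorm_le.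
move=> H; have {}H : Dnorm p w0 <= B / (1 - mu) by rewrite ler_pdivlMr//; lra.
apply: (le_trans (norm_le_Dnorm w0 z)).
by rewrite /poisson_const invfM mulrA ler_wpM2r// invr_ge0 sqrtr_ge0.
Qed.

Section Solution.
Variable f : Z -> R.
Let a t z := mapply (mpow P t) f z - mean p f.

Let a0 z : a 0 z = f z - mean p f.
Proof.
rewrite /a /mapply/= (bigD1 z)//= eqxx mul1r big1 ?addr0// => y yz.
by rewrite eq_sym (negbTE yz) mul0r.
Qed.

Let aS t z : a t.+1 z = mapply P (a t) z.
Proof.
rewrite /a mapplyB mapply_cst; congr (_ - _); rewrite /mapply/=.
under eq_bigr do rewrite mulr_suml.
rewrite exchange_big/=; apply: eq_bigr => y _; rewrite mulr_sumr.
by apply: eq_bigr => v _; rewrite mulrA.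
Qed.

Let mean_a t : mean p (a t) = 0.
Proof.
elim: t => [|t IHt].
  by rewrite (eq_mean _ a0) meanB mean_cst// subrr.
by rewrite (eq_mean _ (aS t)) mean_mapply.
Qed.

Let Dnorm_a t : Dnorm p (a t) <= mu ^+ t * Dnorm p (a 0).
Proof.
elim: t => [|t IHt]; first by rewrite expr0 mul1r.
rewrite (eq_Dnorm _ (aS t)); apply: (le_trans (mapply_contract (mean_a t))).
by rewrite exprS -mulrA ler_wpM2l//; case/andP: mu01 => /ltW.
Qed.

Let is_cvg_a z : cvgn (series (fun t => a t z)).
Proof.
apply: normed_cvg.
apply: (@series_le_cvg _ _ (geometric (Dnorm p (a 0) / Num.sqrt sigma) mu)).
- by move=> t; exact: normr_ge0.
- move=> t; rewrite /geometric/= mulr_ge0 ?divr_ge0 ?Dnorm_ge0 ?sqrtr_ge0//.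
  by rewrite exprn_ge0//; case/andP: mu01 => /ltW.
- move=> t; rewrite /geometric/=; apply: (le_trans (norm_le_Dnorm _ _)).
  by rewrite mulrAC ler_wpM2r ?invr_ge0 ?sqrtr_ge0// mulrC.
- apply: is_cvg_geometric_series; case/andP: mu01 => m0 m1.
  by rewrite gtr0_norm.
Qed.

Let cvg_mean_series q : 
  (fun n => mean q (fun z => series (fun t => a t z) n)) @ \oo --> mean q (poisson P p f).
Proof.
rewrite /mean; apply: cvg_big => [|z _]; first exact: add_continuous.
apply: cvgM; first exact: cvg_cst.
exact: is_cvg_a.
Qed.

Lemma poisson_centered : mean p (poisson P p f) = 0.
Proof.
apply: (cvg_unique _ (@cvg_mean_series p)) => //.
rewrite [X in X @ _](_ : _ = fun=> 0); first exact: cvg_cst.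
apply: funext => n; rewrite /series/= (eq_mean (fun z => \sum_(i < n) a i z)).
  by rewrite mean_sum big1.
by move=> z; rewrite big_mkord.
Qed.

(** Applying [P] shifts the defining series by one; the term lost is the one at time 0. *)
Lemma poissonE z : poisson P p f z - mapply P (poisson P p f) z = f z - mean p f.
Proof.
suff -> : mapply P (poisson P p f) z = poisson P p f z - (f z - mean p f) by ring.
apply: (cvg_unique _ (@cvg_mean_series (P z))) => //.
rewrite [X in X @ _](_ : _ = fun n => series (fun t => a t z) n.+1 - (f z - mean p f)).
  apply: cvgB; last exact: cvg_cst.
  have H : series (fun t => a t z) @ \oo --> poisson P p f z by exact: is_cvg_a.
  by move: H; rewrite -cvg_shiftS.
apply: funext => n; rewrite /series/= big_nat_recl//= a0 addrAC subrr add0r.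
rewrite (eq_mean (fun z => \sum_(i < n) a i z)).
  rewrite mean_sum big_mkord; apply: eq_bigr => i _; by rewrite aS.
by move=> y; rewrite big_mkord.
Qed.

Lemma poisson_bound (B : R) : (forall z, `|f z| <= B) ->
  forall z, `|poisson P p f z| <= 2 * B * poisson_const.
Proof.
move=> fB z; rewrite -[poisson _ _ _ _]subr0 -poisson_centered.
apply: (poisson_equation_bound poissonE) => y.
apply: (le_trans (ler_normB _ _)); rewrite mulr2n mulrDl !mul1r.
by rewrite lerD// norm_mean_le.
Qed.

End Solution.

(** The difference of the two sides is centered and solves the homogeneous equation, so the a priori
    estimate with bound 0 kills it. *)
Lemma poissonB f g z : poisson P p (fun y => f y - g y) z = poisson P p f z - poisson P p g z.
Proof.
set w := fun z => poisson P p (fun y => f y - g y) z - (poisson P p f z - poisson P p g z).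
have w0 : mean p w = 0 by rewrite !meanB !poisson_centered !subrr.
have := @poisson_equation_bound w (fun=> 0) 0 _ _ z.
rewrite w0 subr0 mul0r => H; apply/eqP; rewrite -subr_eq0 -normr_le0; apply: H.
  move=> y; rewrite /w !mapplyB.
  have := poissonE f y; have := poissonE g y.
  have := poissonE (fun y => f y - g y) y; rewrite meanB; lra.
by move=> y; rewrite normr0.
Qed.

(** The constant part of [f] drops out by stationarity. On the centered part, Cauchy-Schwarz and the
    contraction bound the inner product with [P f] by [mu] times the variance. *)
Lemma dirichlet_ge f : (1 - mu) * Dnorm p (fun z => f z - mean p f) ^+ 2 <=
  mean p (fun z => f z * (f z - mapply P f z)).
Proof.
set f0 := fun z => f z - mean p f.
have f00 : mean p f0 = 0 by rewrite meanB mean_cst// subrr.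
have -> : mean p (fun z => f z * (f z - mapply P f z)) =
    mean p (fun z => f0 z ^+ 2) - mean p (fun z => f0 z * mapply P f0 z).
  rewrite -meanB.
  rewrite (eq_mean (fun z => (f0 z ^+ 2 - f0 z * mapply P f0 z) +
      mean p f * (f0 z - mapply P f0 z))).
    rewrite [LHS]meanD (meanZ p (mean p f) (fun z => f0 z - mapply P f0 z)).
    by rewrite (meanB p f0) mean_mapply subrr mulr0 addr0.
  by move=> z; rewrite /f0 mapplyB mapply_cst; ring.
rewrite -sqr_Dnorm//.
have := ler_norm (mean p (fun z => f0 z * mapply P f0 z)).
have := norm_mean_prod dp f0 (mapply P f0).
have : Dnorm p f0 * Dnorm p (mapply P f0) <= Dnorm p f0 * (mu * Dnorm p f0).
  by rewrite ler_wpM2l ?Dnorm_ge0// mapply_contract.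
rewrite expr2; lra.
Qed.

(** Only the terms at [z] and [z0] are kept, each of mass at least [sigma], and
    [(a - b)^2 <= 2 a^2 + 2 b^2] is used. With a function pinned to 0 at [z0] it controls the values
    themselves. *)
Lemma variance_ge f z0 z :
  sigma / 2 * (f z - f z0) ^+ 2 <= Dnorm p (fun z => f z - mean p f) ^+ 2.
Proof.
have [->|zz0] := eqVneq z z0; first by rewrite subrr expr0n mulr0 sqr_ge0.
rewrite sqr_Dnorm//; move: (mean p f) => m.
rewrite /mean (bigD1 z)//= (bigD1 z0) 1?eq_sym//=.
have sz y : sigma * (f y - m) ^+ 2 <= p y * (f y - m) ^+ 2.
  by rewrite ler_wpM2r ?sqr_ge0//; case: (proj2 uK).
have : 0 <= \sum_(i | (i != z) && (i != z0)) p i * (f i - m) ^+ 2.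
  by rewrite sumr_ge0// => y _; rewrite mulr_ge0 ?sqr_ge0//; case: dp.
have := sz z; have := sz z0.
have : 0 <= sigma * ((f z - m) + (f z0 - m)) ^+ 2 by rewrite mulr_ge0 ?sqr_ge0 ?ltW.
rewrite !expr2; lra.
Qed.

End OneKernel.

(** * Dependence of stationary laws and Poisson solutions on the kernel *)

Section TwoKernels.
Variables (P P' : Z -> Z -> R) (p p' : Z -> R).
Hypotheses (uK : uniform_kernel sigma mu P p) (uK' : uniform_kernel sigma mu P' p').

(** Integrate the Poisson equation of [(P, p)] against [p'], which is invariant under [P']. This is
    the performance difference identity, from which the policy gradient is later read off. *)
Lemma mean_perturb f : mean p' f - mean p f =
  mean p' (fun z => mapply P' (poisson P p f) z - mapply P (poisson P p f) z).
Proof.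
have dp' : distribution_on p' by case: (proj2 uK') => _ [].
rewrite meanB (mean_mapply uK') -meanB.
by rewrite (eq_mean _ (poissonE uK f)) meanB mean_cst.
Qed.

Variable (d : R).
Hypothesis dPP : forall z z', `|P' z z' - P z z'| <= d.

Lemma mapply_diff f (B : R) z : (forall z, `|f z| <= B) ->
  `|mapply P' f z - mapply P f z| <= #|Z|%:R * (d * B).
Proof.
move=> fB; rewrite /mapply -sumrB; apply: (le_trans (ler_norm_sum _ _ _)).
apply: (@le_trans _ _ (\sum_(y : Z) d * B)).
  by apply: ler_sum => y _; rewrite -mulrBl normrM ler_pM.
by rewrite sumr_const mulr_natl.
Qed.

Lemma mean_diff f (B : R) : (forall z, `|f z| <= B) ->
  `|mean p' f - mean p f| <= #|Z|%:R * (d * (2 * B * poisson_const)).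
Proof.
have dp' : distribution_on p' by case: (proj2 uK') => _ [].
move=> fB; rewrite mean_perturb; apply: norm_mean_le => // z.
by apply: mapply_diff => y; exact: (poisson_bound uK).
Qed.

(** The difference [w] solves the Poisson equation of [P] with a right-hand side of order [d], which
    controls it up to its [p]-mean. *)
Lemma poisson_diff f (B : R) : (forall z, `|f z| <= B) -> forall z,
  `|poisson P' p' f z - poisson P p f z| <=
    #|Z|%:R * (d * (2 * B * poisson_const)) * (1 + 4 * poisson_const).
Proof.
move=> fB z.
have B0 : 0 <= B by apply: le_trans (fB z).
have d0 : 0 <= d by apply: le_trans (dPP z z).
set u := poisson P p f; set u' := poisson P' p' f.
set D := #|Z|%:R * (d * (2 * B * poisson_const)).
have c0 : 0 <= poisson_const by apply: poisson_const_ge0; case: uK => -[].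
have D0 : 0 <= D by rewrite !mulr_ge0.
have u'B : forall z, `|u' z| <= 2 * B * poisson_const by exact: (poisson_bound uK').
pose w y := u' y - u y.
pose g y := (mean p f - mean p' f) + (mapply P' u' y - mapply P u' y).
have wg y : w y - mapply P w y = g y.
  rewrite /w mapplyB /g; have := poissonE uK f y; have := poissonE uK' f y.
  rewrite -/u -/u'; lra.
have gD y : `|g y| <= 2 * D.
  apply: (le_trans (ler_normD _ _)); rewrite mulr2n mulrDl !mul1r lerD//.
    by rewrite distrC mean_diff.
  exact: mapply_diff.
have := poisson_equation_bound uK wg gD z.
(* [u'] is centered for [p'] and not for [p], so this mean has to be estimated separately. *)
have mw : `|mean p w| <=
    #|Z|%:R * (d * (2 * (2 * B * poisson_const) * poisson_const)).
  rewrite meanB (poisson_centered uK) subr0.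
  rewrite -[mean p u']subr0 -(poisson_centered uK' f) distrC.
  exact: mean_diff.
move=> H; rewrite -/(w z) -[w z](subrK (mean p w)).
apply: (le_trans (ler_normD _ _)); apply: (le_trans (lerD H mw)).
have -> : #|Z|%:R * (d * (2 * (2 * B * poisson_const) * poisson_const)) =
    D * (2 * poisson_const).
  by rewrite /D; ring.
rewrite mulrDr mulr1; lra.
Qed.

End TwoKernels.

End Kernel.

(** * The limit of the truncated critic *)

Lemma injective_kernel_surj (F : fieldType) (X : finType) (K : X -> X -> F) :
  (forall q, (forall x, \sum_y K x y * q y = 0) -> forall x, q x = 0) ->
  forall b, exists q, forall x, \sum_y K x y * q y = b x.
Proof.
move=> Kinj b.
pose A : 'M[F]_#|X| := \matrix_(i, j) K (enum_val j) (enum_val i).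
have sumE (v : 'rV[F]_#|X|) x :
    \sum_y K x y * v 0 (enum_rank y) = (v *m A) 0 (enum_rank x).
  rewrite mxE (reindex enum_rank)/=; last first.
    by apply/onW_bij; exists enum_val; [exact: enum_rankK|exact: enum_valK].
  by apply: eq_bigr => y _; rewrite mxE !enum_rankK mulrC.
have uA : A \in unitmx.
  rewrite -row_free_unit; apply: inj_row_free => v vA; apply/rowP => j.
  rewrite -[j]enum_valK [RHS]mxE.
  by apply: (Kinj (fun x => v 0 (enum_rank x))) => x; rewrite sumE vA mxE.
exists (fun x => ((\row_j b (enum_val j)) *m invmx A) 0 (enum_rank x)) => x.
by rewrite sumE mulmxKV// mxE enum_rankK.
Qed.

Section Aggregation.
Context {R : realType} {Z X : finType}.
Variables (phi : Z -> X) (x0 : X).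
Hypothesis phi_surj : forall x, exists z, phi z = x.

(** Conditional expectation of [g] given [phi = x], not normalised by the mass of the fiber.
    [sum_block] expresses its duality with functions of [phi]. *)
Definition block (p : Z -> R) (g : Z -> R) (x : X) : R :=
  \sum_(z | phi z == x) p z * g z.

Lemma sum_block p g (y : X -> R) :
  \sum_x y x * block p g x = mean p (fun z => y (phi z) * g z).
Proof.
rewrite /mean (partition_big phi xpredT)//=; apply: eq_bigr => x _.
by rewrite mulr_sumr; apply: eq_bigr => z /eqP <-; rewrite mulrCA.
Qed.

Lemma eq_block p g h x : (forall z, g z = h z) -> block p g x = block p h x.
Proof. by move=> gh; apply: eq_bigr => z _; rewrite gh. Qed.

Lemma blockB p g h x : block p (fun z => g z - h z) x = block p g x - block p h x.
Proof. by rewrite -sumrB; apply: eq_bigr => z _; rewrite mulrBr. Qed.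

Lemma norm_block_le p g (B : R) x : distribution_on p -> (forall z, `|g z| <= B) ->
  `|block p g x| <= B.
Proof.
move=> [p0 p1] gB; apply: (le_trans (ler_norm_sum _ _ _)).
rewrite -[leRHS]mul1r -p1 mulr_suml [leRHS](bigID (fun z => phi z == x))/= ler_wpDr//.
  have [z _] := phi_surj x; have B0 := le_trans (normr_ge0 _) (gB z).
  by apply: sumr_ge0 => y _; rewrite mulr_ge0.
by apply: ler_sum => z _; rewrite normrM ger0_norm ?ler_wpM2l.
Qed.

Definition td_error (P : Z -> Z -> R) (p r : Z -> R) (q : X -> R) (z : Z) : R :=
  r z - mean p r + mapply P (q \o phi) z - q (phi z).

(** Rest point of the critic at a frozen parameter: a projected Poisson equation, with the equation
    of the dummy cell replaced by the pinned value. *)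
Definition critic_limit (P : Z -> Z -> R) (p r : Z -> R) (q : X -> R) : Prop :=
  q x0 = 0 /\ forall x, x != x0 -> block p (td_error P p r q) x = 0.

Variables (sigma mu : R).
Hypothesis (mu01 : 0 < mu < 1) (sigma0 : 0 < sigma).

(** The factors are those of [dirichlet_ge] and [variance_ge]. *)
Definition coercivity : R := (1 - mu) * (sigma / 2).

Lemma coercivity_gt0 : 0 < coercivity.
Proof. by case/andP: mu01 => m0 m1; rewrite mulr_gt0 ?divr_gt0//; lra. Qed.

Section OneKernel.
Variables (P : Z -> Z -> R) (p : Z -> R).
Hypothesis uK : uniform_kernel sigma mu P p.

Let dp : distribution_on p. Proof. by case: (proj2 uK) => _ []. Qed.

Let L (q : X -> R) := block p (fun z => q (phi z) - mapply P (q \o phi) z).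

Lemma block_coercive q x : q x0 = 0 ->
  coercivity * q x ^+ 2 <= \sum_y q y * L q y.
Proof.
move=> q0; have [z0 z0E] := phi_surj x0; have [z zE] := phi_surj x.
rewrite sum_block; apply: le_trans (dirichlet_ge uK (q \o phi)).
rewrite /coercivity -mulrA ler_wpM2l//; first by case/andP: mu01; lra.
by have := variance_ge uK (q \o phi) z0 z; rewrite /= z0E zE q0 subr0.
Qed.

Lemma block_coercive_sum q : q x0 = 0 ->
  coercivity * \sum_x q x ^+ 2 <= #|X|%:R * \sum_y q y * L q y.
Proof.
move=> q0; rewrite mulr_sumr.
apply: (@le_trans _ _ (\sum_(x : X) \sum_y q y * L q y)).
  by apply: ler_sum => x _; exact: block_coercive.
by rewrite sumr_const mulr_natl.
Qed.

(** At a point [m] where the size of [q] is maximal, coercivity bounds [q m ^+ 2] by a sum of at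
    most [#|X|] terms of size at most that of [q m] times [B]; the term at [x0] is zero. Dividing by
    the size of [q m] concludes. *)
Lemma block_bounded_inverse q (B : R) : q x0 = 0 ->
  (forall x, x != x0 -> `|L q x| <= B) -> 0 <= B ->
  forall x, `|q x| <= #|X|%:R * B / coercivity.
Proof.
move=> q0 LB B0 x; have c0 := coercivity_gt0.
case: (@Order.TotalTheory.arg_maxP _ _ _ x0 xpredT (fun x => `|q x|)) => // m _ qm.
apply: (le_trans (qm x isT)); rewrite ler_pdivlMr//.
have [->|qm0] := eqVneq (q m) 0; first by rewrite normr0 mul0r mulr_ge0.
have {}qm0 : 0 < `|q m| by rewrite normr_gt0.
rewrite -(ler_pM2l qm0); have := block_coercive m q0.
rewrite -(real_normK (num_real (q m))) => H.
have -> : `|q m| * (`|q m| * coercivity) = coercivity * `|q m| ^+ 2 by ring.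
apply: (le_trans H).
apply: (@le_trans _ _ (\sum_(y : X) `|q m| * B)).
  apply: ler_sum => y _; apply: (le_trans (ler_norm _)).
  have [->|yx] := eqVneq y x0; first by rewrite q0 mul0r normr0 mulr_ge0.
  by rewrite normrM ler_pM// ?LB//; exact: qm.
by rewrite sumr_const mulrCA mulr_natl.
Qed.

Variable (r : Z -> R).

Lemma block_td_error q x :
  block p (td_error P p r q) x = block p (fun z => r z - mean p r) x - L q x.
Proof. by rewrite -blockB; apply: eq_block => z; rewrite /td_error; ring. Qed.

Lemma critic_limit_exists : exists q, critic_limit P p r q.
Proof.
(* Row [x0] of this square system states the pinning, the other rows the block equations.
   Injectivity comes from [block_bounded_inverse] with bound 0, and existence follows in finite
   dimension. *)
pose K x y : R := if x == x0 then (y == x0)%:R else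
  block p (fun z => (phi z == y)%:R - \sum_z' P z z' * (phi z' == y)%:R) x.
have delta (w : X) (q : X -> R) : \sum_y (w == y)%:R * q y = q w.
  rewrite (bigD1 w)//= eqxx mul1r big1 ?addr0// => y yw.
  by rewrite eq_sym (negbTE yw) mul0r.
have KE q x : \sum_y K x y * q y = if x == x0 then q x0 else L q x.
  rewrite /K; have [xx0|_] := eqVneq x x0.
    by under eq_bigr do rewrite eq_sym; rewrite delta.
  under eq_bigr do rewrite /block mulr_suml.
  rewrite exchange_big/=; apply: eq_bigr => z _.
  under eq_bigr do rewrite -mulrA; rewrite -mulr_sumr; congr (_ * _).
  under eq_bigr do rewrite mulrBl; rewrite sumrB delta; congr (_ - _).
  under eq_bigr do rewrite mulr_suml.
  rewrite exchange_big/=; apply: eq_bigr => z' _.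
  by under eq_bigr do rewrite -mulrA; rewrite -mulr_sumr delta.
have [|q qE] := @injective_kernel_surj _ X K _
    (fun x => if x == x0 then 0 else block p (fun z => r z - mean p r) x).
  move=> q Kq x; have q0 : q x0 = 0 by rewrite -(Kq x0) KE eqxx.
  apply/eqP; rewrite -normr_le0.
  have := @block_bounded_inverse q 0 q0 _ (lexx _) x.
  rewrite mulr0 mul0r; apply => y yx.
  by have := Kq y; rewrite KE (negbTE yx) /L => ->; rewrite normr0.
exists q; split; first by have := qE x0; rewrite KE eqxx.
move=> x xx0; rewrite block_td_error; have := qE x.
by rewrite KE (negbTE xx0) => ->; rewrite subrr.
Qed.

Variable (rbar : R).
Hypothesis r_le : forall z, `|r z| <= rbar.

Lemma critic_limit_bound q : critic_limit P p r q ->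
  forall x, `|q x| <= #|X|%:R * (2 * rbar) / coercivity.
Proof.
move=> [q0 qE] x.
have B0 : 0 <= 2 * rbar.
  by have [z _] := phi_surj x0; rewrite mulr_ge0//; exact: le_trans (r_le z).
apply: block_bounded_inverse => // y /qE.
rewrite block_td_error => /eqP; rewrite subr_eq0 => /eqP <-.
apply: norm_block_le => // z; apply: (le_trans (ler_normB _ _)).
by rewrite mulr2n mulrDl !mul1r lerD// norm_mean_le.
Qed.

(** The block equations make the residual of the centered error [e0] orthogonal to functions of
    [phi]. Hence its component [g0] among those functions satisfies
    [mean p (g0 ^+ 2) = mean p (g0 * P e0)], so [Dnorm p g0 <= mu * Dnorm p e0]. The rest [h] is at
    most [eps], and the term in [mu] is absorbed. *)
Lemma critic_limit_approx q (eps : R) : critic_limit P p r q ->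
  (forall z z', phi z = phi z' -> `|poisson P p r z - poisson P p r z'| <= eps) ->
  Dnorm p (fun z => (q (phi z) - poisson P p r z)
    - mean p (fun z => q (phi z) - poisson P p r z)) <= eps / (1 - mu).
Proof.
move=> [q0 qE]; set u := poisson P p r => uosc; pose e z := q (phi z) - u z.
change (Dnorm p (fun z => e z - mean p e) <= eps / (1 - mu)); set m := mean p e.
have mu1 : 0 < 1 - mu by case/andP: mu01; lra.
have p0 z : 0 < p z by case: (proj2 uK) => _ _ /(_ z) sz _; exact: lt_le_trans sz.
have eps0 : 0 <= eps by have [z _] := phi_surj x0; exact: le_trans (uosc z z erefl).
pose mass x := \sum_(z | phi z == x) p z.
have mass0 x : 0 < mass x.
  have [z zx] := phi_surj x; rewrite /mass (bigD1 z) ?zx//= ltr_wpDr//.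
  by apply: sumr_ge0 => y _; exact: ltW.
pose ubar x := block p u x / mass x.
(* [ubar \o phi] is the orthogonal projection of [u] onto the functions of [phi];
   [h] is the projection error. *)
pose h z := ubar (phi z) - u z.
have hblock x : block p h x = 0.
  rewrite blockB -[X in X - _](_ : mass x * ubar x = _).
    by rewrite /ubar mulrCA divff ?gt_eqF// mulr1 subrr.
  by rewrite mulr_suml; apply: eq_bigr => z /eqP ->.
(* [ubar] averages [u] over a fiber, so [h] is at most the oscillation of [u] there. *)
have h_le z : `|h z| <= eps.
  have mz := mass0 (phi z).
  have -> : h z = (\sum_(y | phi y == phi z) p y * (u y - u z)) / mass (phi z).
    under eq_bigr do rewrite mulrBr.
    by rewrite sumrB -mulr_suml mulrBl -/(mass _) mulrAC divff ?gt_eqF// mul1r.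
  rewrite normrM normfV (gtr0_norm mz) ler_pdivrMr//.
  apply: (le_trans (ler_norm_sum _ _ _)); rewrite mulrC mulr_suml.
  apply: ler_sum => y /eqP yz; rewrite normrM (gtr0_norm (p0 y)).
  by rewrite ler_wpM2l ?(ltW (p0 y))// uosc.
pose e0 z := e z - m.
have Pe z : e z - mapply P e z = - td_error P p r q z.
  rewrite /e mapplyB /td_error -(poissonE uK r z) -/u /comp; ring.
have ecrit x : block p (fun z => e0 z - mapply P e0 z) x = 0.
  have E y : block p (fun z => e0 z - mapply P e0 z) y = - block p (td_error P p r q) y.
    rewrite /block -sumrN; apply: eq_bigr => z _.
    by rewrite -mulrN -Pe /e0 mapplyB (mapply_cst uK); congr (_ * _); ring.
  (* The dummy cell has no equation of its own, but the blocks of [e0 - P e0] sum to 0 by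
     stationarity, and all the others vanish. *)
  have [->|xx0] := eqVneq x x0; last by rewrite E qE// oppr0.
  have := sum_block p (fun z => e0 z - mapply P e0 z) (fun=> 1).
  rewrite (bigD1 x0)//= mul1r big1 ?addr0; last first.
    by move=> y yx0; rewrite E qE// oppr0 mulr0.
  move=> ->; rewrite (eq_mean (fun z => e0 z - mapply P e0 z)); last first.
    by move=> z; rewrite mul1r.
  by rewrite meanB (mean_mapply uK) subrr.
pose g0 z := q (phi z) - ubar (phi z) - m.
have ge z : g0 z = e0 z - h z by rewrite /g0 /e0 /h /e; ring.
have orth g : (forall x, block p g x = 0) -> mean p (fun z => g0 z * g z) = 0.
  move=> gx; rewrite -(sum_block p g (fun x => q x - ubar x - m)).
  by rewrite big1// => x _; rewrite gx mulr0.
have g0e0 : mean p (fun z => g0 z ^+ 2) = mean p (fun z => g0 z * mapply P e0 z).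
  apply/eqP; rewrite -subr_eq0 -meanB.
  rewrite (eq_mean (fun z => g0 z * (e0 z - mapply P e0 z) - g0 z * h z)).
    by rewrite meanB !orth// subrr.
  by move=> z; rewrite expr2 {2}ge; ring.
have e00 : mean p e0 = 0 by rewrite meanB mean_cst// subrr.
have g0_le : Dnorm p g0 <= mu * Dnorm p e0.
  have [->|g00] := eqVneq (Dnorm p g0) 0.
    by rewrite mulr_ge0 ?Dnorm_ge0//; case/andP: mu01 => /ltW.
  have gp : 0 < Dnorm p g0 by rewrite lt_neqAle eq_sym g00 Dnorm_ge0.
  rewrite -(ler_pM2l gp) -expr2 sqr_Dnorm// g0e0.
  apply: (le_trans (ler_norm _)); apply: (le_trans (norm_mean_prod dp _ _)).
  by rewrite ler_wpM2l ?Dnorm_ge0//; exact: (mapply_contract uK).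
rewrite -/e0 ler_pdivlMr//.
have : Dnorm p e0 <= Dnorm p g0 + eps.
  rewrite (@eq_Dnorm _ _ p e0 (fun z => g0 z + h z)); last by move=> z; rewrite ge; ring.
  apply: (le_trans (DnormD dp _ _)); rewrite lerD2l; exact: Dnorm_le.
lra.
Qed.

End OneKernel.

(** The difference [q' - q] is pinned at [x0], and its residual collects the changes of kernel,
    stationary law and mean reward, each of order [d]; [block_bounded_inverse] turns this into a
    bound on the difference. *)
Lemma critic_limit_lipschitz (r : Z -> R) (rbar : R) : (forall z, `|r z| <= rbar) ->
  exists2 K, 0 <= K & forall P P' p p' q q' (d : R),
    uniform_kernel sigma mu P p -> uniform_kernel sigma mu P' p' ->
    (forall z z', `|P' z z' - P z z'| <= d) ->
    critic_limit P p r q -> critic_limit P' p' r q' ->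
    forall x, `|q' x - q x| <= K * d.
Proof.
move=> r_le.
have B0 : 0 <= rbar by have [z _] := phi_surj x0; exact: le_trans (r_le z).
have c0 := coercivity_gt0.
have pc0 := poisson_const_ge0 sigma mu01.
set pc := poisson_const sigma mu in pc0.
pose Q := #|X|%:R * (2 * rbar) / coercivity.
have Q0 : 0 <= Q by rewrite divr_ge0 ?(ltW c0)// !mulr_ge0.
pose dp1 := #|Z|%:R * (2 * 1 * pc).
pose dJ := #|Z|%:R * (2 * rbar * pc).
pose T := (2 * Q + 2 * rbar) * dp1 + #|Z|%:R * Q + dJ.
pose K1 := #|Z|%:R * T.
have dp10 : 0 <= dp1 by rewrite !mulr_ge0.
have dJ0 : 0 <= dJ by rewrite !mulr_ge0.
have T0 : 0 <= T by rewrite !addr_ge0// mulr_ge0// addr_ge0// mulr_ge0.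
have K10 : 0 <= K1 by rewrite mulr_ge0.
exists (#|X|%:R * K1 / coercivity); first by rewrite divr_ge0 ?(ltW c0)// mulr_ge0.
move=> P P' p p' q q' d uK uK' dPP cq cq' x.
have d0 : 0 <= d by have [z _] := phi_surj x0; exact: le_trans (dPP z z).
have dp : distribution_on p by case: (proj2 uK) => _ [].
have dp' : distribution_on p' by case: (proj2 uK') => _ [].
have q_le := critic_limit_bound uK r_le cq.
have q'_le := critic_limit_bound uK' r_le cq'.
have -> : #|X|%:R * K1 / coercivity * d = #|X|%:R * (K1 * d) / coercivity by ring.
case: cq => q0 qE; case: cq' => q'0 q'E.
apply: (@block_bounded_inverse P p uK (fun x => q' x - q x));
  [by rewrite q0 q'0 subrr| |by rewrite mulr_ge0].
move=> y yx0.
(* [mean_diff] is applied to the indicator of [z]. *)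
have pp z : `|p' z - p z| <= dp1 * d.
  have I1 w : `|(w == z)%:R : R| <= 1 by case: eqP; rewrite ?normr1 ?normr0.
  have := mean_diff uK uK' dPP I1.
  have E (v : Z -> R) : mean v (fun w => (w == z)%:R) = v z.
    rewrite /mean (bigD1 z)//= eqxx mulr1 big1 ?addr0// => w /negbTE ->.
    by rewrite mulr0.
  rewrite !E => /le_trans; apply; rewrite /dp1 -/pc; lra.
have JJ := mean_diff uK uK' dPP r_le.
have := qE _ yx0; rewrite block_td_error => /eqP; rewrite subr_eq0 => /eqP H.
have := q'E _ yx0; rewrite block_td_error => /eqP; rewrite subr_eq0 => /eqP H'.
pose f z := q (phi z); pose f' z := q' (phi z).
have -> : block p (fun z => q' (phi z) - q (phi z) -
      mapply P ((fun x => q' x - q x) \o phi) z) y =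
    \sum_(z | phi z == y) ((p z - p' z) * (f' z - mapply P' f' z)
      + p z * (mapply P' f' z - mapply P f' z)
      + (p' z - p z) * (r z - mean p' r) + p z * (mean p r - mean p' r)).
  (* The last bracket is 0 by the equation of [q']; adding it exposes the differences between the
     two chains. *)
  rewrite [LHS](_ : _ = block p (fun z => f' z - mapply P f' z) y -
      block p (fun z => f z - mapply P f z) y
      + (block p' (fun z => r z - mean p' r) y - block p' (fun z => f' z - mapply P' f' z) y)).
    rewrite -H; move: (mean p r) (mean p' r) => m m'.
    rewrite /block -!sumrB -big_split; apply: eq_bigr => z _ /=; ring.
  rewrite H' subrr addr0 -blockB; apply: eq_block => z.
  by have := mapplyB P f' f z; rewrite /f /f' /comp => ->; ring.
apply: (le_trans (ler_norm_sum _ _ _)).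
apply: (@le_trans _ _ (\sum_(z : Z) T * d)); last first.
  by rewrite sumr_const /K1 -mulrA mulr_natl.
rewrite [leRHS](bigID (fun z => phi z == y))/= ler_wpDr//.
  by apply: sumr_ge0 => z _; rewrite mulr_ge0.
apply: ler_sum => z _.
have p1 : `|p z| <= 1.
  case: dp => p0 ps; rewrite ger0_norm// -ps (bigD1 z)//= lerDl sumr_ge0//.
have mq' : `|mapply P' f' z| <= Q by apply: (norm_mapply_le uK') => w; exact: q'_le.
have rJ : `|r z - mean p' r| <= 2 * rbar.
  apply: (le_trans (ler_normB _ _)); rewrite mulr2n mulrDl !mul1r lerD//.
  by rewrite norm_mean_le.
have b1 : `|(p z - p' z) * (f' z - mapply P' f' z)| <= dp1 * d * (2 * Q).
  rewrite normrM distrC ler_pM//; apply: (le_trans (ler_normB _ _)).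
  by rewrite mulr2n mulrDl !mul1r lerD//; exact: q'_le.
have b2 : `|p z * (mapply P' f' z - mapply P f' z)| <= #|Z|%:R * (d * Q).
  rewrite normrM -[leRHS]mul1r ler_pM//.
  by apply: mapply_diff => // w; exact: q'_le.
have b3 : `|(p' z - p z) * (r z - mean p' r)| <= dp1 * d * (2 * rbar).
  by rewrite normrM ler_pM.
have b4 : `|p z * (mean p r - mean p' r)| <= dJ * d.
  rewrite normrM -[leRHS]mul1r ler_pM// distrC (le_trans JJ)// /dJ -/pc; lra.
apply: (le_trans (ler_normD _ _)); apply: (le_trans (lerD (ler_normD _ _) b4)).
apply: (le_trans (lerD (lerD (ler_normD _ _) b3) (lexx _))).
apply: (le_trans (lerD (lerD (lerD b1 b2) (lexx _)) (lexx _))).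
rewrite /T; lra.
Qed.

End Aggregation.

(** * Stochastic approximation with controlled Markov noise *)

Section HistoryExpectation.
Context {R : realType} {Z : finType}.
Variables (p0 : Z -> R) (K : seq Z -> Z -> R).

(* Histories list the most recent state first. *)
Fixpoint Ex (t : nat) (F : seq Z -> R) : R :=
  if t is t'.+1 then Ex t' (fun s => mean (K s) (fun x => F (x :: s)))
  else mean p0 (fun x => F [:: x]).

Hypotheses (dp0 : distribution_on p0) (dK : forall s, distribution_on (K s)).

Lemma Ex_le t F G : (forall s, size s = t.+1 -> F s <= G s) -> Ex t F <= Ex t G.
Proof.
elim: t F G => [|t IHt] F G FG /=; first by apply: le_mean => // x; exact: FG.
by apply: IHt => s st; apply: le_mean => // x; apply: FG; rewrite /= st.
Qed.

Lemma eq_Ex t F G : (forall s, size s = t.+1 -> F s = G s) -> Ex t F = Ex t G.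
Proof.
by move=> FG; apply/eqP; rewrite eq_le !Ex_le// => s /FG ->.
Qed.

Lemma ExD t F G : Ex t (fun s => F s + G s) = Ex t F + Ex t G.
Proof.
elim: t F G => [|t IHt] F G /=; first exact: meanD.
by rewrite -IHt; apply: eq_Ex => s _; exact: meanD.
Qed.

Lemma ExZ t k F : Ex t (fun s => k * F s) = k * Ex t F.
Proof.
elim: t F => [|t IHt] F /=; first exact: meanZ.
by rewrite -IHt; apply: eq_Ex => s _; exact: meanZ.
Qed.

Lemma Ex_cst t k : Ex t (fun=> k) = k.
Proof.
elim: t => [|t IHt] /=; first exact: mean_cst.
by rewrite -[RHS]IHt; apply: eq_Ex => s _; exact: mean_cst.
Qed.

Lemma Ex_ge0 t F : (forall s, 0 <= F s) -> 0 <= Ex t F.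
Proof. by move=> F0; rewrite -(Ex_cst t 0); apply: Ex_le => s _. Qed.

Lemma Ex_sum t (I : finType) (F : I -> seq Z -> R) :
  Ex t (fun s => \sum_i F i s) = \sum_i Ex t (F i).
Proof.
elim: t F => [|t IHt] F /=; first exact: mean_sum.
by rewrite -IHt; apply: eq_Ex => s _; exact: mean_sum.
Qed.

End HistoryExpectation.

Section ControlledChain.
Context {R : realType} {Z : finType} {Theta : Type}.
Variables (sigma mu : R) (P : Theta -> Z -> Z -> R) (pi : Theta -> Z -> R).
Hypothesis mu01 : 0 < mu < 1.
Hypothesis uK : forall th, uniform_kernel sigma mu (P th) (pi th).
Variables (dist : Theta -> Theta -> R) (KP : R).
Hypothesis KP0 : 0 <= KP.
Hypothesis PLip : forall th th' z z', `|P th' z z' - P th z z'| <= KP * dist th' th.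

Let pc := poisson_const sigma mu.

(* The Poisson solution telescopes the Markov noise: [f z] equals its stationary
   mean up to a one-step drift of [poisson f] and the variation of parameters. *)
Lemma poisson_step : exists2 C : R, 0 <= C &
  forall th (th' : Z -> Theta) f (f' : Z -> Z -> R) (B delta d : R) z,
  0 <= d -> (forall z, `|f z| <= B) -> (forall x z, `|f' x z - f z| <= delta) ->
  (forall x, dist (th' x) th <= d) ->
  `|mean (P th z) (fun x => poisson (P (th' x)) (pi (th' x)) (f' x) x)
    - (poisson (P th) (pi th) f z - f z + mean (pi th) f)| <= C * (delta + d * B).
Proof.
have pc0 : 0 <= pc := poisson_const_ge0 sigma mu01.
pose C2 := #|Z|%:R * KP * 2 * pc * (1 + 4 * pc).
have C20 : 0 <= C2 by rewrite /C2 !mulr_ge0// addr_ge0// mulr_ge0.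
exists (2 * pc + C2); first by rewrite addr_ge0// mulr_ge0.
move=> th th' f f' B delta d z dd fB ff' dth.
have B0 : 0 <= B by exact: le_trans (fB z).
have d0 : 0 <= delta by exact: le_trans (ff' z z).
have -> : poisson (P th) (pi th) f z - f z + mean (pi th) f =
    mean (P th z) (poisson (P th) (pi th) f).
  have := poissonE (uK th) f z; rewrite /mapply -/(mean _ _); lra.
rewrite -meanB; apply: norm_mean_le; first by case: (proj2 (uK th)).
move=> x; set u := poisson (P th) _ _ x.
(* Split into the change of [f] under the new kernel, handled by linearity, and the change of kernel
   with [f] fixed. *)
rewrite -[poisson _ _ _ _](subrK (poisson (P (th' x)) (pi (th' x)) f x)) -addrA.
rewrite -(poissonB (uK (th' x))); apply: (le_trans (ler_normD _ _)).
have h1 := poisson_bound (uK (th' x)) (ff' x) x.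
have h2 : `|poisson (P (th' x)) (pi (th' x)) f x - u| <= C2 * (d * B).
  apply: (le_trans (@poisson_diff _ _ _ _ _ _ _ _ (uK th) (uK (th' x)) (KP * d) _ f B fB x)).
    move=> y y'; apply: (le_trans (PLip _ _ _ _)); exact: ler_wpM2l.
  by rewrite /C2 -/pc le_eqVlt; apply/orP; left; apply/eqP; ring.
apply: (le_trans (lerD h1 h2)); rewrite -/pc.
have e1 : 0 <= C2 * delta by rewrite mulr_ge0.
have e2 : 0 <= pc * (d * B) by rewrite !mulr_ge0.
lra.
Qed.

(** * Lyapunov argument for the fast iterates *)

Section StochasticApproximation.
Context {I : finType}.
Variables (F : Z -> Z -> (I -> R) -> I -> R) (xs : Theta -> I -> R) (lam : I -> R).
Variables (CF CX c : R).
Hypotheses (CF0 : 0 <= CF) (CX0 : 0 <= CX) (c0 : 0 < c).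
Hypothesis lam1 : forall k, 1 <= lam k.
Hypothesis F0 : forall z z' k, `|F z z' (fun=> 0) k| <= CF.
Hypothesis FLip : forall z z' x y k,
  `|F z z' x k - F z z' y k| <= CF * \sum_j `|x j - y j|.
Hypothesis xs_le : forall th k, `|xs th k| <= CX.
Hypothesis xsLip : forall th th' k, `|xs th' k - xs th k| <= CX * dist th' th.
Hypothesis drift : forall th y,
  mean (pi th) (fun z => mean (P th z) (fun z' =>
    \sum_k lam k * ((y k - xs th k) * F z z' y k)))
  <= - c * \sum_k lam k * (y k - xs th k) ^+ 2.

Variables (p0 : Z -> R) (cur : seq Z -> Z) (th : seq Z -> Theta) (x : seq Z -> I -> R).
Variables (alpha eta : nat -> R).
Hypothesis dp0 : distribution_on p0.
Hypothesis cur_cons : forall y s, cur (y :: s) = y.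
Hypothesis alpha_gt0 : forall t, 0 < alpha t.
Hypothesis alpha_noninc : forall t, alpha t.+1 <= alpha t.
Hypothesis alpha_div : ~ cvgn (series alpha).
Hypothesis alpha_van : vanishing alpha.
Hypothesis eta_ge0 : forall t, 0 <= eta t.
Hypothesis ratio_van : vanishing (fun t => eta t / alpha t).
Hypothesis th_step : forall s t y, size s = t.+1 ->
  dist (th (y :: s)) (th s) <= eta t.
Hypothesis x_step : forall s t y k, size s = t.+1 ->
  x (y :: s) k = x s k + alpha t * F (cur s) y (x s) k.

Let K s := P (th s) (cur s).
Let e s k := x s k - xs (th s) k.
Let V s := \sum_k lam k * e s k ^+ 2.
(** Common scale of all estimates at history [s], in place of a bound on the iterates: the
    increments are of order [A s], while [g], [f] and [u] are of order [A s ^+ 2], which [A2_le]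
    absorbs into [1 + V s]. *)
Let A s := 1 + \sum_k `|e s k|.

Let A1 s : 1 <= A s.
Proof. by rewrite lerDl sumr_ge0. Qed.

Let A0 s : 0 <= A s. Proof. exact: le_trans (A1 s). Qed.

Let lam0 k : 0 <= lam k. Proof. exact: le_trans (lam1 k). Qed.

Let V0 s : 0 <= V s.
Proof. by apply: sumr_ge0 => k _; rewrite mulr_ge0// sqr_ge0. Qed.

Let e_le s k : `|e s k| <= A s.
Proof.
rewrite /A (bigD1 k)//= addrCA lerDl addr_ge0// sumr_ge0//.
Qed.

Let card_I : 0 <= #|I|%:R :> R. Proof. by []. Qed.

Let CA : R := 2 * (1 + #|I|%:R).

Let A2_le s : A s ^+ 2 <= CA * (1 + V s).
Proof.
have S2 : (\sum_k `|e s k|) ^+ 2 <= #|I|%:R * V s.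
  rewrite expr2 mulr_suml.
  apply: (@le_trans _ _ (\sum_i \sum_j (`|e s i| ^+ 2 + `|e s j| ^+ 2) / 2)).
    apply: ler_sum => i _; rewrite mulr_sumr; apply: ler_sum => j _.
    have := sqr_ge0 (`|e s i| - `|e s j|); rewrite sqrrB; lra.
  have E : \sum_k `|e s k| ^+ 2 <= V s.
    apply: ler_sum => k _; rewrite real_normK ?num_real//.
    by rewrite ler_peMl ?sqr_ge0.
  have -> : \sum_i \sum_j (`|e s i| ^+ 2 + `|e s j| ^+ 2) / 2 =
      #|I|%:R * \sum_k `|e s k| ^+ 2.
    under eq_bigr do rewrite -mulr_suml big_split/= sumr_const.
    rewrite -mulr_suml big_split/= sumr_const sumrMnl.
    by move: (\sum_k _) => S; rewrite mulr_natl; lra.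
  by rewrite ler_wpM2l.
have := sqr_ge0 (1 - \sum_k `|e s k|); rewrite /A /CA.
have := card_I; have := V0 s; rewrite !expr2 in S2 *; lra.
Qed.

Let L := \sum_k lam k.
Let L0 : 0 <= L. Proof. exact: sumr_ge0. Qed.

Let C1 := CF * (1 + #|I|%:R * (1 + CX)).
Let C10 : 0 <= C1. Proof. by rewrite mulr_ge0// addr_ge0// mulr_ge0// addr_ge0. Qed.

Let F_le s z z' k : `|F z z' (x s) k| <= C1 * A s.
Proof.
rewrite -[F _ _ _ _](subrK (F z z' (fun=> 0) k)).
apply: (le_trans (ler_normD _ _)); apply: (le_trans (lerD (FLip _ _ _ _ _) (F0 _ _ _))).
rewrite /C1 -mulrA -[X in _ + X]mulr1 -mulrDr ler_wpM2l//.
have : \sum_j `|x s j - 0| <= A s - 1 + #|I|%:R * CX.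
  have -> : A s - 1 = \sum_k `|e s k| by rewrite /A addrC addKr.
  apply: (@le_trans _ _ (\sum_j (`|e s j| + CX))).
    apply: ler_sum => j _; rewrite subr0 -[x s j](subrK (xs (th s) j)).
    by apply: (le_trans (ler_normD _ _)); rewrite lerD2l.
  by rewrite big_split/= sumr_const mulr_natl.
have : 0 <= #|I|%:R * CX * (A s - 1) by rewrite !mulr_ge0// subr_ge0.
have : 0 <= #|I|%:R * A s by rewrite mulr_ge0.
lra.
Qed.

Let CP : R := #|Z|%:R * KP * (2 * L * C1).
Let CP0 : 0 <= CP. Proof. by rewrite /CP; do ?[apply: mulr_ge0 => //]. Qed.

(** First-order change of [V] per unit of step size. As [F] also sees the next state, this is
    averaged into the function [f] of the current state, for which the Poisson equation is
    solved. *)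
Let g s z z' := \sum_k lam k * (2 * (e s k * F z z' (x s) k)).
Let f s z := mean (P (th s) z) (g s z).

Let g_le s z z' : `|g s z z'| <= 2 * L * C1 * A s ^+ 2.
Proof.
have -> : 2 * L * C1 * A s ^+ 2 = \sum_k lam k * (2 * (A s * (C1 * A s))).
  by rewrite -mulr_suml -/L expr2; ring.
apply: (le_trans (ler_norm_sum _ _ _)); apply: ler_sum => k _.
by rewrite !normrM (ger0_norm (lam0 k)) ger0_norm// ler_wpM2l// ler_wpM2l// ler_pM ?e_le ?F_le.
Qed.

Let dP v z : distribution_on (P v z).
Proof. by case: (proj2 (uK v)). Qed.

Let dpi v : distribution_on (pi v).
Proof. by case: (proj2 (uK v)) => _ []. Qed.

Let f_le s z : `|f s z| <= 2 * L * C1 * A s ^+ 2.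
Proof. exact: norm_mean_le. Qed.

Let CG := 2 * L * ((C1 + CX) * (C1 + CF * #|I|%:R * C1) + CF * #|I|%:R * C1).
Let CG0 : 0 <= CG.
Proof.
by rewrite /CG; do ?[apply: mulr_ge0 => //|apply: addr_ge0 => //].
Qed.

Let pc0 : 0 <= pc. Proof. exact: (poisson_const_ge0 sigma mu01). Qed.

Let u s := poisson (P (th s)) (pi (th s)) (f s) (cur s).

Let CU := 2 * (2 * L * C1) * pc * CA.
Let CA0 : 0 <= CA. Proof. by rewrite /CA mulr_ge0// addr_ge0. Qed.
Let CU0 : 0 <= CU. Proof. by rewrite /CU; do ?[apply: mulr_ge0 => //]. Qed.

Let u_le s : `|u s| <= CU * (1 + V s).
Proof.
apply: (le_trans (poisson_bound (uK _) (f_le s) _)).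
have -> : 2 * (2 * L * C1 * A s ^+ 2) * poisson_const sigma mu =
  2 * (2 * L * C1) * pc * A s ^+ 2 by rewrite /pc; ring.
rewrite /CU -[leRHS]mulrA ler_wpM2l//; do ?[apply: mulr_ge0 => //].
Qed.

(* Adding [CU * (1 + V s)] to the Poisson correction makes it nonnegative, so
   that replacing [alpha t] by the smaller [alpha t.+1] only decreases [W]. *)
Let W t s := V s + alpha t * (u s + CU * (1 + V s)).

Let W_ge t s : V s <= W t s.
Proof.
rewrite lerDl mulr_ge0 ?(ltW (alpha_gt0 t))//.
have := u_le s; rewrite ler_norml => /andP[+ _]; lra.
Qed.

Let W_le t s : W t s <= V s + alpha t * (2 * CU * (1 + V s)).
Proof.
rewrite lerD2l ler_wpM2l ?(ltW (alpha_gt0 t))//.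
have := u_le s; rewrite ler_norml => /andP[_]; lra.
Qed.

Section Step.
Variables (s : seq Z) (t : nat).
Hypotheses (st : size s = t.+1) (at1 : alpha t <= 1) (ea : eta t <= alpha t).

Let a := alpha t.
Let a0 : 0 <= a. Proof. exact: ltW (alpha_gt0 t). Qed.

Let x_diff y k : `|x (y :: s) k - x s k| <= a * (C1 * A s).
Proof.
by rewrite (x_step _ _ st) addrAC subrr add0r normrM ger0_norm// ler_wpM2l// F_le.
Qed.

Let xs_diff y k : `|xs (th (y :: s)) k - xs (th s) k| <= CX * eta t.
Proof. by apply: (le_trans (xsLip _ _ _)); rewrite ler_wpM2l// (th_step _ st). Qed.

Let e_diff y k : `|e (y :: s) k - e s k| <= a * ((C1 + CX) * A s).
Proof.
have -> : e (y :: s) k - e s k =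
    (x (y :: s) k - x s k) - (xs (th (y :: s)) k - xs (th s) k) by rewrite /e; ring.
apply: (le_trans (ler_normB _ _)); apply: (le_trans (lerD (x_diff _ _) (xs_diff _ _))).
have : CX * eta t <= CX * (a * A s).
  rewrite ler_wpM2l// (le_trans ea)// ler_peMr//.
lra.
Qed.

Let F_diff y z z' k : `|F z z' (x (y :: s)) k - F z z' (x s) k| <=
  a * (CF * #|I|%:R * C1 * A s).
Proof.
apply: (le_trans (FLip _ _ _ _ _)).
have -> : a * (CF * #|I|%:R * C1 * A s) = CF * \sum_(j : I) a * (C1 * A s).
  by rewrite sumr_const -mulr_natl; ring.
by rewrite ler_wpM2l//; apply: ler_sum => j _; exact: x_diff.
Qed.

Let g_diff y z z' : `|g (y :: s) z z' - g s z z'| <= a * (CG * A s ^+ 2).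
Proof.
set D := CF * #|I|%:R * C1.
have D0 : 0 <= D by rewrite /D; do ?[apply: mulr_ge0 => //].
have -> : a * (CG * A s ^+ 2) = \sum_k lam k *
   (2 * (a * ((C1 + CX) * A s) * ((C1 + D) * A s) + A s * (a * (D * A s)))).
  by rewrite -mulr_suml -/L /CG -/D expr2; ring.
rewrite -sumrB; apply: (le_trans (ler_norm_sum _ _ _)); apply: ler_sum => k _.
rewrite -mulrBr normrM (ger0_norm (lam0 k)) ler_wpM2l//.
rewrite -mulrBr normrM ger0_norm// ler_wpM2l//.
have -> : e (y :: s) k * F z z' (x (y :: s)) k - e s k * F z z' (x s) k =
  (e (y :: s) k - e s k) * F z z' (x (y :: s)) k
  + e s k * (F z z' (x (y :: s)) k - F z z' (x s) k) by ring.
apply: (le_trans (ler_normD _ _)); rewrite lerD// normrM ler_pM ?e_diff ?e_le ?F_diff//.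
rewrite -[F _ _ _ _](subrK (F z z' (x s) k)).
apply: (le_trans (ler_normD _ _)); apply: (le_trans (lerD (F_diff _ _ _ _) (F_le _ _ _ _))).
rewrite -/D mulrDl addrC lerD2l ler_piMl// mulr_ge0//.
Qed.

Lemma f_diff y z : `|f (y :: s) z - f s z| <= a * ((CG + CP) * A s ^+ 2).
Proof.
rewrite -[f (y :: s) z](subrK (mean (P (th (y :: s)) z) (g s z))) -addrA.
apply: (le_trans (ler_normD _ _)).
have -> : a * ((CG + CP) * A s ^+ 2) = a * (CG * A s ^+ 2) + a * (CP * A s ^+ 2).
  by ring.
rewrite lerD//; first by rewrite /f -meanB; apply: norm_mean_le => // z'; exact: g_diff.
have H : forall z z', `|P (th (y :: s)) z z' - P (th s) z z'| <= KP * a.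
  move=> v v'; apply: (le_trans (PLip _ _ _ _)); rewrite ler_wpM2l//.
  exact: le_trans (th_step _ st) ea.
have := @mapply_diff _ _ _ _ _ H (g s z) _ z (g_le s z).
move=> /le_trans; apply; rewrite /CP le_eqVlt; apply/orP; left; apply/eqP; ring.
Qed.

Let CV := L * (2 * CX + (C1 + CX) ^+ 2).
Let CV0 : 0 <= CV.
Proof. by rewrite /CV mulr_ge0// addr_ge0 ?sqr_ge0// mulr_ge0. Qed.

(** In [CV], the part [2 * CX] pays for the motion of the target, which is of order [eta t], and
    [(C1 + CX) ^+ 2] for the square of the increment. *)
Let V_step y : V (y :: s) <= V s + a * g s (cur s) y + CV * (eta t + a ^+ 2) * A s ^+ 2.
Proof.
have [w wE] : exists w, w = (2 * CX + (C1 + CX) ^+ 2) * (eta t + a ^+ 2) * A s ^+ 2.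
  by eexists.
have -> : V s + a * g s (cur s) y + CV * (eta t + a ^+ 2) * A s ^+ 2 =
  \sum_k lam k * (e s k ^+ 2 + a * (2 * (e s k * F (cur s) y (x s) k)) + w).
  under [RHS]eq_bigr do rewrite !mulrDr (mulrCA _ a).
  by rewrite !big_split/= -!mulr_suml -mulr_sumr -/L -/(V s) -/(g _ _ _) /CV wE; ring.
apply: ler_sum => k _; rewrite ler_wpM2l// wE.
set D := xs (th (y :: s)) k - xs (th s) k.
have eE : e (y :: s) k = e s k + a * F (cur s) y (x s) k - D.
  by rewrite /e (x_step _ _ st) -/a /D; ring.
have -> : e (y :: s) k ^+ 2 = e s k ^+ 2 + a * (2 * (e s k * F (cur s) y (x s) k))
    - 2 * (e s k * D) + (e (y :: s) k - e s k) ^+ 2 by rewrite eE; ring.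
have h1 : `|e s k * D| <= A s * (CX * eta t) by rewrite normrM ler_pM ?e_le ?xs_diff.
have h2 : (e (y :: s) k - e s k) ^+ 2 <= (a * ((C1 + CX) * A s)) ^+ 2.
  rewrite -(real_normK (num_real (e (y :: s) k - e s k))) ler_pXn2r ?nnegrE ?e_diff//.
  by do ?[apply: mulr_ge0 => //|apply: addr_ge0 => //].
have h3 : A s * (CX * eta t) <= CX * eta t * A s ^+ 2.
  by rewrite [leLHS]mulrC expr2 mulrA ler_peMr//; do ?[apply: mulr_ge0 => //].
have h4 : 0 <= CX * a ^+ 2 * A s ^+ 2 by rewrite !mulr_ge0 ?sqr_ge0.
have h5 : 0 <= (C1 + CX) ^+ 2 * eta t * A s ^+ 2 by do ?[exact: sqr_ge0|apply: mulr_ge0 => //].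
have := ler_norm (- (e s k * D)); rewrite normrN => h6.
rewrite !exprMn in h2; lra.
Qed.

Let dK : distribution_on (K s). Proof. exact: dP. Qed.

Let V_mean : mean (K s) (fun y => V (y :: s)) <=
  V s + a * f s (cur s) + CV * (eta t + a ^+ 2) * A s ^+ 2.
Proof.
apply: (le_trans (le_mean dK V_step)).
rewrite meanD (mean_cst dK) lerD2r (meanD _ (fun=> V s) (fun y => a * g s (cur s) y)).
by rewrite (mean_cst dK) meanZ.
Qed.

Variable CS : R.
Hypothesis u_step : mean (K s) (fun y => u (y :: s)) <=
  u s - f s (cur s) + mean (pi (th s)) (f s) + a * (CS * A s ^+ 2).

Let drift_f : mean (pi (th s)) (f s) <= - (2 * c) * V s.
Proof.
have -> : mean (pi (th s)) (f s) = 2 * mean (pi (th s)) (fun z => mean (P (th s) z)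
    (fun z' => \sum_k lam k * ((x s k - xs (th s) k) * F z z' (x s) k))).
  rewrite -meanZ; apply: eq_mean => z; rewrite /f -meanZ; apply: eq_mean => z'.
  by rewrite /g mulr_sumr; apply: eq_bigr => k _; rewrite mulrCA.
rewrite mulNr -mulrA -mulrN ler_wpM2l// -mulNr; exact: drift.
Qed.

Hypothesis CS0 : 0 <= CS.

(** The sampled drift [a * f s (cur s)] of [V] cancels against the one released by the Poisson
    correction, which leaves its stationary mean, at most [- 2 * c * V s]. *)
Let W_step : mean (K s) (fun y => W t.+1 (y :: s)) <= W t s - 2 * c * a * V s
  + a * (eta t / a + a) * ((CV + CS + CU * (2 * L * C1 + 2 * CV)) * CA) * (1 + V s).
Proof.
have W'_le y : W t.+1 (y :: s) <=
    (1 + a * CU) * V (y :: s) + a * u (y :: s) + a * CU.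
  have -> : (1 + a * CU) * V (y :: s) + a * u (y :: s) + a * CU =
    V (y :: s) + a * (u (y :: s) + CU * (1 + V (y :: s))) by ring.
  rewrite lerD2l ler_wpM2r ?alpha_noninc//.
  have := u_le (y :: s); rewrite ler_norml => /andP[+ _]; lra.
apply: (le_trans (le_mean dK W'_le)).
rewrite meanD (mean_cst dK) meanD !meanZ.
have aCU0 : 0 <= a * CU by rewrite mulr_ge0.
have h1 : a * CU * mean (K s) (fun y => V (y :: s)) <=
    a * CU * (V s + a * (2 * L * C1 + 2 * CV) * A s ^+ 2).
  rewrite ler_wpM2l//; apply: (le_trans V_mean); rewrite -addrA lerD2l.
  have := ler_wpM2l a0 (le_trans (ler_norm _) (f_le s (cur s))).
  have : CV * A s ^+ 2 * (eta t + a ^+ 2) <= CV * A s ^+ 2 * (2 * a).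
    rewrite ler_wpM2l ?(mulr_ge0 CV0) ?sqr_ge0// mulr2n mulrDl mul1r lerD//.
    by rewrite expr2 ler_piMr.
  lra.
have h2 := ler_wpM2l a0 u_step.
have h3 := V_mean.
have h4 : a * mean (pi (th s)) (f s) <= a * (- (2 * c) * V s) by rewrite ler_wpM2l.
have h5 : 0 <= eta t * (CS + CU * (2 * L * C1 + 2 * CV)) * A s ^+ 2.
  rewrite mulr_ge0 ?sqr_ge0// mulr_ge0// addr_ge0// mulr_ge0// addr_ge0//.
    by rewrite -mulrA; do ?[apply: mulr_ge0 => //].
  by rewrite mulr_ge0.
have -> : a * (eta t / a + a) = eta t + a ^+ 2.
  have aN0 : a != 0 := lt0r_neq0 (alpha_gt0 t).
  by rewrite mulrDr mulrCA divff// mulr1 expr2.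
set M := CV + CS + _.
have M0 : 0 <= M.
  rewrite /M addr_ge0//; first by rewrite addr_ge0.
  rewrite mulr_ge0// addr_ge0//; last by rewrite mulr_ge0.
  by rewrite -mulrA; do ?[apply: mulr_ge0 => //].
have h6 : (eta t + a ^+ 2) * M * A s ^+ 2 <= (eta t + a ^+ 2) * M * (CA * (1 + V s)).
  by rewrite ler_wpM2l// mulr_ge0// addr_ge0// sqr_ge0.
rewrite (mulrA _ M CA) -(mulrA _ CA).
apply: le_trans (lerD (lexx _) h6).
rewrite /W -/a /M; lra.
Qed.

(** Of the decrease [2 * c * a * V s], one half absorbs the error proportional to [V s]. The other
    half is rewritten in terms of [W] using [W t s <= 2 * V s + 2 * a * CU]. *)
Lemma W_contract : 2 * a * CU <= 1 ->
  (eta t / a + a) * ((CV + CS + CU * (2 * L * C1 + 2 * CV)) * CA) <= c ->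
  mean (K s) (fun y => W t.+1 (y :: s)) <= (1 - c / 2 * a) * W t s
    + ((eta t / a + a) * ((CV + CS + CU * (2 * L * C1 + 2 * CV)) * CA) + c * (a * CU)) * a.
Proof.
move=> aCU; set M := (_ / a + a) * _ => Mc; apply: (le_trans W_step).
rewrite -(mulrA a) -/M.
have h1 : W t s <= 2 * V s + 2 * a * CU.
  apply: (le_trans (W_le t s)); rewrite -/a.
  have := ler_wpM2r (V0 s) aCU; lra.
have ac0 : 0 <= a * c by rewrite mulr_ge0// ltW.
have := ler_wpM2l ac0 h1.
have aV0 : 0 <= a * V s by rewrite mulr_ge0.
have := ler_wpM2l aV0 Mc.
lra.
Qed.

End Step.

Lemma sa_vanishing : vanishing (fun t => Ex p0 K t V).
Proof.
have [Cps Cps0 ps] := poisson_step.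
pose CS := Cps * (CG + CP + 2 * L * C1).
have L20 : 0 <= 2 * L * C1 by rewrite -mulrA; do ?[apply: mulr_ge0 => //].
have CS0 : 0 <= CS by rewrite mulr_ge0// addr_ge0// addr_ge0.
pose CV := L * (2 * CX + (C1 + CX) ^+ 2).
have CV0 : 0 <= CV by rewrite /CV mulr_ge0// addr_ge0 ?sqr_ge0// mulr_ge0.
pose M := (CV + CS + CU * (2 * L * C1 + 2 * CV)) * CA.
have M0 : 0 <= M.
  rewrite mulr_ge0// addr_ge0//; first by rewrite addr_ge0.
  by rewrite mulr_ge0// addr_ge0// mulr_ge0.
have dK' s : distribution_on (K s) by exact: dP.
have W0 t s : 0 <= W t s by exact: le_trans (W_ge t s).
have rho_van : vanishing (fun t => (eta t / alpha t + alpha t) * M).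
  apply: (@vanishing_le _ _ (fun t => M * (eta t / alpha t + alpha t))).
    by near=> t; rewrite mulrC.
  by apply: vanishingZ => //; exact: vanishingD.
suff : vanishing (fun t => Ex p0 K t (W t)).
  apply: vanishing_le; near=> t; apply: Ex_le => // s _; exact: W_ge.
apply: (@contraction_vanishing _ _ alpha
  (fun t => (eta t / alpha t + alpha t) * M + c * (alpha t * CU)) (c / 2)) => //.
- by rewrite divr_gt0.
- by move=> t; apply: Ex_ge0.
- apply: vanishingD => //.
  apply: (@vanishing_le _ _ (fun t => (c * CU) * alpha t)).
    by near=> t; rewrite mulrCA mulrC.
  by apply: vanishingZ => //; rewrite mulr_ge0// ltW.
have CU_van : vanishing (fun t => 2 * CU * alpha t).
  by apply: vanishingZ => //; rewrite mulr_ge0.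
have small : \forall t \near \oo, [/\ alpha t <= 1, 2 * CU * alpha t <= 1,
    eta t / alpha t <= 1 & (eta t / alpha t + alpha t) * M <= c].
  near=> t; split; near: t.
  - exact: alpha_van.
  - exact: CU_van.
  - exact: ratio_van.
  - exact: rho_van.
near=> t.
have [at1 aCU hr rc] : [/\ alpha t <= 1, 2 * CU * alpha t <= 1,
    eta t / alpha t <= 1 & (eta t / alpha t + alpha t) * M <= c] by near: t.
have ea : eta t <= alpha t by rewrite ler_pdivrMr// mul1r in hr.
rewrite -(@ExZ _ _ p0 K dp0 dK') -[X in _ <= _ + X](@Ex_cst _ _ p0 K dp0 dK' t) -ExD//.
(* [Ex] at time [t.+1] unfolds to [Ex] at time [t] of a one-step mean, so an estimate conditional on
   the history is enough. *)
rewrite [Ex p0 K t.+1 _]/=; apply: Ex_le => // s st.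
apply: W_contract => //; last by rewrite mulrAC.
have := ps (th s) (fun y => th (y :: s)) (f s) (fun y => f (y :: s))
  (2 * L * C1 * A s ^+ 2) (alpha t * ((CG + CP) * A s ^+ 2)) (eta t) (cur s) (eta_ge0 t)
  (f_le s) (fun y z => f_diff st at1 ea y z) (fun y => th_step y st).
rewrite (eq_mean (fun y => u (y :: s))); last by move=> y; rewrite /u cur_cons.
rewrite ler_norml => /andP[_]; rewrite lerBlDl -/(u s) => /le_trans; apply.
rewrite lerD2l /CS.
have : Cps * (2 * L * C1 * A s ^+ 2) * eta t <= Cps * (2 * L * C1 * A s ^+ 2) * alpha t.
  by rewrite ler_wpM2l// mulr_ge0// mulr_ge0// sqr_ge0.
lra.
Unshelve. all: by end_near. Qed.

End StochasticApproximation.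
End ControlledChain.

(** * Finite products, the mean value theorem, and the operator norm *)

(** Distributivity for dependent families, through their encoding as functions into a tagged
    union. *)
Lemma sum_dffun_prod (R : comNzRingType) (I : finType) (T : I -> finType)
    (g : forall i, T i -> R) :
  \sum_(s : {dffun forall i, T i}) \prod_i g i (s i) = \prod_i \sum_(x : T i) g i x.
Proof.
rewrite (reindex (@dffun_of_fprod I T)); last exact/onW_bij/dffun_of_fprod_bij.
pose P i := finfun (g i).
transitivity (\sum_(t : fprod T) \prod_(i in I) P i (t i)).
  by apply: eq_bigr => t _; apply: eq_bigr => i _; rewrite !ffunE.
transitivity (\prod_i \sum_(x : T i) P i x); last first.
  by apply: eq_bigr => i _; apply: eq_bigr => x _; rewrite ffunE.
rewrite big_fprod; under [RHS]eq_bigr do rewrite (big_tag (fun i x => P i x)).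
by rewrite bigA_distr_big_dep.
Qed.

Section Directional.
Context {R : realType} {d : nat}.
Implicit Types (f : 'rV[R]_d -> R) (x v : 'rV[R]_d).

Lemma derive_dot f x v : differentiable f x -> 'D_v f x = dot (gradient f x) v.
Proof.
move=> df; rewrite deriveE// [in LHS](row_sum_delta v) linear_sum/=.
by apply: eq_bigr => j _; rewrite linearZ/= mxE deriveE// mulrC.
Qed.

Lemma mvt_dot f x v : (forall y, differentiable f y) ->
  exists2 c, 0 <= c <= 1 & f (x + v) - f x = dot (gradient f (x + c *: v)) v.
Proof.
move=> df; pose phi (t : R) := f (x + t *: v).
have dphi (t : R) : is_derive t 1 phi (dot (gradient f (x + t *: v)) v).
  have E : (fun h : R => h^-1 *: ((phi \o shift t) (h *: 1) - phi t)) =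
      (fun h : R => h^-1 *: ((f \o shift (x + t *: v)) (h *: v) - f (x + t *: v))).
    apply: funext => h; rewrite /phi/=; congr (_ *: (f _ - _)).
    by rewrite [h *: 1]mulr1 scalerDl addrCA.
  have dv : derivable f (x + t *: v) v by exact: diff_derivable.
  apply: DeriveDef; first by rewrite /derivable E.
  by rewrite -derive_dot// /derive E.
have cphi : {within `[0, 1], continuous phi}.
  apply: continuous_subspaceT => t; apply: differentiable_continuous.
  by apply/derivable1_diffP; case: (dphi t).
have [c c01 H] := MVT_segment ler01 (fun t _ => dphi t) cphi.
exists c; first by rewrite in_itv in c01.
by move: H; rewrite /phi scale1r scale0r addr0 subr0 mulr1.
Qed.

Lemma lipschitz_of_gradient f (L : R) : (forall y, differentiable f y) ->
  (forall y, enorm (gradient f y) <= L) ->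
  forall x y, `|f y - f x| <= L * enorm (y - x).
Proof.
move=> df fL x y; have [c _ ] := mvt_dot x (y - x) df.
rewrite subrKC => ->; apply: (le_trans (dot_le_enorm _ _)).
by rewrite ler_wpM2r ?enorm_ge0.
Qed.

(** The mean value theorem along the segment. The absolute value covers a Lipschitz constant of
    unspecified sign. *)
Lemma taylor2_of_gradient f (K : R) : (forall y, differentiable f y) ->
  elipschitz K (gradient f) ->
  forall x y, `|f y - f x - dot (gradient f x) (y - x)| <= `|K| * enorm (y - x) ^+ 2.
Proof.
move=> df fK x y; have [c /andP[c0 c1] ] := mvt_dot x (y - x) df.
rewrite subrKC => ->; rewrite dotC (dotC (gradient f x)) -dotBr dotC.
apply: (le_trans (dot_le_enorm _ _)); rewrite expr2 mulrA ler_wpM2r ?enorm_ge0//.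
apply: (le_trans (fK _ _)); rewrite addrAC subrr add0r enormZ ger0_norm//.
apply: (le_trans (ler_wpM2r _ (ler_norm K))); first by rewrite mulr_ge0 ?enorm_ge0.
by rewrite ler_wpM2l// ler_piMl ?enorm_ge0.
Qed.

End Directional.

Lemma derive_of_quadratic (R : realType) d (f : 'rV[R]_d -> R) (x v : 'rV[R]_d) (D C : R) :
  (forall h, `|h| <= 1 -> `|f (x + h *: v) - f x - h * D| <= C * h ^+ 2) ->
  'D_v f x = D.
Proof.
move=> H; apply: cvg_lim => //; apply/cvgrPdist_le => e e0; near=> h.
have h0 : h != 0 by near: h; exact: nbhs_dnbhs_neq.
have h1 : `|h| <= 1 by near: h; apply: dnbhs0_le.
have hC : `|h| <= e / (`|C| + 1).
  by near: h; apply: dnbhs0_le; rewrite divr_gt0// ltr_wpDl.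
rewrite distrC /= (addrC (h *: v)).
have -> : h^-1 *: (f (x + h *: v) - f x) - D = h^-1 * (f (x + h *: v) - f x - h * D).
  by rewrite mulrBr mulKf.
rewrite normrM normfV mulrC ler_pdivrMr ?normr_gt0//; apply: (le_trans (H _ h1)).
rewrite -(real_normK (num_real h)) expr2 mulrA ler_wpM2r//.
apply: (@le_trans _ _ ((`|C| + 1) * `|h|)).
  by rewrite ler_wpM2r// (le_trans (ler_norm _))// lerDl.
by move: hC; rewrite ler_pdivlMr ?ltr_wpDl// mulrC.
Unshelve. all: by end_near. Qed.

(** The exponential has slope at most 1 where its values are at most 1; thus Lipschitz
    log-probabilities give Lipschitz probabilities with the same constant. *)
Lemma expR_le1_lipschitz (R : realType) (x y : R) : expR x <= 1 -> expR y <= 1 ->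
  `|expR x - expR y| <= `|x - y|.
Proof.
suff H (a b : R) : expR a <= 1 -> expR a - expR b <= `|a - b|.
  by move=> x1 y1; rewrite ler_norml lerNl opprB (distrC x) !H// distrC H.
move=> a1; have : expR a * (1 + (b - a)) <= expR a * expR (b - a).
  by rewrite ler_wpM2l ?expR_ge0 ?expR_ge1Dx.
rewrite -expRD subrKC => h1.
have : expR a * (a - b) <= `|a - b|.
  apply: (le_trans (ler_norm _)); rewrite normrM ger0_norm ?expR_ge0//.
  by rewrite ler_piMl.
lra.
Qed.

(** The supremum is evaluated at [x] rescaled to norm 1; norm 0 forces [x] to vanish because [p] is
    positive everywhere. *)
Lemma uniform_kernel_Dopnorm (R : realType) (Z : finType) (sigma mu : R) P
    (p : Z -> R) : 0 < sigma -> 0 < mu < 1 ->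
  (forall z, distribution_on (P z)) -> stationary P p -> (forall z, sigma <= p z) ->
  (Dopnorm p (fun z z' => (P z z' - p z')%R) <= mu%:E)%E ->
  uniform_kernel sigma mu P p.
Proof.
move=> s0 mu01 dP st sp Dop; split=> //; split=> // x.
have dp : distribution_on p by case: st.
set M := fun z z' => _ in Dop *.
have [x0|x0] := eqVneq (Dnorm p x) 0.
  have {}x0 z : x z = 0.
    have : mean p (fun z => x z ^+ 2) == 0 by rewrite -sqr_Dnorm// x0 expr0n.
    rewrite psumr_eq0; last by move=> y _; rewrite mulr_ge0 ?sqr_ge0//; case: dp.
    move=> /allP/(_ z); rewrite mem_index_enum => /(_ isT)/=.
    by rewrite mulf_eq0 gt_eqF ?(lt_le_trans s0)//= sqrf_eq0 => /eqP.
  rewrite (_ : Dnorm p (mapply M x) = 0).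
    by rewrite mulr_ge0 ?Dnorm_ge0//; case/andP: mu01 => /ltW.
  rewrite /Dnorm big1 ?sqrtr0// => z _.
  by rewrite (_ : mapply M x z = 0) ?mul0r// /mapply big1// => y _; rewrite x0 mulr0.
have xp : 0 < Dnorm p x by rewrite lt_neqAle eq_sym x0 Dnorm_ge0.
have : ((Dnorm p (mapply M (fun z => (Dnorm p x)^-1 * x z)))%:E <= mu%:E)%E.
  apply: le_trans Dop; apply: ereal_sup_ubound; eexists; last reflexivity.
  by rewrite /= DnormZ// gtr0_norm ?invr_gt0// mulVf.
rewrite lee_fin (@eq_Dnorm _ _ _ _ (fun z => (Dnorm p x)^-1 * mapply M x z)).
  by rewrite DnormZ// gtr0_norm ?invr_gt0// mulrC ler_pdivrMr.
by move=> z; exact: mapplyZ.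
Qed.

(** * Product structure and smoothness of the model *)

Section ProductStructure.
Context {R : realType} {n : nat}.
Variable G : networked_mdp R n.

Lemma joint_trans_distr (z : state_action G) : distribution_on (joint_trans z).
Proof.
have dt i := ptrans_distr (restr (closed_nbhd (edge G) i) z.1) (z.2 i).
split=> [s|]; first by apply: prodr_ge0 => i _; case: (dt i).
rewrite /joint_trans.
rewrite (sum_dffun_prod (fun i => ptrans (restr (closed_nbhd (edge G) i) z.1) (z.2 i))).
by rewrite big1// => i _; case: (dt i).
Qed.

Lemma joint_policy_distr (th : params G) s : distribution_on (joint_policy th s).
Proof.
split=> [a|]; first by apply: prodr_ge0 => i _; case: (policy_distr (submxrow th i) (s i)).
rewrite /joint_policy (sum_dffun_prod (fun i => policy (submxrow th i) (s i))).
by rewrite big1// => i _; case: (policy_distr (submxrow th i) (s i)).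
Qed.

Lemma Ptheta_distr (th : params G) z : distribution_on (Ptheta th z).
Proof.
have [t0 t1] := joint_trans_distr z; split=> [z'|].
  by rewrite mulr_ge0//; case: (joint_policy_distr th z'.1).
rewrite -(pair_bigA _ (fun s a => joint_trans z s * joint_policy th s a))/=.
under eq_bigr do rewrite -mulr_sumr.
rewrite -[RHS]t1; apply: eq_bigr => s _.
by case: (joint_policy_distr th s) => _ ->; rewrite mulr1.
Qed.

Definition upd (T : 'I_n -> finType) (s : conf T) (i : 'I_n) (x : T i) : conf T :=
  [ffun j => @eqtype.dfwith _ (fun j => T j) (fun j => s j) i x j].

Lemma upd_in (T : 'I_n -> finType) (s : conf T) i (x : T i) : upd s x i = x.
Proof. by rewrite ffunE eqtype.dfwith_in. Qed.

Lemma upd_out (T : 'I_n -> finType) (s : conf T) i (x : T i) j : i != j ->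
  upd s x j = s j.
Proof. by move=> ij; rewrite ffunE eqtype.dfwith_out. Qed.

Lemma updK (T : 'I_n -> finType) (s : conf T) i (x : T i) : upd (upd s x) (s i) = s.
Proof.
apply/ffunP => j; have [<-|ij] := eqVneq i j; first by rewrite upd_in.
by rewrite !upd_out.
Qed.

(** Walks can be reversed. This exchanges the agents whose Q-functions feed the actor [i] with those
    whose Q-functions see the action of [i]. *)
Lemma nbhdk_sym k i j : (j \in nbhdk (edge G) k i) = (i \in nbhdk (edge G) k j).
Proof.
suff H i' j' : j' \in nbhdk (edge G) k i' -> i' \in nbhdk (edge G) k j'.
  by apply/idP/idP; exact: H.
rewrite !inE => /existsP[m /existsP[p /andP[ep /eqP lp]]].
apply/existsP; exists m; apply/existsP.
have sz : size (rev (belast i' p)) == m by rewrite size_rev size_belast size_tuple.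
exists (Tuple sz); rewrite /= -lp rev_path.
rewrite (@eq_path _ _ (edge G)) ?ep/=; last by move=> x y; rewrite edge_sym.
by case: (tval p) => //= x q; rewrite rev_cons last_rcons.
Qed.

Lemma zloc_upd k i j s (a : conf (Ac G)) (b : Ac G i) : i \notin nbhdk (edge G) k j ->
  zloc k j (s, upd a b) = zloc k j (s, a).
Proof.
move=> ij; congr (_, _); apply/ffunP => -[l lj]; rewrite !ffunE /= eqtype.dfwith_out//.
by apply: contraNneq ij => ->.
Qed.

(** A local configuration is completed by that of [z0], which also supplies inhabitants of the state
    and action sets. The cast along an equality of indices is the identity by [eq_axiomK]. *)
Lemma zloc_surj (z0 : state_action G) k i (x : local_state_action G k i) :
  exists z, zloc k i z = x.
Proof.
pose ext (T : 'I_n -> finType) (s0 : conf T) (y : sub_conf T (nbhdk (edge G) k i)) : conf T :=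
  [ffun j => if insub j is Some u then
    (if val u =P j is ReflectT e then ecast j (T j) e (y u) else s0 j) else s0 j].
have extE (T : 'I_n -> finType) s0 y : restr (nbhdk (edge G) k i) (@ext T s0 y) = y.
  apply/ffunP => -[j ji]; rewrite !ffunE/= insubT/=.
  case: eqP => //= e; by rewrite (eq_axiomK e).
by exists (ext _ z0.1 x.1, ext _ z0.2 x.2); case: x => x1 x2; rewrite /zloc !extE.
Qed.

End ProductStructure.

Section SmoothPolicies.
Context {R : realType} {n : nat}.
Variables (G : networked_mdp R n) (pi : params G -> state_action G -> R).
Variables (sigma muD : R) (Li Li' : 'I_n -> R) (L' : R).
Hypotheses (A4 : uniformly_ergodic pi sigma muD) (A5 : smooth pi Li Li' L').
Variable z0 : state_action G.

Let sigma0 : 0 < sigma. Proof. by case: A4. Qed.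
Let mu01 : 0 < muD < 1. Proof. by case: A4. Qed.

Lemma model_kernel th : uniform_kernel sigma muD (Ptheta th) (pi th).
Proof.
have [_ _ /(_ th)[_ st sp Dop]] := A4.
exact: uniform_kernel_Dopnorm (@Ptheta_distr _ _ _ _) st sp Dop.
Qed.

Let dpi th : distribution_on (pi th).
Proof. by case: (proj2 (model_kernel th)) => _ []. Qed.

(** One step of invariance: whatever the past, the action is drawn from the policy given the new
    state. *)
Lemma stationary_factor th z : pi th z =
  mean (pi th) (fun y => joint_trans y z.1) * joint_policy th z.1 z.2.
Proof.
case: (proj2 (model_kernel th)) => _ [_ <-] _ _.
by rewrite mulr_suml; apply: eq_bigr => y _; rewrite mulrA.
Qed.

(** A zero factor would contradict [sigma <= pi] through [stationary_factor]; the other parameter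
    blocks are filled with 0. Positivity makes [expR] undo the logarithm in [log_policy]. *)
Lemma policy_gt0 i (th : 'rV[R]_(Defs.dim G i)) s a : 0 < policy th s a.
Proof.
pose f0 (j : 'I_n) : 'rV[R]_(Defs.dim G j) := 0.
pose T : params G := \mxrow_j @eqtype.dfwith _ (fun j => 'rV[R]_(Defs.dim G j)) f0 i th j.
pose z : state_action G := (upd z0.1 s, upd z0.2 a).
have : pi T z != 0.
  by case: (proj2 (model_kernel T)) => _ _ sp _; rewrite gt_eqF// (lt_le_trans sigma0).
rewrite stationary_factor mulf_eq0 negb_or => /andP[_].
rewrite /joint_policy (bigD1 i)//= mulf_eq0 negb_or => /andP[+ _].
rewrite mxrowK eqtype.dfwith_in !upd_in lt_neqAle eq_sym => ->/=.
by case: (policy_distr th s).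
Qed.

Lemma policy_le1 i (th : 'rV[R]_(Defs.dim G i)) s a : policy th s a <= 1.
Proof.
case: (policy_distr th s) => p0 <-; rewrite (bigD1 a)//= lerDl.
by apply: sumr_ge0 => b _.
Qed.

Lemma expR_log_policy i s a (th : 'rV[R]_(Defs.dim G i)) :
  expR (log_policy s a th) = policy th s a.
Proof. by rewrite lnK// posrE policy_gt0. Qed.

Lemma Li_ge0 i : 0 <= Li i.
Proof.
have [_ sL _ _ _] := A5.
exact: le_trans (enorm_ge0 _) (sL i (z0.1 i) (z0.2 i) 0).
Qed.

Definition log_joint (th : params G) (z : state_action G) : R :=
  \sum_i log_policy (z.1 i) (z.2 i) (submxrow th i).

Definition score_vec (th : params G) (z : state_action G) : params G :=
  \mxrow_i score (z.1 i) (z.2 i) (submxrow th i).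

Lemma expR_log_joint th z : expR (log_joint th z) = joint_policy th z.1 z.2.
Proof. by rewrite expR_sum; apply: eq_bigr => i _; rewrite expR_log_policy. Qed.

Lemma dot_score_vec th z v : dot (score_vec th z) v =
  \sum_i dot (score (z.1 i) (z.2 i) (submxrow th i)) (submxrow v i).
Proof. by rewrite dot_block; apply: eq_bigr => i _; rewrite mxrowK. Qed.

Lemma enorm_score_vec th z : enorm (score_vec th z) <= Num.sqrt (\sum_i Li i ^+ 2).
Proof.
rewrite -(@ler_pXn2r _ 2) ?nnegrE ?enorm_ge0 ?sqrtr_ge0// enorm_block.
rewrite sqr_sqrtr ?sumr_ge0//; last by move=> i _; rewrite sqr_ge0.
apply: ler_sum => i _; rewrite mxrowK ler_pXn2r ?nnegrE ?enorm_ge0 ?Li_ge0//.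
by case: A5.
Qed.

Let KL := \sum_i Li i.
Let KL' := \sum_i `|Li' i|.

Lemma KL_ge0 : 0 <= KL. Proof. by apply: sumr_ge0 => i _; exact: Li_ge0. Qed.

Lemma log_joint_lipschitz th th' z :
  `|log_joint th' z - log_joint th z| <= KL * enorm (th' - th).
Proof.
have [df sL _ _ _] := A5.
rewrite /log_joint -sumrB mulr_suml; apply: (le_trans (ler_norm_sum _ _ _)).
apply: ler_sum => i _.
apply: (le_trans (lipschitz_of_gradient (df i _ _) (sL i _ _) _ _)).
by rewrite -submxrowB ler_wpM2l ?Li_ge0// enorm_submxrow.
Qed.

Lemma log_joint_taylor th th' z :
  `|log_joint th' z - log_joint th z - dot (score_vec th z) (th' - th)|
  <= KL' * enorm (th' - th) ^+ 2.
Proof.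
have [df _ sL _ _] := A5.
rewrite dot_score_vec /log_joint -!sumrB mulr_suml.
apply: (le_trans (ler_norm_sum _ _ _)); apply: ler_sum => i _.
rewrite submxrowB; apply: (le_trans (taylor2_of_gradient (df i _ _) (sL i _ _) _ _)).
by rewrite ler_wpM2l// -submxrowB ler_pXn2r ?nnegrE ?enorm_ge0 ?enorm_submxrow.
Qed.

Lemma joint_policy_le1 (th : params G) s a : joint_policy th s a <= 1.
Proof.
have [p0 <-] := joint_policy_distr th s; rewrite (bigD1 a)//= lerDl.
by apply: sumr_ge0.
Qed.

Lemma joint_trans_le1 (z : state_action G) s : joint_trans z s <= 1.
Proof.
have [p0 <-] := joint_trans_distr z; rewrite (bigD1 s)//= lerDl.
by apply: sumr_ge0.
Qed.

Lemma Ptheta_lipschitz (th th' : params G) z z' :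
  `|Ptheta th' z z' - Ptheta th z z'| <= KL * enorm (th' - th).
Proof.
rewrite -mulrBr normrM ger0_norm; last by case: (joint_trans_distr z).
apply: (@le_trans _ _ `|joint_policy th' z'.1 z'.2 - joint_policy th z'.1 z'.2|).
  by rewrite ler_piMl// joint_trans_le1.
rewrite -!expR_log_joint; apply: le_trans (log_joint_lipschitz _ _ _).
by apply: expR_le1_lipschitz; rewrite expR_log_joint joint_policy_le1.
Qed.

(** The ratio of the two kernels is the exponential of a log-ratio with linear part
    [dot (score_vec th z') (th' - th)]. Scores are bounded and Lipschitz uniformly in the parameter,
    hence a single [C]. *)
Lemma Ptheta_taylor : exists2 C, 0 <= C & forall (th th' : params G) z z',
  enorm (th' - th) <= 1 ->
  `|Ptheta th' z z' - Ptheta th z z' - Ptheta th z z' * dot (score_vec th z') (th' - th)|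
  <= C * enorm (th' - th) ^+ 2.
Proof.
pose L := Num.sqrt (\sum_i Li i ^+ 2).
have KL'0 : 0 <= KL' by exact: sumr_ge0.
have [|C C0 HC] := @expR_linearization R (L + KL').
  by rewrite addr_ge0 ?sqrtr_ge0.
exists C => // th th' z z' d1.
have -> : Ptheta th' z z' - Ptheta th z z' - Ptheta th z z' * dot (score_vec th z') (th' - th)
  = Ptheta th z z' * (expR (log_joint th' z' - log_joint th z') - 1
     - dot (score_vec th z') (th' - th)).
  have pE : joint_policy th' z'.1 z'.2 =
      joint_policy th z'.1 z'.2 * expR (log_joint th' z' - log_joint th z').
    by rewrite -!expR_log_joint -expRD subrKC.
  by rewrite /Ptheta pE; ring.
rewrite normrM -[leRHS]mul1r ler_pM//.
  have [P0 _] := Ptheta_distr th z; rewrite ger0_norm// -[leRHS]mul1r ler_pM//.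
  - by case: (joint_trans_distr z).
  - by case: (joint_policy_distr th z'.1).
  - exact: joint_trans_le1.
  - exact: joint_policy_le1.
have e0 := enorm_ge0 (th' - th).
apply: HC; first by rewrite e0.
  apply: (le_trans (log_joint_taylor _ _ _)); rewrite ler_wpM2r ?sqr_ge0//.
  by rewrite lerDr sqrtr_ge0.
apply: (le_trans (dot_le_enorm _ _)); rewrite ler_wpM2r//.
by apply: (le_trans (enorm_score_vec _ _)); rewrite lerDl.
Qed.

(** The probabilities sum to 1 both at [th] and at [th + t *: v]; the sum in question is the
    first-order part of this identity, isolated by [linear_le_quadratic]. *)
Lemma score_mean0 i (th : 'rV[R]_(Defs.dim G i)) s v :
  \sum_a policy th s a * dot (score s a th) v = 0.
Proof.
have [df sL sL' _ _] := A5.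
pose Kv := Li i * enorm v + `|Li' i| * enorm v ^+ 2.
have Kv0 : 0 <= Kv by rewrite addr_ge0// mulr_ge0 ?enorm_ge0 ?Li_ge0 ?sqr_ge0.
have [C C0 HC] := expR_linearization Kv0.
apply: (@linear_le_quadratic R _ (#|Ac G i|%:R * C)); first by rewrite mulr_ge0.
move=> t /andP[t0 t1].
have pE a : policy (th + t *: v) s a =
    policy th s a * expR (log_policy s a (th + t *: v) - log_policy s a th).
  by rewrite -!expR_log_policy -expRD subrKC.
have : \sum_a (policy (th + t *: v) s a - policy th s a) = 0.
  rewrite sumrB; case: (policy_distr (th + t *: v) s) => _ ->.
  by case: (policy_distr th s) => _ ->; rewrite subrr.
move=> S0; rewrite -normrN.
have -> : - (t * \sum_a policy th s a * dot (score s a th) v) =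
    \sum_a (policy (th + t *: v) s a - policy th s a
      - t * (policy th s a * dot (score s a th) v)).
  by rewrite sumrB S0 sub0r mulr_sumr.
apply: (le_trans (ler_norm_sum _ _ _)).
apply: (@le_trans _ _ (\sum_(a : Ac G i) C * t ^+ 2)); last first.
  by rewrite sumr_const -mulrA mulr_natl.
apply: ler_sum => a _.
have -> : policy (th + t *: v) s a - policy th s a - t * (policy th s a * dot (score s a th) v)
  = policy th s a * (expR (log_policy s a (th + t *: v) - log_policy s a th) - 1
      - t * dot (score s a th) v) by rewrite pE; ring.
rewrite normrM -[leRHS]mul1r ler_pM//.
  by rewrite gtr0_norm ?policy_gt0// policy_le1.
apply: HC; first by rewrite (ltW t0).
  rewrite -dotZr.
  have := taylor2_of_gradient (df i s a) (sL' i s a) th (th + t *: v).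
  have -> : th + t *: v - th = t *: v by rewrite addrC addKr.
  rewrite enormZ (gtr0_norm t0) exprMn => /le_trans; apply.
  rewrite mulrCA mulrC ler_wpM2r ?sqr_ge0// lerDr mulr_ge0 ?Li_ge0 ?enorm_ge0//.
rewrite normrM gtr0_norm// mulrC ler_wpM2r ?(ltW t0)//.
apply: (le_trans (dot_le_enorm _ _)); apply: (@le_trans _ _ (Li i * enorm v)).
  by rewrite ler_wpM2r ?enorm_ge0//; exact: sL.
by rewrite lerDl mulr_ge0 ?sqr_ge0.
Qed.

End SmoothPolicies.

(** * The policy gradient *)

Section Objective.
Context {R : realType} {n : nat}.
Variables (G : networked_mdp R n) (pi : params G -> state_action G -> R).
Variables (rbar sigma muD : R) (Li Li' : 'I_n -> R) (L' : R).
Hypotheses (n_gt0 : (0 < n)%N) (A1 : bounded_rewards G rbar).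
Hypotheses (A4 : uniformly_ergodic pi sigma muD) (A5 : smooth pi Li Li' L').
Variable z0 : state_action G.

Let mu01 : 0 < muD < 1. Proof. by case: A4. Qed.
Let uK th : uniform_kernel sigma muD (Ptheta th) (pi th).
Proof. exact: model_kernel. Qed.
Let dpi th : distribution_on (pi th).
Proof. by case: (proj2 (uK th)) => _ []. Qed.
Let pc := poisson_const sigma muD.
Let pc0 : 0 <= pc. Proof. exact: (poisson_const_ge0 sigma mu01). Qed.

(** Given the state, the action of agent [i] is independent of the other actions, so its score
    averages to 0 against anything that ignores it. It is applied both to constants and to the
    critics of distant agents. *)
Lemma mean_score0 i (th : params G) (v : 'rV[R]_(Defs.dim G i)) (g : state_action G -> R) :
  (forall s a (b : Ac G i), g (s, upd a b) = g (s, a)) ->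
  mean (pi th) (fun z => dot (score (z.1 i) (z.2 i) (submxrow th i)) v * g z) = 0.
Proof.
move=> gi.
rewrite /mean (eq_bigr (fun z : state_action G =>
   mean (pi th) (fun y => joint_trans y z.1) * (joint_policy th z.1 z.2 *
   (dot (score (z.1 i) (z.2 i) (submxrow th i)) v * g (z.1, z.2))))); last first.
  by move=> z _; rewrite -surjective_pairing (stationary_factor A4) -mulrA.
rewrite -(pair_bigA _ (fun s a => mean (pi th) (fun y => joint_trans y s) *
  (joint_policy th s a * (dot (score (s i) (a i) (submxrow th i)) v * g (s, a)))))/=.
apply: big1 => s _; rewrite -mulr_sumr.
pose zeta (b : Ac G i) := policy (submxrow th i) (s i) b.
pose w (b : Ac G i) := dot (score (s i) b (submxrow th i)) v.
have joint_upd (a : conf (Ac G)) b : 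
    zeta (a i) * joint_policy th s (upd a b) = joint_policy th s a * zeta b.
  rewrite /joint_policy (bigD1 i)//= [in RHS](bigD1 i)//= upd_in -/(zeta b) -/(zeta (a i)).
  rewrite -mulrA; congr (_ * _); rewrite mulrC; congr (_ * _); apply: eq_bigr => j ji.
  by rewrite upd_out// eq_sym.
suff -> : \sum_(a : conf (Ac G)) joint_policy th s a * (w (a i) * g (s, a)) = 0.
  by rewrite mulr0.
transitivity (\sum_(p : conf (Ac G) * Ac G i)
    zeta p.2 * (joint_policy th s p.1 * (w (p.1 i) * g (s, p.1)))).
  rewrite -(pair_bigA _ (fun a b => zeta b * (joint_policy th s a * (w (a i) * g (s, a)))))/=.
  apply: eq_bigr => a _; rewrite -mulr_suml.
  by case: (policy_distr (submxrow th i) (s i)) => _; rewrite /zeta => ->; rewrite mul1r.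
(* Exchange the action of agent i with an independent copy of it. *)
rewrite (reindex (fun p : conf (Ac G) * Ac G i => (upd p.1 p.2, p.1 i)))/=; last first.
  apply: onW_bij; exists (fun p : conf (Ac G) * Ac G i => (upd p.1 p.2, p.1 i));
  by move=> [a b]; rewrite /= updK upd_in.
rewrite (eq_bigr (fun p : conf (Ac G) * Ac G i =>
   (joint_policy th s p.1 * g (s, p.1)) * (zeta p.2 * w p.2))); last first.
  by move=> [a b] _ /=; rewrite upd_in gi mulrA joint_upd; ring.
rewrite -(pair_bigA _ (fun a b => (joint_policy th s a * g (s, a)) * (zeta b * w b)))/=.
apply: big1 => a _; rewrite -mulr_sumr.
by rewrite (score_mean0 A4 A5 z0) mulr0.
Qed.

Lemma rew_norm i (z : state_action G) : `|rew i z| <= rbar.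
Proof. by case/andP: (A1 (z.1 i) (z.2 i)) => r0 r1; rewrite ger0_norm. Qed.

Let rbar0 : 0 <= rbar. Proof. exact: le_trans (normr_ge0 _) (rew_norm (Ordinal n_gt0) z0). Qed.

Definition Qbar (th : params G) (z : state_action G) : R :=
  n%:R^-1 * \sum_i Qfun pi i th z.

(** The expression of the policy gradient theorem for the averaged Q-function; [gradient_J]
    identifies it with the gradient of [J]. *)
Definition policy_gradient (th : params G) : params G :=
  \sum_z pi th z *: (Qbar th z *: score_vec th z).

Let CQ := 2 * rbar * pc.
Let CQ0 : 0 <= CQ. Proof. by rewrite /CQ mulr_ge0// mulr_ge0. Qed.

Lemma avg_le (F : 'I_n -> R) (B : R) : (forall i, `|F i| <= B) ->
  `|n%:R^-1 * \sum_i F i| <= B.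
Proof.
move=> FB; rewrite normrM ger0_norm ?invr_ge0// mulrC ler_pdivrMr ?ltr0n//.
apply: (le_trans (ler_norm_sum _ _ _)).
by apply: (le_trans (ler_sum _ (fun i _ => FB i))); rewrite sumr_const card_ord mulr_natr.
Qed.

Lemma Qbar_le th z : `|Qbar th z| <= CQ.
Proof. by apply: avg_le => i; apply: (poisson_bound (uK th)) => y; exact: rew_norm. Qed.

Lemma J_le th : `|J pi th| <= rbar.
Proof. by apply: avg_le => i; apply: norm_mean_le => // y; exact: rew_norm. Qed.

Lemma dot_policy_gradient th v : dot (policy_gradient th) v =
  mean (pi th) (fun z => Qbar th z * dot (score_vec th z) v).
Proof.
rewrite dotC dot_sumr; apply: eq_bigr => z _.
by rewrite !dotZr (dotC v).
Qed.

Let L := Num.sqrt (\sum_i Li i ^+ 2).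

Lemma policy_gradient_le th : enorm (policy_gradient th) <= CQ * L.
Proof.
set g := policy_gradient th.
have [->|g0] := eqVneq (enorm g) 0; first by rewrite mulr_ge0 ?sqrtr_ge0.
have gp : 0 < enorm g by rewrite lt_neqAle eq_sym g0 enorm_ge0.
rewrite -(ler_pM2r gp) -expr2 -dot_enorm {1}/g dot_policy_gradient.
apply: (le_trans (ler_norm _)); apply: norm_mean_le => // z.
rewrite normrM -mulrA ler_pM ?Qbar_le//.
apply: (le_trans (dot_le_enorm _ _)).
by rewrite ler_wpM2r ?enorm_ge0// (enorm_score_vec A5 z0).
Qed.

Lemma mean_avg p (F : 'I_n -> state_action G -> R) :
  mean p (fun z => n%:R^-1 * \sum_i F i z) = n%:R^-1 * \sum_i mean p (F i).
Proof. by rewrite meanZ mean_sum. Qed.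

Lemma J_perturb (th th' : params G) : J pi th' - J pi th =
  mean (pi th') (fun z => mapply (Ptheta th') (Qbar th) z - mapply (Ptheta th) (Qbar th) z).
Proof.
rewrite /J -mulrBr -sumrB; rewrite (eq_mean (fun z => n%:R^-1 * \sum_i
   (mapply (Ptheta th') (Qfun pi i th) z - mapply (Ptheta th) (Qfun pi i th) z))).
  rewrite mean_avg; congr (_ * _); apply: eq_bigr => i _.
  exact: (mean_perturb (uK th) (uK th') (@rew _ _ G i)).
by move=> z; rewrite /mapply -!/(mean _ _) !mean_avg -mulrBr -sumrB.
Qed.

(** Two replacements in [J_perturb], each at quadratic cost: [pi th'] by [pi th], where both the
    change of law and the integrand are of first order, then the kernel difference by its linear
    part. *)
Lemma J_taylor : exists2 C, 0 <= C & forall (th th' : params G), enorm (th' - th) <= 1 ->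
  `|J pi th' - J pi th - dot (policy_gradient th) (th' - th)| <= C * enorm (th' - th) ^+ 2.
Proof.
have [C C0 HC] := Ptheta_taylor A4 A5 z0.
pose KL := \sum_i Li i; pose N : R := #|state_action G|%:R.
have KL0 : 0 <= KL := KL_ge0 A5 z0.
pose C1 := N * (KL * (2 * (N * (KL * CQ)) * pc)).
have C10 : 0 <= C1 by rewrite /C1; do ?[apply: mulr_ge0 => //].
exists (C1 + N * (C * CQ)); first by rewrite addr_ge0// mulr_ge0// mulr_ge0.
move=> th th' d1; set d := enorm (th' - th).
have d0 : 0 <= d := enorm_ge0 _.
have PL z z' : `|Ptheta th' z z' - Ptheta th z z'| <= KL * d.
  exact: (Ptheta_lipschitz A4 A5 z0).
pose h z := mapply (Ptheta th') (Qbar th) z - mapply (Ptheta th) (Qbar th) z.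
have hB z : `|h z| <= N * (KL * d * CQ) by exact: mapply_diff PL _ _ _ (Qbar_le th).
have b1 := mean_diff (uK th) (uK th') PL hB.
pose q z' := Qbar th z' * dot (score_vec th z') (th' - th).
have b2 : `|mean (pi th) h - mean (pi th) q| <= N * (C * d ^+ 2 * CQ).
  rewrite -(mean_mapply (uK th) q) -meanB; apply: norm_mean_le => // z.
  have -> : h z - mapply (Ptheta th) q z = \sum_z' (Ptheta th' z z' - Ptheta th z z'
      - Ptheta th z z' * dot (score_vec th z') (th' - th)) * Qbar th z'.
    by rewrite /h /mapply -!sumrB; apply: eq_bigr => z' _; rewrite /q; ring.
  apply: (le_trans (ler_norm_sum _ _ _)).
  apply: (@le_trans _ _ (\sum_(z' : state_action G) C * d ^+ 2 * CQ)).
    by apply: ler_sum => z' _; rewrite normrM ler_pM// ?HC// Qbar_le.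
  by rewrite sumr_const mulr_natl.
rewrite J_perturb dot_policy_gradient -/h -/q.
have -> : mean (pi th') h - mean (pi th) q =
  (mean (pi th') h - mean (pi th) h) + (mean (pi th) h - mean (pi th) q) by ring.
apply: (le_trans (ler_normD _ _)); apply: (le_trans (lerD b1 b2)).
rewrite le_eqVlt; apply/orP; left; apply/eqP; rewrite /C1 -/pc -/N; ring.
Qed.

Lemma gradient_J (th : params G) : gradient (J pi) th = policy_gradient th.
Proof.
have [C C0 HC] := J_taylor.
apply/rowP => j; rewrite mxE.
have dE : enorm (delta_mx 0 j : params G) = 1.
  apply/eqP; rewrite -(@eqrXn2 _ 2)// ?enorm_ge0// -dot_enorm expr1n.
  by rewrite dot_delta mxE !eqxx.
apply: (@derive_of_quadratic _ _ _ _ _ _ C) => h h1.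
have tE : th + h *: delta_mx 0 j - th = h *: delta_mx 0 j by rewrite addrC addKr.
have := HC th (th + h *: delta_mx 0 j).
by rewrite tE enormZ dE mulr1 dotZr dot_delta real_normK ?num_real//; apply.
Qed.

End Objective.

(** * Convergence of the critic *)

Lemma big_option_sum (V : nmodType) (X : finType) (f : option X -> V) :
  \sum_k f k = f None + \sum_x f (Some x).
Proof.
rewrite (bigD1 None)//=; congr (_ + _).
rewrite (reindex_omap Some id)/=; last by case.
by apply: eq_bigl => x; rewrite eqxx.
Qed.

Section Critic.
Context {R : realType} {Z X : finType} {Theta : Type}.
Variables (sigma mu : R) (P : Theta -> Z -> Z -> R) (pi : Theta -> Z -> R).
Hypothesis mu01 : 0 < mu < 1.
Hypothesis sigma0 : 0 < sigma.
Hypothesis uK : forall th, uniform_kernel sigma mu (P th) (pi th).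
Variables (dist : Theta -> Theta -> R) (KP : R).
Hypothesis KP0 : 0 <= KP.
Hypothesis PLip : forall th th' z z', `|P th' z z' - P th z z'| <= KP * dist th' th.
Variables (phi : Z -> X) (x0 : X) (r : Z -> R) (rbar : R).
Hypothesis phi_surj : forall x, exists z, phi z = x.
Hypothesis r_le : forall z, `|r z| <= rbar.
Variable qs : Theta -> X -> R.
Hypothesis qsP : forall th, critic_limit phi x0 (P th) (pi th) r (qs th).

Variables (p0 : Z -> R) (cur : seq Z -> Z) (th : seq Z -> Theta).
Variables (muh : seq Z -> R) (Qh : seq Z -> X -> R) (alpha eta : nat -> R).
Hypothesis dp0 : distribution_on p0.
Hypothesis cur_cons : forall y s, cur (y :: s) = y.
Hypothesis alpha_gt0 : forall t, 0 < alpha t.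
Hypothesis alpha_noninc : forall t, alpha t.+1 <= alpha t.
Hypothesis alpha_div : ~ cvgn (series alpha).
Hypothesis alpha_van : vanishing alpha.
Hypothesis eta_ge0 : forall t, 0 <= eta t.
Hypothesis ratio_van : vanishing (fun t => eta t / alpha t).
Hypothesis th_step : forall s t y, size s = t.+1 ->
  dist (th (y :: s)) (th s) <= eta t.
Hypothesis muh_step : forall s t y, size s = t.+1 ->
  muh (y :: s) = (1 - alpha t) * muh s + alpha t * r (cur s).
Hypothesis Qh_step : forall s t y x, size s = t.+1 ->
  Qh (y :: s) x = if phi (cur s) == x0 then Qh s x
    else if x == phi (cur s) then
      (1 - alpha t) * Qh s x + alpha t * (r (cur s) - muh s + Qh s (phi y))
    else Qh s x.
Hypothesis Qh_dummy : forall s, Qh s x0 = 0.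

(* The dummy coordinate, which the algorithm keeps at 0, is given an artificial
   decay so that the mean field is strongly monotone on the whole space. *)
Let hat (y : option X -> R) x : R := if x == x0 then 0 else y (Some x).

Let F z z' (y : option X -> R) (k : option X) : R :=
  if k is Some x then
    if x == x0 then - y (Some x)
    else if x == phi z then r z - y None + hat y (phi z') - y (Some x) else 0
  else r z - y None.

Let xs v (k : option X) : R := if k is Some x then qs v x else mean (pi v) r.

Let c1 := coercivity sigma mu / #|X|%:R.

Let X_gt0 : 0 < #|X|%:R :> R.
Proof. by rewrite ltr0n; apply/card_gt0P; exists x0. Qed.

Let c1_gt0 : 0 < c1. Proof. by rewrite divr_gt0// coercivity_gt0. Qed.

(** The extra weight on the average-reward coordinate lets its decay dominate its influence on the
    Q-coordinates, split by Young's inequality with parameter [c1]. *)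
Let lam (k : option X) : R := if k is Some _ then 1 else 1 + c1^-1.

Let c := Num.min 2^-1 (c1 / 2).

Let dpi v : distribution_on (pi v).
Proof. by case: (proj2 (uK v)) => _ []. Qed.

Let dP v z : distribution_on (P v z).
Proof. by case: (proj2 (uK v)). Qed.

Let rbar0 : 0 <= rbar.
Proof. by have [z _] := phi_surj x0; exact: le_trans (r_le z). Qed.

Let meanF v (y : option X -> R) x : x != x0 ->
  mean (pi v) (fun z => mean (P v z) (fun z' => F z z' y (Some x))) =
  block phi (pi v) (fun z => r z - y None + mapply (P v) (hat y \o phi) z - hat y (phi z)) x.
Proof.
move=> xx0; rewrite /block big_mkcond/=; apply: eq_bigr => z _.
rewrite /F (negbTE xx0) eq_sym; case: eqP => [zx|_]; last first.
  by rewrite mean_cst// mulr0.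
congr (_ * _); rewrite /hat /mapply -/(mean _ _).
rewrite meanD mean_cst//; congr (_ - _); last by rewrite zx (negbTE xx0).
by rewrite meanD mean_cst.
Qed.

(** Subtracting the equations of the critic limit leaves, off the dummy, a coercive part [Lq] and a
    coupling [m * mass x]. Summed against [e], the coupling is [m] times a stationary mean of [e],
    whose square is at most the sum of the [e x ^+ 2]. *)
Let drift v y :
  mean (pi v) (fun z => mean (P v z) (fun z' =>
    \sum_k lam k * ((y k - xs v k) * F z z' y k)))
  <= - c * \sum_k lam k * (y k - xs v k) ^+ 2.
Proof.
have -> : mean (pi v) (fun z => mean (P v z) (fun z' =>
    \sum_k lam k * ((y k - xs v k) * F z z' y k))) =
    \sum_k lam k * ((y k - xs v k) *
      mean (pi v) (fun z => mean (P v z) (fun z' => F z z' y k))).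
  rewrite (eq_mean (fun z => \sum_k lam k * ((y k - xs v k) *
      mean (P v z) (fun z' => F z z' y k)))).
    by rewrite mean_sum; apply: eq_bigr => k _; rewrite !meanZ.
  by move=> z; rewrite mean_sum; apply: eq_bigr => k _; rewrite !meanZ.
rewrite !big_option_sum /=.
set m := y None - mean (pi v) r.
pose e x := hat y x - qs v x.
have [q0 qE] := qsP v.
have e0 : e x0 = 0 by rewrite /e /hat eqxx q0 subrr.
have -> : mean (pi v) (fun z => mean (P v z) (fun=> r z - y None)) = - m.
  rewrite (eq_mean (fun z => r z - y None)); last by move=> z; rewrite mean_cst.
  by rewrite meanB mean_cst// /m opprB.
pose Lq := block phi (pi v) (fun z => e (phi z) - mapply (P v) (e \o phi) z).
pose mass := block phi (pi v) (fun=> 1).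
have main x : x != x0 ->
    mean (pi v) (fun z => mean (P v z) (fun z' => F z z' y (Some x))) = - (m * mass x + Lq x).
  move=> xx0; rewrite meanF// -[LHS]subr0 -(qE x xx0) -blockB.
  rewrite /mass /Lq /block mulr_sumr -big_split/= -sumrN; apply: eq_bigr => z _.
  rewrite /td_error /e /m; have := mapplyB (P v) (hat y \o phi) (qs v \o phi) z.
  by rewrite /comp => ->; ring.
have D1 (g : X -> R) : g x0 = 0 -> \sum_x g x = \sum_(x | x != x0) g x.
  by move=> g0; rewrite (bigD1 x0)//= g0 add0r.
have E1 : \sum_x 1 * ((y (Some x) - qs v x) *
      mean (pi v) (fun z => mean (P v z) (fun z' => F z z' y (Some x)))) =
    - y (Some x0) ^+ 2 - m * mean (pi v) (e \o phi) - \sum_x e x * Lq x.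
  rewrite (bigD1 x0)//= q0 subr0.
  rewrite [in LHS](eq_mean (fun=> - y (Some x0))); last first.
    by move=> z; rewrite eqxx mean_cst.
  rewrite mean_cst// mul1r mulrN -expr2 -addrA; congr (_ + _).
  have -> : mean (pi v) (e \o phi) = \sum_x e x * mass x.
    by rewrite sum_block; apply: eq_mean => z; rewrite mulr1.
  rewrite (D1 (fun x => e x * mass x)) ?e0 ?mul0r// (D1 (fun x => e x * Lq x)) ?e0 ?mul0r//.
  rewrite mulr_sumr -opprD -big_split/= -sumrN; apply: eq_bigr => x xx0.
  by rewrite main// /e /hat (negbTE xx0); ring.
rewrite E1.
have E2 : \sum_x 1 * (y (Some x) - qs v x) ^+ 2 = y (Some x0) ^+ 2 + \sum_x e x ^+ 2.
  rewrite (bigD1 x0)//= (D1 (fun x => e x ^+ 2)) ?e0 ?expr0n// q0 subr0 mul1r.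
  by congr (_ + _); apply: eq_bigr => x xx0; rewrite mul1r /e /hat (negbTE xx0).
rewrite E2.
have h1 : c1 * \sum_x e x ^+ 2 <= \sum_x e x * Lq x.
  rewrite /c1 mulrAC ler_pdivrMr// mulrC (mulrC _ #|X|%:R).
  rewrite mulrC; exact: (block_coercive_sum phi_surj mu01 (uK v) e0).
have h2 : mean (pi v) (e \o phi) ^+ 2 <= \sum_x e x ^+ 2.
  have h : mean (pi v) (e \o phi) ^+ 2 <= Dnorm (pi v) (e \o phi) ^+ 2.
    rewrite -(real_normK (num_real (mean _ _))) ler_pXn2r ?nnegrE ?Dnorm_ge0//.
    apply: (le_trans (norm_mean (dpi v) _)); exact: mean_norm_Dnorm.
  apply: (le_trans h); rewrite sqr_Dnorm//.
  apply: (le_trans (ler_norm _)); apply: norm_mean_le => // z.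
  rewrite ger0_norm ?sqr_ge0// (bigD1 (phi z))//= lerDl sumr_ge0// => x _.
  exact: sqr_ge0.
set a := mean (pi v) (e \o phi) in h2 *.
have h3 : - (m * a) <= c1^-1 / 2 * m ^+ 2 + c1 / 2 * a ^+ 2.
  have := sqr_ge0 (m / c1 + a); rewrite sqrrD exprMn => H.
  have {}H : 0 <= c1 / 2 * (m ^+ 2 * c1^-1 ^+ 2 + m / c1 * a *+ 2 + a ^+ 2).
    by rewrite mulr_ge0// divr_ge0// ltW.
  have cN : c1 != 0 by rewrite gt_eqF.
  have E3 : c1 / 2 * (m ^+ 2 * c1^-1 ^+ 2 + m / c1 * a *+ 2 + a ^+ 2) =
    c1^-1 / 2 * m ^+ 2 + m * a + c1 / 2 * a ^+ 2 by field.
  rewrite E3 in H; lra.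
have h4 : c1 / 2 * a ^+ 2 <= c1 / 2 * \sum_x e x ^+ 2.
  by rewrite ler_wpM2l// divr_ge0// ltW.
have c_half : c <= 2^-1 by rewrite /c ge_min lexx.
have c_c1 : c <= c1 / 2 by rewrite /c ge_min lexx orbT.
have m2 := sqr_ge0 m; have y2 := sqr_ge0 (y (Some x0)).
have e2 : 0 <= \sum_x e x ^+ 2 by apply: sumr_ge0 => x _; exact: sqr_ge0.
have ci : 0 < c1^-1 by rewrite invr_gt0.
have h5 : c * \sum_x e x ^+ 2 <= c1 / 2 * \sum_x e x ^+ 2 by rewrite ler_wpM2r.
have h6 : c * y (Some x0) ^+ 2 <= 2^-1 * y (Some x0) ^+ 2 by rewrite ler_wpM2r.
have h7 : c * ((1 + c1^-1) * m ^+ 2) <= 2^-1 * ((1 + c1^-1) * m ^+ 2).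
  by rewrite ler_wpM2r// mulr_ge0// addr_ge0// ltW.
rewrite mulrN -expr2 in h3 *.
lra.
Qed.

Lemma critic_vanishing : vanishing (fun t => Ex p0 (fun s => P (th s) (cur s)) t
  (fun s => (muh s - mean (pi (th s)) r) ^+ 2 + \sum_x (Qh s x - qs (th s) x) ^+ 2)).
Proof.
have rb0 := rbar0.
have [K K0 HK] := critic_limit_lipschitz x0 phi_surj mu01 sigma0 r_le.
pose pc := poisson_const sigma mu.
have pc0 : 0 <= pc := poisson_const_ge0 sigma mu01.
pose Q := #|X|%:R * (2 * rbar) / coercivity sigma mu.
have c10 := coercivity_gt0 mu01 sigma0.
have Q0 : 0 <= Q by rewrite divr_ge0 ?(ltW c10)// mulr_ge0// mulr_ge0.
pose CJ := #|Z|%:R * (KP * (2 * rbar * pc)).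
have CJ0 : 0 <= CJ by rewrite /CJ; do ?[apply: mulr_ge0 => //].
have KKP0 : 0 <= K * KP by rewrite mulr_ge0.
pose CX := rbar + Q + CJ + K * KP.
have CX0 : 0 <= CX by rewrite !addr_ge0.
(* [rbar] bounds the increment at the zero iterate; 3 counts the entries of the iterate in a
   temporal difference. *)
have CF0 : 0 <= rbar + 3 by rewrite addr_ge0.
have c_gt0 : 0 < c by rewrite lt_min; apply/andP; split; rewrite ?divr_gt0 ?invr_gt0.
have dist0 v v' : 0 <= KP * dist v' v.
  have [z _] := phi_surj x0; exact: le_trans (PLip v v' z z).
pose x s (k : option X) := if k is Some y then Qh s y else muh s.
have lam1 k : 1 <= lam k by case: k => //=; rewrite lerDl invr_ge0 ltW.
(* [dist] carries no sign assumption, so it is truncated at 0 before constants are enlarged. *)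
have van := @sa_vanishing R Z Theta sigma mu P pi mu01 uK
  (fun v v' => Num.max 0 (dist v v')) KP KP0 _ _ F xs lam
  (rbar + 3) CX c CF0 CX0 c_gt0 lam1.
have maxd v v' : dist v v' <= Num.max 0 (dist v v') by rewrite le_max lexx orbT.
have {}van := van _ _ _ _ _ drift p0 cur th x alpha eta dp0 cur_cons alpha_gt0
  alpha_noninc alpha_div alpha_van eta_ge0 ratio_van.
have Pm v v' z z' : `|P v' z z' - P v z z'| <= KP * Num.max 0 (dist v' v).
  by apply: (le_trans (PLip _ _ _ _)); rewrite ler_wpM2l.
apply: vanishing_le (van _ _ _ _ _ _ _).
- near=> t; apply: Ex_le => // s _; rewrite big_option_sum/=.
  apply: lerD.
    by rewrite ler_peMl ?sqr_ge0// lerDl invr_ge0 ltW.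
  by apply: ler_sum => y _; rewrite mul1r.
- exact: Pm.
- move=> z z' [y|] /=.
    have [_|_] := eqVneq y x0; first by rewrite oppr0 normr0.
    case: eqP => _; last by rewrite normr0.
    rewrite /hat if_same !subr0 addr0 (le_trans (r_le z))// lerDl//.
  by rewrite subr0 (le_trans (r_le z))// lerDl.
- move=> z z' y y' k; set S := \sum_j `|y j - y' j|.
  have S_ge j : `|y j - y' j| <= S.
    by rewrite /S (bigD1 j)//= lerDl sumr_ge0.
  have S0 : 0 <= S := sumr_ge0 _ (fun _ _ => normr_ge0 _).
  have rS : 0 <= rbar * S by rewrite mulr_ge0.
  case: k => [w|] /=; last first.
    have -> : r z - y None - (r z - y' None) = - (y None - y' None) by ring.
    rewrite normrN; have := S_ge None; lra.
  have [_|_] := eqVneq w x0.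
    have -> : - y (Some w) - - y' (Some w) = - (y (Some w) - y' (Some w)) by ring.
    rewrite normrN; have := S_ge (Some w); lra.
  case: eqP => _; last by rewrite subrr normr0 mulr_ge0.
  have -> : r z - y None + hat y (phi z') - y (Some w)
      - (r z - y' None + hat y' (phi z') - y' (Some w)) =
    - (y None - y' None) + (hat y (phi z') - hat y' (phi z')) - (y (Some w) - y' (Some w)).
    by ring.
  have hh : `|hat y (phi z') - hat y' (phi z')| <= S.
    by rewrite /hat; case: eqP => _; [rewrite subrr normr0|exact: S_ge].
  apply: (le_trans (ler_normB _ _)).
  apply: (le_trans (lerD (ler_normD _ _) (lexx _))); rewrite normrN.
  have := S_ge None; have := S_ge (Some w); lra.
- move=> v [y|] /=.
    have := critic_limit_bound phi_surj mu01 sigma0 (uK v) r_le (qsP v) y.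
    rewrite -/Q => /le_trans; apply; rewrite /CX; lra.
  have := norm_mean_le (dpi v) r_le => /le_trans; apply; rewrite /CX; lra.
- move=> v v' [y|] /=.
    have := HK _ _ _ _ _ _ _ (uK v) (uK v') (Pm v v') (qsP v) (qsP v') y.
    move=> /le_trans; apply; rewrite mulrA ler_wpM2r ?le_max ?lexx// /CX; lra.
  have := mean_diff (uK v) (uK v') (Pm v v') r_le; move=> /le_trans; apply.
  have -> : #|Z|%:R * (KP * Num.max 0 (dist v' v) * (2 * rbar * poisson_const sigma mu)) =
    CJ * Num.max 0 (dist v' v) by rewrite /CJ -/pc; ring.
  by rewrite ler_wpM2r ?le_max ?lexx// /CX; lra.
- by move=> s t y st; rewrite ge_max eta_ge0/= th_step.
- move=> s t y [w|] st /=; last by rewrite (muh_step y st); ring.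
  (* At the dummy, [F] prescribes a decay whereas the algorithm leaves the entry alone; both agree
     because that entry is 0. *)
  rewrite (Qh_step y w st); have [phi0|phi0] := eqVneq (phi (cur s)) x0.
    rewrite phi0; case: eqP => [->|_]; first by rewrite Qh_dummy oppr0 mulr0 addr0.
    by rewrite mulr0 addr0.
  have [wphi|wphi] := eqVneq w (phi (cur s)).
    rewrite wphi (negbTE phi0) /hat /x/=; case: eqP => [->|_]; rewrite ?Qh_dummy; ring.
  by case: eqP => [->|_]; rewrite ?Qh_dummy ?oppr0 mulr0 addr0.
Unshelve. all: by end_near. Qed.

End Critic.

(** * The actor *)

Section Algorithm.
Context {R : realType} {n : nat}.
Variables (G : networked_mdp R n) (pi : params G -> state_action G -> R).
Variables (rbar c rho sigma muD : R) (Li Li' : 'I_n -> R) (L' : R).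
Variables (kappa : nat) (alpha eta : nat -> R).
Hypotheses (n_gt0 : (0 < n)%N) (kappa_ge1 : (1 <= kappa)%N).
Hypotheses (A1 : bounded_rewards G rbar) (A2 : exp_decay pi c rho).
Hypotheses (A3 : step_sizes alpha eta).
Hypotheses (A4 : uniformly_ergodic pi sigma muD) (A5 : smooth pi Li Li' L').
Variables (dummy : forall i, local_state_action G kappa i) (theta0 : params G).
Variable z0 : state_action G.

Notation SA := (state_action G).
Notation X := (local_state_action G kappa).

Let mu01 : 0 < muD < 1. Proof. by case: A4. Qed.
Let sigma0 : 0 < sigma. Proof. by case: A4. Qed.
Let uK th : uniform_kernel sigma muD (Ptheta th) (pi th).
Proof. exact: model_kernel. Qed.
Let dpi th : distribution_on (pi th).
Proof. by case: (proj2 (uK th)) => _ []. Qed.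
Let pc := poisson_const sigma muD.
Let pc0 : 0 <= pc. Proof. exact: (poisson_const_ge0 sigma mu01). Qed.

Let L := Num.sqrt (\sum_i Li i ^+ 2).
Let L0 : 0 <= L. Proof. exact: sqrtr_ge0. Qed.

Let alpha_gt0 t : 0 < alpha t. Proof. by case: A3 => -[]. Qed.
Let eta_gt0 t : 0 < eta t. Proof. by case: A3 => _ []. Qed.
Let eta_ge0 t : 0 <= eta t. Proof. exact: ltW. Qed.
Let alpha_noninc t : alpha t.+1 <= alpha t. Proof. by case: A3 => -[]. Qed.
Let eta_noninc t : eta t.+1 <= eta t. Proof. by case: A3 => _ []. Qed.
Let alpha_div : ~ cvgn (series alpha). Proof. by case: A3 => -[]. Qed.
Let eta_div : ~ cvgn (series eta). Proof. by case: A3 => _ []. Qed.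
Let alpha_van : vanishing alpha.
Proof.
by apply: vanishing_sqr; [move=> t; exact: ltW|case: A3 => -[]].
Qed.
Let eta_van : vanishing eta.
Proof.
by apply: vanishing_sqr; [move=> t; exact: ltW|case: A3 => _ []].
Qed.
Let ratio_van : vanishing (fun t => eta t / alpha t).
Proof.
case: A3 => _ _ [p p0 H]; apply: vanishing_powR p0 _ H => t.
by rewrite divr_ge0// ltW.
Qed.

Definition ac_init : ac_state G kappa := ACState (fun=> 0) (fun i x => 0) theta0.

(** The iterates as a function of the reversed history, to which [Ex] applies. If [s'] has length
    [t.+1], the step performed has index [t] and goes from [z] to [y]. *)
Fixpoint ac_hist (s : seq SA) : ac_state G kappa :=
  if s is y :: s' then
    if s' is z :: _ then ac_step alpha eta dummy (size s').-1 (ac_hist s') z y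
    else ac_init
  else ac_init.

Lemma ac_hist_cons s t y : size s = t.+1 ->
  ac_hist (y :: s) = ac_step alpha eta dummy t (ac_hist s) (head z0 s) y.
Proof. by case: s => //= z s [<-]. Qed.

Let cur := head z0.
Let th s := param (ac_hist s).

Lemma Q_hat_dummy s i : Q_hat (ac_hist s) (dummy i) = 0.
Proof.
elim: s => //= y [|z s] //= IH; case: ifP => // zd; case: eqP => // dz.
by rewrite dz eqxx in zd.
Qed.

Definition Q_max (st : ac_state G kappa) : R := \big[Num.max/0]_i Qnorm dummy st i.

Lemma Qnorm_ge0 st i : 0 <= Qnorm dummy st i.
Proof. by apply: (big_ind (fun x : R => 0 <= x)) => // x y x0 y0; rewrite le_max x0. Qed.

Lemma Q_max_ge0 st : 0 <= Q_max st.
Proof.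
by apply: (big_ind (fun x : R => 0 <= x)) => // [x y x0 y0|i _];
  rewrite ?le_max ?x0 ?Qnorm_ge0.
Qed.

Lemma Gam_ge0 st : 0 <= Gam dummy st.
Proof. by rewrite invr_ge0 addr_ge0// Q_max_ge0. Qed.

Lemma Gam_le1 st : Gam dummy st <= 1.
Proof.
by rewrite invf_le1 ?lerDl ?Q_max_ge0// ltr_wpDr ?Q_max_ge0.
Qed.

Lemma Gam_Q_max st : Gam dummy st * (1 + Q_max st) = 1.
Proof. by rewrite mulVf// gt_eqF// ltr_wpDr ?Q_max_ge0. Qed.

Lemma Gam_Q_max_le1 st : Gam dummy st * Q_max st <= 1.
Proof. by rewrite -[leRHS](Gam_Q_max st) mulrDr mulr1 lerDr Gam_ge0. Qed.

Lemma Q_hat_le s i (x : X i) : `|Q_hat (ac_hist s) x| <= Q_max (ac_hist s).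
Proof.
have [->|xd] := eqVneq x (dummy i); first by rewrite Q_hat_dummy normr0 Q_max_ge0.
apply: le_trans (le_bigmax _ (Qnorm dummy (ac_hist s)) i).
exact: (@le_bigmax_cond _ _ _ 0 x (fun x => x != dummy i) (fun x => `|Q_hat (ac_hist s) x|)).
Qed.

Definition g_joint (st : ac_state G kappa) (z : SA) : params G :=
  \mxrow_i g_hat st z i.

Lemma param_step t st z z' : param (ac_step alpha eta dummy t st z z') =
  param st + (eta t * Gam dummy st) *: g_joint st z.
Proof.
apply/mxrowP => i; rewrite /= mxrowK submxrowD; congr (_ + _).
by rewrite submxrowZ mxrowK.
Qed.

Lemma dot_g_joint (v : params G) st z : dot v (g_joint st z) =
  \sum_i (n%:R^-1 * \sum_(j in nbhdk (edge G) kappa i) Q_hat st (zloc kappa j z))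
    * dot (submxrow v i) (score (z.1 i) (z.2 i) (submxrow (param st) i)).
Proof. by rewrite dot_block; apply: eq_bigr => i _; rewrite mxrowK dotZr. Qed.

Lemma nbhd_avg_le (F : 'I_n -> R) (A : {set 'I_n}) (B : R) : 0 <= B ->
  (forall j, `|F j| <= B) -> `|n%:R^-1 * \sum_(j in A) F j| <= B.
Proof.
move=> B0 FB; rewrite big_mkcond/=; apply: (avg_le n_gt0) => j.
by case: ifP => // _; rewrite normr0.
Qed.

Lemma g_joint_le s z : enorm (g_joint (ac_hist s) z) <= Q_max (ac_hist s) * L.
Proof.
rewrite -(@ler_pXn2r _ 2) ?nnegrE ?enorm_ge0 ?mulr_ge0 ?Q_max_ge0// enorm_block.
rewrite exprMn sqr_sqrtr ?sumr_ge0//; last by move=> i _; rewrite sqr_ge0.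
rewrite mulr_sumr; apply: ler_sum => i _; rewrite mxrowK enormZ exprMn.
rewrite ler_pM ?sqr_ge0//.
  rewrite ler_pXn2r ?nnegrE ?Q_max_ge0//.
  by apply: nbhd_avg_le => [|j]; [exact: Q_max_ge0|exact: Q_hat_le].
rewrite ler_pXn2r ?nnegrE ?enorm_ge0 ?(Li_ge0 A5 z0)//.
by case: A5.
Qed.

(** The purpose of the scaling: the direction grows at most like [Q_max], and [Gam] times [Q_max] is
    at most 1, so parameter steps are of size [eta t] whatever the critic does. *)
Lemma scaled_g_joint_le s z : Gam dummy (ac_hist s) * enorm (g_joint (ac_hist s) z) <= L.
Proof.
apply: (le_trans (ler_wpM2l (Gam_ge0 _) (g_joint_le s z))).
by rewrite mulrA ler_piMl// Gam_Q_max_le1.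
Qed.

Lemma th_step s t y : size s = t.+1 -> enorm (th (y :: s) - th s) <= L * eta t.
Proof.
move=> st; rewrite /th (ac_hist_cons _ st) param_step addrC addKr enormZ normrM.
rewrite !ger0_norm ?Gam_ge0// -mulrA mulrC ler_wpM2r//.
exact: scaled_g_joint_le.
Qed.

Definition r_local (i : 'I_n) : SA -> R := @rew _ _ G i.

Let qs_exists i : exists q : params G -> X i -> R,
  forall v, critic_limit (zloc kappa i) (dummy i) (Ptheta v) (pi v) (r_local i) (q v).
Proof.
have /choice[q qP] : forall v, exists q, critic_limit (zloc kappa i) (dummy i)
    (Ptheta v) (pi v) (r_local i) q.
  by move=> v; exact: (critic_limit_exists _ (@zloc_surj _ _ _ z0 kappa i) mu01 sigma0 (uK v)).
by exists q.
Qed.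

Definition critic_target (i : 'I_n) : params G -> X i -> R := sval (cid (qs_exists i)).

Lemma critic_targetP i v : critic_limit (zloc kappa i) (dummy i) (Ptheta v) (pi v)
  (r_local i) (@critic_target i v).
Proof. by rewrite /critic_target; case: cid. Qed.

Definition critic_error (i : 'I_n) (s : seq SA) : R :=
  (mu_hat (ac_hist s) i - mean (pi (th s)) (r_local i)) ^+ 2
  + \sum_x (Q_hat (ac_hist s) x - @critic_target i (th s) x) ^+ 2.

Definition K_hist (s : seq SA) : SA -> R := Ptheta (th s) (cur s).

Lemma K_hist_distr s : distribution_on (K_hist s).
Proof. exact: Ptheta_distr. Qed.

Variable p0 : SA -> R.
Hypothesis dp0 : distribution_on p0.

Lemma critic_error_vanishing i :
  vanishing (fun t => Ex p0 K_hist t (critic_error i)).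
Proof.
apply: (@critic_vanishing R SA (X i) (params G) sigma muD (@Ptheta _ _ G) pi mu01 sigma0 uK
  (fun v v' => enorm (v - v')) (\sum_i Li i) (KL_ge0 A5 z0) _ (zloc kappa i) (dummy i)
  (r_local i) rbar (@zloc_surj _ _ _ z0 kappa i) _ (@critic_target i) _ p0 cur th
  (fun s => mu_hat (ac_hist s) i) (fun s => @Q_hat _ _ _ _ (ac_hist s) i)
  alpha (fun t => L * eta t)) => //.
- by move=> v v' z z'; exact: (Ptheta_lipschitz A4 A5 z0).
- by move=> z; exact: rew_norm.
- by move=> v; exact: critic_targetP.
- by move=> t; rewrite mulr_ge0.
- apply: (@vanishing_le _ _ (fun t => L * (eta t / alpha t))).
    by near=> t; rewrite mulrA.
  exact: vanishingZ.
- by move=> s t y st; exact: th_step.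
- by move=> s t y st; rewrite (ac_hist_cons _ st).
- by move=> s t y x st; rewrite (ac_hist_cons _ st).
- by move=> s; rewrite Q_hat_dummy.
Unshelve. all: by end_near. Qed.

Definition approx_error : R := c * rho ^+ kappa.+1 / (1 - muD).

Lemma approx_error_ge0 : 0 <= approx_error.
Proof.
case: A2 => c0 /andP[r0 r1] _; case/andP: mu01 => m0 m1.
by rewrite divr_ge0 ?subr_ge0 ?(ltW m1)// mulr_ge0 ?exprn_ge0 ?(ltW c0) ?(ltW r0).
Qed.

(** Exponential decay bounds the oscillation of the Q-function over states with equal [zloc], which
    is the [eps] of [critic_limit_approx]. The constant [m] stays unspecified because only the
    centered error is controlled. *)
Lemma critic_target_approx i v : exists m,
  mean (pi v) (fun z => `|@critic_target i v (zloc kappa i z) - Qfun pi i v z - m|)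
  <= approx_error.
Proof.
eexists; apply: le_trans (critic_limit_approx (@zloc_surj _ _ _ z0 kappa i) mu01 sigma0
  (uK v) (critic_targetP i v) _).
  exact: (mean_norm_Dnorm (dpi v)).
by move=> z z' zz'; case: A2 => _ _; apply.
Qed.

Definition critic_gap (s : seq SA) : R :=
  \sum_j \sum_x `|Q_hat (ac_hist s) x - @critic_target j (th s) x|.

Lemma critic_gap_ge s j x :
  `|Q_hat (ac_hist s) x - @critic_target j (th s) x| <= critic_gap s.
Proof.
rewrite /critic_gap (bigD1 j)//= (bigD1 x)//= -addrA lerDl addr_ge0 ?sumr_ge0//.
by move=> i _; rewrite sumr_ge0.
Qed.

(** Mean-zero scores allow the neighbourhood sum to be completed to all agents and a constant to be
    added to each Q-function. What remains pairs a score of norm at most [L] with the distance of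
    the critic to its target plus [approx_error]. *)
Lemma actor_bias s g : g = policy_gradient pi (th s) ->
  enorm g ^+ 2 - L * enorm g * (critic_gap s + approx_error) <=
  mean (pi (th s)) (fun z => dot g (g_joint (ac_hist s) z)).
Proof.
move=> gE; set v := th s.
pose w i (z : SA) := dot (score (z.1 i) (z.2 i) (submxrow v i)) (submxrow g i).
pose sv z := dot (score_vec v z) g.
have svE z : sv z = \sum_i w i z by exact: dot_score_vec.
pose Qh j (z : SA) := Q_hat (ac_hist s) (zloc kappa j z).
have sv0 : mean (pi v) sv = 0.
  rewrite (eq_mean (fun z => \sum_i w i z))// mean_sum big1// => i _.
  rewrite (eq_mean (fun z => w i z * 1)); last by move=> z; rewrite mulr1.
  exact: (mean_score0 A4 A5 z0).
have mean_g : mean (pi v) (fun z => dot g (g_joint (ac_hist s) z)) =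
    n%:R^-1 * \sum_j mean (pi v) (fun z => sv z * Qh j z).
  (* By symmetry [i] is outside the neighbourhood of [j], so [Qh j] ignores the action of [i]. *)
  have far i j : j \notin nbhdk (edge G) kappa i ->
      mean (pi v) (fun z => w i z * Qh j z) = 0.
    move=> ji; apply: (mean_score0 A4 A5 z0) => a b b'.
    by rewrite /Qh zloc_upd// -nbhdk_sym.
  rewrite (eq_mean (fun z => \sum_i n%:R^-1 * \sum_(j in nbhdk (edge G) kappa i)
      w i z * Qh j z)); last first.
    move=> z; rewrite dot_g_joint; apply: eq_bigr => i _.
    by rewrite -mulrA mulr_suml; congr (_ * _); apply: eq_bigr => j _; rewrite mulrC dotC.
  rewrite mean_sum mulr_sumr.
  rewrite (eq_bigr (fun i => n%:R^-1 * \sum_j mean (pi v) (fun z => w i z * Qh j z))).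
    rewrite -!mulr_sumr exchange_big/=; congr (_ * _); apply: eq_bigr => j _.
    rewrite -mean_sum; apply: eq_mean => z; by rewrite svE mulr_suml.
  move=> i _; rewrite meanZ mean_sum [in LHS]big_mkcond/=; congr (_ * _).
  by apply: eq_bigr => j _; case: ifPn => // /far ->.
have g2 : enorm g ^+ 2 = n%:R^-1 * \sum_j mean (pi v) (fun z => sv z * Qfun pi j v z).
  rewrite -dot_enorm {1}gE dot_policy_gradient -mean_sum -meanZ.
  by apply: eq_mean => z; rewrite /Qbar -mulrA mulr_suml; congr (_ * _);
     apply: eq_bigr => j _; rewrite mulrC.
rewrite mean_g lerBlDr -lerBlDl g2 -mulrBr -sumrB.
apply: (le_trans (ler_norm _)); apply: (avg_le n_gt0) => j.
have [m mE] := critic_target_approx j v.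
have -> : mean (pi v) (fun z => sv z * Qfun pi j v z) - mean (pi v) (fun z => sv z * Qh j z)
  = mean (pi v) (fun z => sv z * (Qfun pi j v z + m - Qh j z)).
  rewrite -meanB; apply/esym.
  rewrite (eq_mean (fun z => (sv z * Qfun pi j v z - sv z * Qh j z) + m * sv z)).
    by rewrite [LHS]meanD meanZ sv0 mulr0 addr0.
  by move=> z; ring.
apply: (le_trans (norm_mean (dpi v) _)).
apply: (@le_trans _ _ (mean (pi v) (fun z => (L * enorm g) * (critic_gap s +
   `|@critic_target j v (zloc kappa j z) - Qfun pi j v z - m|)))).
  apply: le_mean => // z; rewrite normrM ler_pM//.
    apply: (le_trans (dot_le_enorm _ _)); rewrite ler_wpM2r ?enorm_ge0//.
    exact: (enorm_score_vec A5 z0).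
  have -> : Qfun pi j v z + m - Qh j z = - (Qh j z - @critic_target j v (zloc kappa j z))
    - (@critic_target j v (zloc kappa j z) - Qfun pi j v z - m) by ring.
  apply: (le_trans (ler_normB _ _)); rewrite normrN lerD2r; exact: critic_gap_ge.
rewrite meanZ meanD mean_cst// ler_wpM2l ?mulr_ge0 ?enorm_ge0//.
by rewrite lerD2l.
Qed.

(** * One-step variation of the scaled actor direction *)

Lemma critic_error_ge0 i s : 0 <= critic_error i s.
Proof. by rewrite addr_ge0 ?sqr_ge0// sumr_ge0// => x _; rewrite sqr_ge0. Qed.

(** Random factor of the variations below. Being affine in the squared errors, it is controlled in
    expectation by [critic_error_vanishing]. *)
Let b s := 1 + \sum_i critic_error i s.

Let b_ge1 s : 1 <= b s.
Proof. by rewrite lerDl sumr_ge0// => i _; exact: critic_error_ge0. Qed.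

Let rbar0 : 0 <= rbar.
Proof. exact: le_trans (normr_ge0 _) (rew_norm A1 (Ordinal n_gt0) z0). Qed.

Lemma mu_hat_le s i : `|mu_hat (ac_hist s) i| <= rbar + b s.
Proof.
set J0 := mean (pi (th s)) (r_local i).
rewrite -[mu_hat _ _](subrK J0); apply: (le_trans (ler_normD _ _)).
have h1 : `|J0| <= rbar by apply: norm_mean_le => // z; exact: rew_norm.
have h2 : critic_error i s <= \sum_j critic_error j s.
  by rewrite (bigD1 i)//= lerDl sumr_ge0// => j _; exact: critic_error_ge0.
have h3 : (mu_hat (ac_hist s) i - J0) ^+ 2 <= critic_error i s.
  by rewrite lerDl sumr_ge0// => x _; rewrite sqr_ge0.
have := sqr_ge0 (`|mu_hat (ac_hist s) i - J0| - 1).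
rewrite sqrrB real_normK ?num_real// /b.
have := normr_ge0 (mu_hat (ac_hist s) i - J0); lra.
Qed.

Lemma Q_max_le s (B : R) : 0 <= B ->
  (forall i (x : X i), `|Q_hat (ac_hist s) x| <= B) -> Q_max (ac_hist s) <= B.
Proof.
move=> B0 QB; apply: bigmax_le => // i _.
by apply: bigmax_le => // x _.
Qed.

(** The term in [Q_max] has no deterministic bound; it becomes harmless after multiplication by
    [Gam]. *)
Let delta s t := alpha t * (2 * rbar + b s + 2 * Q_max (ac_hist s)).

Lemma Q_hat_diff s t y i (x : X i) : size s = t.+1 ->
  `|Q_hat (ac_hist (y :: s)) x - Q_hat (ac_hist s) x| <= delta s t.
Proof.
move=> st; have N0 := Q_max_ge0 (ac_hist s); have b1 := b_ge1 s.
have d0 : 0 <= delta s t.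
  rewrite mulr_ge0 ?(ltW (alpha_gt0 t))//.
  have := rbar0; lra.
rewrite (ac_hist_cons _ st) /=; case: ifP => _; first by rewrite subrr normr0.
case: eqP => [->|_]; last by rewrite subrr normr0.
set q := Q_hat _ _; set q' := Q_hat _ _; set r := rew _ _; set m := mu_hat _ _.
have -> : (1 - alpha t) * q + alpha t * (r - m + q') - q = alpha t * (r - m + q' - q).
  by ring.
rewrite normrM gtr0_norm// ler_wpM2l ?(ltW (alpha_gt0 t))//.
apply: (le_trans (ler_normB _ _)).
apply: (le_trans (lerD (ler_normD _ _) (lexx _))).
apply: (le_trans (lerD (lerD (ler_normB _ _) (lexx _)) (lexx _))).
have := rew_norm A1 i (head z0 s); have := mu_hat_le s i; rewrite -/r -/m.
have := Q_hat_le s (zloc kappa i (head z0 s)); have := Q_hat_le s (zloc kappa i y).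
rewrite -/q -/q'; lra.
Qed.

(** The scaled actor step sees the critic only through these products, which are bounded by 1. *)
Let yv s i (x : X i) := Gam dummy (ac_hist s) * Q_hat (ac_hist s) x.

Let yv_le s i (x : X i) : `|yv s x| <= 1.
Proof.
rewrite normrM ger0_norm ?Gam_ge0//.
apply: le_trans (Gam_Q_max_le1 (ac_hist s)).
by rewrite ler_wpM2l ?Gam_ge0// Q_hat_le.
Qed.

Let yv_diff s t y i (x : X i) : size s = t.+1 ->
  `|yv (y :: s) x - yv s x| <= alpha t * (2 * (2 * rbar + 3) * b s).
Proof.
move=> st; rewrite /yv.
set g := Gam dummy (ac_hist s); set g' := Gam dummy (ac_hist (y :: s)).
set N := Q_max (ac_hist s); set N' := Q_max (ac_hist (y :: s)).
have N0 : 0 <= N := Q_max_ge0 _; have N'0 : 0 <= N' := Q_max_ge0 _.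
have g0 : 0 <= g := Gam_ge0 _; have g'0 : 0 <= g' := Gam_ge0 _.
have gN : g * (1 + N) = 1 := Gam_Q_max _.
have g'N : g' * (1 + N') = 1 := Gam_Q_max _.
have b1 := b_ge1 s; have rb := rbar0; have a0 := ltW (alpha_gt0 t).
have d0 : 0 <= delta s t by rewrite /delta -/N mulr_ge0//; lra.
have NN' : `|N - N'| <= delta s t.
  have h1 : N' <= N + delta s t.
    apply: Q_max_le => [|j w]; first by rewrite addr_ge0.
    rewrite -[Q_hat _ _](subrK (Q_hat (ac_hist s) w)).
    apply: (le_trans (ler_normD _ _)); rewrite [leRHS]addrC.
    by apply: lerD; [exact: Q_hat_diff|exact: Q_hat_le].
  have h2 : N <= N' + delta s t.
    apply: Q_max_le => [|j w]; first by rewrite addr_ge0.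
    rewrite -[Q_hat _ _](subrK (Q_hat (ac_hist (y :: s)) w)).
    apply: (le_trans (ler_normD _ _)); rewrite [leRHS]addrC distrC.
    by apply: lerD; [exact: Q_hat_diff|exact: Q_hat_le].
  rewrite ler_norml; apply/andP; split; lra.
set q := Q_hat _ _; set q' := Q_hat _ _.
(* Since [g * (1 + N) = 1] and [g' * (1 + N') = 1], the scaling changes by [g * g' * (N - N')]. *)
have -> : g' * q - g * q' = g * (q - q') + g * g' * (N - N') * q.
  have -> : g * (q - q') + g * g' * (N - N') * q =
    g * (q - q') + (g * (1 + N)) * g' * q - (g' * (1 + N')) * g * q by ring.
  by rewrite gN g'N; ring.
have gd : g * delta s t <= alpha t * ((2 * rbar + 3) * b s).
  rewrite /delta mulrCA ler_wpM2l//.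
  have -> : g * (2 * rbar + b s + 2 * N) = g * (2 * rbar + b s) + 2 * (g * N) by ring.
  have gle : g <= 1 := Gam_le1 _.
  have gNle : g * N <= 1 := Gam_Q_max_le1 _.
  have : g * (2 * rbar + b s) <= 2 * rbar + b s by rewrite ler_piMl//; lra.
  have : rbar * 1 <= rbar * b s by rewrite ler_wpM2l.
  lra.
have h1 : `|g * (q - q')| <= g * delta s t.
  by rewrite normrM ger0_norm// ler_wpM2l// Q_hat_diff.
have h2 : `|g * g' * (N - N') * q| <= g * delta s t.
  have -> : g * g' * (N - N') * q = g * ((N - N') * (g' * q)) by ring.
  rewrite normrM ger0_norm// ler_wpM2l// normrM -[leRHS]mulr1 ler_pM//.
  exact: (yv_le (y :: s) x).
apply: (le_trans (ler_normD _ _)); apply: (le_trans (lerD h1 h2)).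
lra.
Qed.

Let CG := 2 * rbar * pc * L.
Let CG0 : 0 <= CG. Proof. by rewrite /CG; do ?[apply: mulr_ge0 => //]. Qed.

Let PG s := policy_gradient pi (th s).

Let PG_le s : enorm (PG s) <= CG.
Proof. exact: (policy_gradient_le n_gt0 A1 A4 A5 z0). Qed.

Let f s (z : SA) := - (Gam dummy (ac_hist s) * dot (PG s) (g_joint (ac_hist s) z)).

Let f_le s z : `|f s z| <= CG * L.
Proof.
rewrite normrN normrM ger0_norm ?Gam_ge0//.
apply: (le_trans (ler_wpM2l (Gam_ge0 _) (dot_le_enorm _ _))).
rewrite mulrCA; apply: ler_pM; rewrite ?enorm_ge0 ?mulr_ge0 ?enorm_ge0 ?Gam_ge0//.
exact: scaled_g_joint_le.
Qed.

(** The first part pays for the motion of the parameters, in gradient and score; the second for that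
    of the scaled critic entries. *)
Let Cf := (\sum_i (`|L'| * Li i + CG * `|Li' i|)) * L
  + \sum_i 2 * (2 * rbar + 3) * (CG * Li i).

Let Li0 i : 0 <= Li i. Proof. exact: (Li_ge0 A5 z0). Qed.

Let score_sum0 : 0 <= \sum_i (`|L'| * Li i + CG * `|Li' i|).
Proof. by apply: sumr_ge0 => i _; rewrite addr_ge0// mulr_ge0. Qed.

Let mix_sum0 : 0 <= \sum_i 2 * (2 * rbar + 3) * (CG * Li i).
Proof.
apply: sumr_ge0 => i _; rewrite mulr_ge0//; last by rewrite mulr_ge0.
by rewrite mulr_ge0// addr_ge0// mulr_ge0.
Qed.

Let Cf0 : 0 <= Cf. Proof. by rewrite addr_ge0// mulr_ge0. Qed.

(** The field moves at the fast rate [alpha t] through the critic. This is affordable: the Poisson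
    correction carries the weight [eta t], so the resulting error is [o(eta t)] in mean. *)
Lemma actor_field_diff s t y z : size s = t.+1 ->
  `|f (y :: s) z - f s z| <= Cf * (alpha t + eta t) * b s.
Proof.
move=> st; have b1 := b_ge1 s.
pose avg s' i := n%:R^-1 * \sum_(j in nbhdk (edge G) kappa i) yv s' (zloc kappa j z).
pose a s' i := dot (submxrow (PG s') i) (score (z.1 i) (z.2 i) (submxrow (th s') i)).
have fE s' : f s' z = - \sum_i avg s' i * a s' i.
  rewrite /f dot_g_joint mulr_sumr; congr (- _); apply: eq_bigr => i _.
  by rewrite /avg /a /yv -mulr_sumr; ring.
have avg_le s' i : `|avg s' i| <= 1 by apply: nbhd_avg_le => // j; exact: yv_le.
have avg_diff i : `|avg (y :: s) i - avg s i| <= alpha t * (2 * (2 * rbar + 3) * b s).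
  rewrite -mulrBr -sumrB; apply: nbhd_avg_le => [|j]; last exact: yv_diff.
  rewrite mulr_ge0 ?(ltW (alpha_gt0 t))// mulr_ge0 ?(le_trans _ b1)// mulr_ge0//.
  by rewrite addr_ge0// mulr_ge0.
have [_ sL sLip _ gradL] := A5.
have thd := th_step y st.
have a_le s' i : `|a s' i| <= CG * Li i.
  apply: (le_trans (dot_le_enorm _ _)); rewrite ler_pM ?enorm_ge0 ?sL//.
  exact: le_trans (enorm_submxrow _ _) (PG_le _).
have a_diff i : `|a (y :: s) i - a s i| <= (`|L'| * Li i + CG * `|Li' i|) * (L * eta t).
  apply: (le_trans (dot_diff_le _ _ _ _)); rewrite mulrDl; apply: lerD.
    rewrite (mulrAC `|L'|); apply: ler_pM; [exact: enorm_ge0|exact: enorm_ge0| |exact: sL].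
    rewrite -submxrowB; apply: (le_trans (enorm_submxrow _ _)).
    rewrite /PG -!(gradient_J n_gt0 A1 A4 A5 z0); apply: (le_trans (gradL _ _)).
    apply: (le_trans (ler_wpM2r (enorm_ge0 _) (ler_norm _))).
    exact: ler_wpM2l.
  rewrite -mulrA; apply: ler_pM; [exact: enorm_ge0|exact: enorm_ge0| |].
    exact: le_trans (enorm_submxrow _ _) (PG_le _).
  apply: (le_trans (sLip _ _ _ _ _)); rewrite -submxrowB.
  apply: (le_trans (ler_wpM2r (enorm_ge0 _) (ler_norm _))).
  by apply: ler_wpM2l => //; exact: le_trans (enorm_submxrow _ _) thd.
rewrite !fE opprK addrC -sumrB; apply: (le_trans (ler_norm_sum _ _ _)).
apply: (@le_trans _ _ (\sum_i ((`|L'| * Li i + CG * `|Li' i|) * (L * eta t)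
   + alpha t * (2 * (2 * rbar + 3) * b s) * (CG * Li i)))).
  apply: ler_sum => i _.
  have -> : avg s i * a s i - avg (y :: s) i * a (y :: s) i =
    - (avg (y :: s) i * (a (y :: s) i - a s i)) - (avg (y :: s) i - avg s i) * a s i by ring.
  apply: (le_trans (ler_normB _ _)); rewrite normrN; apply: lerD.
    rewrite normrM -[leRHS]mul1r.
    by apply: ler_pM; [exact: normr_ge0|exact: normr_ge0|exact: avg_le|exact: a_diff].
  rewrite normrM; apply: ler_pM; [exact: normr_ge0|exact: normr_ge0| |exact: a_le].
  exact: avg_diff.
rewrite big_split/= -mulr_suml.
have -> : \sum_i alpha t * (2 * (2 * rbar + 3) * b s) * (CG * Li i) =
    alpha t * b s * \sum_i 2 * (2 * rbar + 3) * (CG * Li i).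
  by rewrite mulr_sumr; apply: eq_bigr => i _; ring.
have := score_sum0; have := mix_sum0; rewrite /Cf.
move: (\sum_i _) => S1; move: (\sum_i _) => S2 S10 S20.
have a0 := ltW (alpha_gt0 t); have e0 := eta_ge0 t.
have h1 : S2 * (L * eta t) * 1 <= S2 * (L * eta t) * b s.
  by rewrite ler_wpM2l// !mulr_ge0.
have h2 : 0 <= S2 * L * alpha t * b s by rewrite !mulr_ge0// (le_trans _ b1).
have h3 : 0 <= S1 * eta t * b s by rewrite !mulr_ge0// (le_trans _ b1).
lra.
Qed.

Let C0 := 2 * (CG * L) * pc.
Let u s := poisson (Ptheta (th s)) (pi (th s)) (f s) (cur s).

Let u_le s : `|u s| <= C0.
Proof. exact: (poisson_bound (uK (th s)) (f_le s)). Qed.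

(** The shifts [rbar] and [C0] make both summands nonnegative; the second one also allows [eta t.+1]
    to be replaced by [eta t]. *)
Definition actor_potential t s : R := (rbar - J pi (th s)) + eta t * (u s + C0).

Lemma actor_potential_ge0 t s : 0 <= actor_potential t s.
Proof.
rewrite addr_ge0//.
  rewrite subr_ge0; exact: le_trans (ler_norm _) (J_le n_gt0 A1 A4 _).
by rewrite mulr_ge0//; have := u_le s; rewrite ler_norml => /andP[+ _]; lra.
Qed.

Lemma actor_step : exists2 C, 0 <= C & forall t s, size s = t.+1 -> L * eta t <= 1 ->
  mean (K_hist s) (fun y => actor_potential t.+1 (y :: s)) <=
  actor_potential t s + eta t * mean (pi (th s)) (f s)
  + eta t * (C * (alpha t + eta t) * b s).
Proof.
have [CJ CJ0 HJ] := J_taylor n_gt0 A1 A4 A5 z0.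
have KL0 := KL_ge0 A5 z0.
have [Cp Cp0 HP] := @poisson_step R SA (params G) sigma muD (@Ptheta _ _ G) pi mu01 uK
  (fun v v' => enorm (v - v')) _ KL0 (Ptheta_lipschitz A4 A5 z0).
have CL0 : 0 <= CG * L by rewrite mulr_ge0.
exists (CJ * L ^+ 2 + Cp * (Cf + L * (CG * L))).
  by rewrite addr_ge0// mulr_ge0 ?sqr_ge0// addr_ge0// mulr_ge0.
move=> t s st Le; have b1 := b_ge1 s.
have dK := K_hist_distr s.
have a0 := ltW (alpha_gt0 t); have e0 := eta_ge0 t.
have thd y := th_step y st.
have J_step y : rbar - J pi (th (y :: s)) <=
    rbar - J pi (th s) + eta t * f s (cur s) + CJ * (L * eta t) ^+ 2.
  have := HJ (th s) (th (y :: s)) (le_trans (thd y) Le).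
  rewrite ler_norml => /andP[+ _].
  have -> : dot (policy_gradient pi (th s)) (th (y :: s) - th s) = - (eta t * f s (cur s)).
    rewrite /th (ac_hist_cons _ st) param_step addrC addKr dotZr /f /PG mulrN opprK.
    by rewrite mulrA.
  have : CJ * enorm (th (y :: s) - th s) ^+ 2 <= CJ * (L * eta t) ^+ 2.
    by rewrite ler_wpM2l// ler_pXn2r ?nnegrE ?enorm_ge0// mulr_ge0.
  lra.
have pot_le y : actor_potential t.+1 (y :: s) <=
    (rbar - J pi (th s) + eta t * f s (cur s) + CJ * (L * eta t) ^+ 2 + eta t * C0)
    + eta t * u (y :: s).
  rewrite /actor_potential.
  have uC : 0 <= u (y :: s) + C0.
    by have := u_le (y :: s); rewrite ler_norml => /andP[+ _]; lra.
  have := ler_wpM2r uC (eta_noninc t); have := J_step y; lra.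
apply: (le_trans (le_mean dK pot_le)); rewrite meanD mean_cst// meanZ.
have := HP (th s) (fun y => th (y :: s)) (f s) (fun y => f (y :: s)) (CG * L)
  (Cf * (alpha t + eta t) * b s) (L * eta t) (cur s) (mulr_ge0 L0 e0) (f_le s)
  (fun y z => actor_field_diff y z st) thd.
rewrite ler_norml => /andP[_]; rewrite lerBlDl -/(u s) => /(ler_wpM2l e0).
rewrite -[mean (K_hist s) _]/(mean (Ptheta (th s) (cur s)) (fun y => u (y :: s))) => hu.
apply: (le_trans (lerD (lexx _) hu)); rewrite /actor_potential.
have h1 : eta t * (CJ * L ^+ 2 * eta t) * 1 <=
    eta t * (CJ * L ^+ 2 * (alpha t + eta t)) * b s.
  rewrite ler_pM// ?mulr_ge0 ?sqr_ge0// ler_wpM2l// ler_wpM2l ?mulr_ge0 ?sqr_ge0//.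
  by rewrite lerDr.
have h2 : eta t * (Cp * (L * (CG * L)) * eta t) * 1 <=
    eta t * (Cp * (L * (CG * L)) * (alpha t + eta t)) * b s.
  have q0 : 0 <= Cp * (L * (CG * L)) by rewrite mulr_ge0// mulr_ge0.
  rewrite ler_pM//; first by rewrite mulr_ge0// mulr_ge0.
  by rewrite ler_wpM2l// ler_wpM2l// lerDr.
lra.
Qed.

(** The asserted bound enters here: when the norm [g] of the gradient exceeds
    [L * approx_error + dl], the product [g * (g - L * approx_error)] is at least [dl ^+ 2]. *)
Lemma actor_drift s (dl : R) : 0 < dl -> L * approx_error + dl < enorm (PG s) ->
  mean (pi (th s)) (f s) <= - (dl ^+ 2 * Gam dummy (ac_hist s)) + L * CG * critic_gap s.
Proof.
move=> dl0 big; have ae0 := approx_error_ge0.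
have lae0 : 0 <= L * approx_error by rewrite mulr_ge0.
have gap0 : 0 <= critic_gap s.
  by apply: sumr_ge0 => j _; apply: sumr_ge0.
have bias := actor_bias (erefl (PG s)).
rewrite /f meanN meanZ.
have PGC := PG_le s.
move: (mean _ _) bias big PGC (Gam_ge0 (ac_hist s)) (Gam_le1 (ac_hist s)).
move: (enorm (PG s)) (Gam _ _) (critic_gap s) gap0 => g ga gap gap0 M bias big gC ga0 ga1.
have h1 := ler_wpM2l ga0 bias.
have h2 : dl ^+ 2 <= g * (g - L * approx_error) by rewrite expr2 ler_pM ?(ltW dl0)//; lra.
have h3 := ler_wpM2l ga0 h2.
have g0 : 0 <= g by lra.
have h4 : ga * (L * g * gap) <= 1 * (L * CG * gap).
  by rewrite ler_pM ?mulr_ge0// ler_wpM2r// ler_wpM2l.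
rewrite expr2 in h1; rewrite expr2 in h3 *; lra.
Qed.

(** The head of a history sits at time [size s'], and times before [m] are free. As a conjunction
    over past times, the event can only shrink along a trajectory. *)
Fixpoint stays_above (dl : R) (m : nat) (s : seq SA) : bool :=
  if s is _ :: s' then stays_above dl m s' &&
    ((size s' < m)%N || (L * approx_error + dl < enorm (policy_gradient pi (th s))))
  else true.

Lemma critic_gap_vanishing : vanishing (fun t => Ex p0 K_hist t critic_gap).
Proof.
have E t : Ex p0 K_hist t critic_gap = \sum_j \sum_x Ex p0 K_hist t
    (fun s => `|Q_hat (ac_hist s) x - @critic_target j (th s) x|).
  rewrite /critic_gap Ex_sum; last exact: K_hist_distr.
    by apply: eq_bigr => j _; rewrite Ex_sum//; exact: K_hist_distr.
  exact: dp0.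
apply: (@vanishing_le _ _ (fun t => \sum_j \sum_x Ex p0 K_hist t
    (fun s => `|Q_hat (ac_hist s) x - @critic_target j (th s) x|))).
  by near=> t; rewrite E.
apply: vanishing_sum => j; apply: vanishing_sum => x e e0.
have e20 : 0 < e ^+ 2 by rewrite exprn_gt0.
near=> t.
(* Young's inequality passes from mean squares to mean absolute values. *)
apply: (@le_trans _ _ (Ex p0 K_hist t (fun s => e / 2 + (2 * e)^-1 * critic_error j s))).
  apply: Ex_le => // [s|s _]; first exact: K_hist_distr.
  have h : (Q_hat (ac_hist s) x - @critic_target j (th s) x) ^+ 2 <= critic_error j s.
    rewrite /critic_error (bigD1 x)//= addrCA lerDl addr_ge0 ?sqr_ge0//.
    by apply: sumr_ge0 => y _; rewrite sqr_ge0.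
  move: (critic_error j s) (_ - _) h => V d; rewrite -(real_normK (num_real d)).
  move: (`|d|) => {}d h.
  have e2i : 0 < (2 * e)^-1 by rewrite invr_gt0 mulr_gt0.
  have := ler_wpM2l (ltW e2i) h.
  have : 0 <= (2 * e)^-1 * (d - e) ^+ 2 by rewrite mulr_ge0 ?sqr_ge0// ltW.
  have -> : (2 * e)^-1 * (d - e) ^+ 2 = (2 * e)^-1 * d ^+ 2 - d + e / 2.
    by field; rewrite gt_eqF.
  lra.
rewrite ExD ?ExZ ?Ex_cst//; try exact: K_hist_distr.
have : Ex p0 K_hist t (critic_error j) <= e ^+ 2.
  by near: t; exact: (critic_error_vanishing j).
move=> h; have e2i : 0 < (2 * e)^-1 by rewrite invr_gt0 mulr_gt0.
have := ler_wpM2l (ltW e2i) h.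
have -> : (2 * e)^-1 * e ^+ 2 = e / 2 by field; rewrite gt_eqF.
lra.
Unshelve. all: by end_near. Qed.

Lemma Q_max_bound : exists2 C, 0 <= C & forall s, Q_max (ac_hist s) <= C + critic_gap s.
Proof.
pose C := \sum_j #|X j|%:R * (2 * rbar) / coercivity sigma muD.
have c0 := coercivity_gt0 mu01 sigma0.
have Cj0 j : 0 <= #|X j|%:R * (2 * rbar) / coercivity sigma muD.
  by rewrite divr_ge0 ?(ltW c0)// mulr_ge0// mulr_ge0.
have C0' : 0 <= C by apply: sumr_ge0 => j _; exact: Cj0.
exists C => // s; apply: Q_max_le => [|j x].
  by rewrite addr_ge0//; apply: sumr_ge0 => i _; apply: sumr_ge0.
rewrite -[Q_hat _ _](subrK (@critic_target j (th s) x)) addrC.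
apply: (le_trans (ler_normD _ _)); apply: lerD; last exact: critic_gap_ge.
apply: (@le_trans _ _ (#|X j|%:R * (2 * rbar) / coercivity sigma muD)).
  apply: (critic_limit_bound (@zloc_surj _ _ _ z0 kappa j) mu01 sigma0 (uK (th s)) _
    (critic_targetP j (th s))) => z; exact: rew_norm.
rewrite /C (bigD1 j)//= lerDl sumr_ge0// => i _; exact: Cj0.
Qed.

(** Otherwise the potential restricted to the event would lose a fixed multiple of [eta t] in mean
    at every late step, against its nonnegativity. *)
Lemma stays_above_null (dl p : R) (m : nat) : 0 < dl -> 0 < p ->
  ~ forall t, p <= Ex p0 K_hist t (fun s => (stays_above dl m s)%:R).
Proof.
move=> dl0 p_gt0 stay.
have dK := K_hist_distr.
have [C C_0 step] := actor_step.
have [CN CN0 QN] := Q_max_bound.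
pose B := 2 + CN.
have B_gt0 : 0 < B by rewrite ltr_wpDr.
(* [B] bounds the late mean of [1 + Q_max]. The choice [a = p / B] below maximises
   [2 * a * p - a ^+ 2 * B], for a gain [dl ^+ 2 * p ^+ 2 / B = 4 * k]; two errors of at most [k]
   leave [2 * k]. *)
pose k := dl ^+ 2 * p ^+ 2 / (4 * B).
have k0 : 0 < k by rewrite divr_gt0 ?mulr_gt0// exprn_gt0.
pose h t := Ex p0 K_hist t (fun s => (stays_above dl m s)%:R * actor_potential t s).
apply: (@descent_unbounded _ h eta (2 * k) eta_gt0 eta_div).
- by rewrite mulr_gt0.
- move=> t; apply: Ex_ge0 => // s; rewrite mulr_ge0//; exact: actor_potential_ge0.
have LCG0 : 0 <= L * CG by rewrite mulr_ge0.
have gap_small : vanishing (fun t => L * CG * Ex p0 K_hist t critic_gap).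
  by apply: vanishingZ => //; exact: critic_gap_vanishing.
have rate_small : vanishing (fun t => C * 2 * (alpha t + eta t)).
  by apply: vanishingZ; [rewrite mulr_ge0|exact: vanishingD].
have eta_small : vanishing (fun t => L * eta t) by exact: vanishingZ.
have err_small : vanishing (fun t => \sum_i Ex p0 K_hist t (critic_error i)).
  by apply: vanishing_sum => i; exact: critic_error_vanishing.
near=> t.
have mt : (m <= t)%N by near: t; exact: nbhs_infty_ge.
have Le : L * eta t <= 1 by near: t; exact: eta_small.
have gap1 : Ex p0 K_hist t critic_gap <= 1 by near: t; exact: critic_gap_vanishing.
have gapk : L * CG * Ex p0 K_hist t critic_gap <= k by near: t; exact: gap_small.
have ratek : C * 2 * (alpha t + eta t) <= k by near: t; exact: rate_small.
have errb : Ex p0 K_hist t b <= 2.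
  rewrite /b ExD// Ex_cst// Ex_sum//.
  have : \sum_i Ex p0 K_hist t (critic_error i) <= 1 by near: t; exact: err_small.
  lra.
pose a := p / B.
pose I s : R := (stays_above dl m s)%:R.
have e0 := eta_ge0 t; have a0 := ltW (alpha_gt0 t).
have pt s : size s = t.+1 ->
    mean (K_hist s) (fun y => I (y :: s) * actor_potential t.+1 (y :: s)) <=
    I s * actor_potential t s
    + eta t * (- dl ^+ 2 * (2 * a * I s - a ^+ 2 * (1 + CN + critic_gap s))
      + L * CG * critic_gap s + C * (alpha t + eta t) * b s).
  move=> st.
  have gap0 : 0 <= critic_gap s by apply: sumr_ge0 => j _; apply: sumr_ge0.
  have b0 : 0 <= b s by exact: le_trans (b_ge1 s).
  have r0 : 0 <= C * (alpha t + eta t) * b s by rewrite mulr_ge0// mulr_ge0// addr_ge0.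
  have lg0 : 0 <= L * CG * critic_gap s by rewrite mulr_ge0.
  (* The event shrinks and the potential is nonnegative, so the next indicator is replaced by the
     current one. *)
  apply: (@le_trans _ _ (I s * mean (K_hist s) (fun y => actor_potential t.+1 (y :: s)))).
    rewrite -meanZ; apply: le_mean => // y; rewrite ler_wpM2r ?actor_potential_ge0//.
    by rewrite /I ler_nat /=; case: (stays_above dl m s) => //; case: (_ || _).
  have := step t s st Le; rewrite /I; case E : (stays_above dl m s) => H.
    rewrite !mul1r mulr1; apply: (le_trans H).
    have big : L * approx_error + dl < enorm (PG s).
      move: E; case: (s) st => // y s' [st']; rewrite /= st' ltnNge mt/=.
      by case/andP.
    have dr := actor_drift dl0 big.
    (* [1 / x >= 2 a - a^2 x] with [x = 1 + Q_max], the inverse of [Gam]. *)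
    have gamma : 2 * a - a ^+ 2 * (1 + CN + critic_gap s) <= Gam dummy (ac_hist s).
      have gN := Gam_Q_max (ac_hist s).
      have N0 := Q_max_ge0 (ac_hist s); have QNs := QN s.
      move: (Gam _ _) (Q_max _) gN N0 QNs (Gam_ge0 (ac_hist s)) => ga N gN N0 QNs ga0.
      have h1 : a ^+ 2 * (1 + N) <= a ^+ 2 * (1 + CN + critic_gap s).
        by rewrite ler_wpM2l ?sqr_ge0//; lra.
      have h2 : 0 <= (1 + N) * (ga - a) ^+ 2 by rewrite mulr_ge0 ?sqr_ge0// addr_ge0.
      have h3 : (1 + N) * (ga - a) ^+ 2 = ga * (ga * (1 + N)) - 2 * a * (ga * (1 + N))
          + a ^+ 2 * (1 + N) by ring.
      rewrite h3 gN in h2; lra.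
    have := ler_wpM2l (sqr_ge0 dl) gamma => gamma2.
    have := ler_wpM2l e0 dr; have := ler_wpM2l e0 gamma2.
    move: (mean (pi (th s)) _) (actor_potential t s) => M H0.
    lra.
  (* Outside the event the left side is 0 and all the terms on the right are nonnegative. *)
  rewrite !mul0r mulr0 !sub0r add0r mulr_ge0// addr_ge0// addr_ge0// mulrNN.
  by rewrite mulr_ge0 ?sqr_ge0// mulr_ge0 ?sqr_ge0// addr_ge0// addr_ge0.
apply: (@le_trans _ _ (Ex p0 K_hist t (fun s => I s * actor_potential t s +
  eta t * (- dl ^+ 2 * (2 * a * I s - a ^+ 2 * (1 + CN + critic_gap s))
      + L * CG * critic_gap s + C * (alpha t + eta t) * b s)))).
  by rewrite /h [Ex p0 K_hist t.+1 _]/=; exact: Ex_le.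
pose c1 := - (eta t * (dl ^+ 2 * (2 * a))).
pose c2 := eta t * (dl ^+ 2 * a ^+ 2 + L * CG).
pose c3 := eta t * (C * (alpha t + eta t)).
pose c4 := eta t * (dl ^+ 2 * a ^+ 2 * (1 + CN)).
rewrite (@eq_Ex _ _ p0 K_hist dp0 dK t _ (fun s => I s * actor_potential t s +
  (c1 * I s + (c2 * critic_gap s + (c3 * b s + c4))))); last first.
  by move=> s _; rewrite /c1 /c2 /c3 /c4; ring.
rewrite !ExD// !ExZ// Ex_cst// -/(h t) lerD2l.
have pI : p <= Ex p0 K_hist t I := stay t.
move: (Ex p0 K_hist t I) pI (Ex p0 K_hist t critic_gap) gap1 gapk (Ex p0 K_hist t b) errb.
move=> EI pI Eg gap1 gapk Eb errb.
have dla : dl ^+ 2 * a ^+ 2 * B = 4 * k.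
  by rewrite /a /k; field; rewrite gt_eqF.
have dlp : dl ^+ 2 * (2 * a) * p = 8 * k.
  by rewrite /a /k; field; rewrite gt_eqF.
have a_ge0 : 0 <= a by rewrite divr_ge0// ltW.
have h1 : dl ^+ 2 * (2 * a) * p <= dl ^+ 2 * (2 * a) * EI.
  by rewrite ler_wpM2l// mulr_ge0 ?sqr_ge0// mulr_ge0.
have h2 : dl ^+ 2 * a ^+ 2 * (1 + CN + Eg) <= dl ^+ 2 * a ^+ 2 * B.
  apply: ler_wpM2l; first by rewrite mulr_ge0 ?sqr_ge0.
  rewrite /B; lra.
have h3 : C * (alpha t + eta t) * Eb <= C * (alpha t + eta t) * 2.
  by rewrite ler_wpM2l// mulr_ge0// addr_ge0.
have : eta t * (- (dl ^+ 2 * (2 * a) * EI) + dl ^+ 2 * a ^+ 2 * (1 + CN + Eg)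
    + L * CG * Eg + C * (alpha t + eta t) * Eb) <= eta t * (- (2 * k)).
  rewrite ler_wpM2l//; lra.
rewrite /c1 /c2 /c3 /c4; lra.
Unshelve. all: by end_near. Qed.

End Algorithm.

(** * From histories to the probability space *)

Lemma measure_finite_valued (R : realType) d (Om : measurableType d)
    (P : {measure set Om -> \bar R}) (T : finType) (X : Om -> T) (B : pred T) :
  (forall x, measurable [set w | X w = x]) ->
  P [set w | B (X w)] = (\sum_(x | B x) P [set w | X w = x])%E.
Proof.
move=> mX; pose r := [seq x <- enum T | B x].
have -> : [set w | B (X w)] = \bigcup_(x in [set` r]) [set w | X w = x].
  apply/seteqP; split => [w /= Bw|w [x /= xr /= Xw]].
    by exists (X w) => //=; rewrite mem_filter Bw mem_enum.
  by rewrite Xw; move: xr; rewrite mem_filter => /andP[].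
rewrite measure_fin_bigcup//; last by move=> x y _ _ [w [/= <- <-]].
by rewrite -fsbig_seq ?(filter_uniq _ (enum_uniq _))// big_filter big_enum_cond.
Qed.

Lemma measurable_finite_valued d (Om : measurableType d) (T : finType) (X : Om -> T)
    (B : pred T) :
  (forall x, measurable [set w | X w = x]) -> measurable [set w | B (X w)].
Proof.
move=> mX; have -> : [set w | B (X w)] = \bigcup_(x in [set x | B x]) [set w | X w = x].
  apply/seteqP; split => [w /= Bw|w [x /= xr /= Xw]]; first by exists (X w).
  by rewrite Xw.
by apply: fin_bigcup_measurable.
Qed.

(** The lower limit is the supremum of the tail infima, so some tail infimum exceeds [e]. The margin
    is taken of the form [k.+1%:R^-1] to keep the family of exceptional events countable. *)
Lemma lime_inf_gt (R : realType) (u : nat -> R) (e : R) :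
  ~ (limn_einf (fun T => (u T)%:E) <= e%:E)%E ->
  exists m k, forall T, (m <= T)%N -> e + k.+1%:R^-1 < u T.
Proof.
move=> H; set v := fun T => (u T)%:E.
have [m em] : exists m, ~ (einfs v m <= e%:E)%E.
  apply/existsNP => He; apply: H; rewrite limn_einf_lim.
  have -> : limn (einfs v) = ereal_sup (range (einfs v)).
    by apply: cvg_lim => //; apply: ereal_nondecreasing_cvgn; exact: nondecreasing_einfs.
  by apply: ub_ereal_sup => _ [k _ <-]; exact: He.
have inf_le T : (m <= T)%N -> (einfs v m <= (u T)%:E)%E.
  by move=> mT; apply: ereal_inf_lbound; exists T.
have {em} : (e%:E < einfs v m)%E by rewrite ltNge; apply/negP.
case E : (einfs v m) => [r| |] er.
- rewrite lte_fin in er.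
  have [k hk] : exists k : nat, k.+1%:R^-1 < r - e.
    exists (Num.truncn (r - e)^-1); rewrite invf_plt ?posrE ?subr_gt0//.
    by rewrite truncnS_gt.
  exists m, k => T /inf_le; rewrite E lee_fin; apply: lt_le_trans.
  by rewrite -ltrBrDl.
- by have := inf_le m (leqnn m); rewrite E leye_eq.
- by [].
Qed.

Fixpoint history (T : Type) (h : nat -> T) (t : nat) : seq T :=
  if t is t'.+1 then h t :: history h t' else [:: h 0].

Lemma size_history (T : Type) (h : nat -> T) t : size (history h t) = t.+1.
Proof. by elim: t => //= t ->. Qed.

Lemma eq_history (T : Type) (g h : nat -> T) t :
  history g t = history h t <-> forall k, (k <= t)%N -> g k = h k.
Proof.
elim: t => [|t IHt] /=; split.
- by case=> gh0 k; rewrite leqn0 => /eqP ->.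
- by move=> ->.
- case=> ght /IHt IH k; rewrite leq_eqVlt => /predU1P[->//|]; rewrite ltnS; exact: IH.
- by move=> gh; rewrite gh// (IHt.2 (fun k kt => gh k (leqW kt))).
Qed.

Lemma history_nth (T : Type) (x0 : T) t (s : seq T) : size s = t.+1 ->
  history (fun k => nth x0 s (t - k)) t = s.
Proof.
elim: t s => [|t IHt] [|x s] //= [st]; first by case: s st.
rewrite subnn/=; congr (_ :: _); rewrite -[RHS](IHt s st).
by apply/eq_history => k kt; rewrite subSn.
Qed.

Section HistoryLaw.
Context {R : realType} {Z : finType} {d : measure_display} {Om : measurableType d}.
Variables (P : probability Om R) (z : nat -> Om -> Z) (K : seq Z -> Z -> R) (x0 : Z).
Hypothesis mz : forall t x, measurable [set w | z t w = x].
Hypothesis law : forall (h : nat -> Z) t,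
  (P [set w | history (z^~ w) t.+1 = history h t.+1] =
   P [set w | history (z^~ w) t = history h t] * (K (history h t) (h t.+1))%:E)%E.

Let p0 x := fine (P [set w | z 0 w = x]).

(** Probability of a history as a product of transition weights; it links the recursion [Ex] to the
    measure of cylinder events. *)
Fixpoint path_weight (s : seq Z) : R :=
  if s is x :: s' then
    if s' is _ :: _ then path_weight s' * K s' x else p0 x
  else 1.

Let P_history h t :
  P [set w | history (z^~ w) t = history h t] = (path_weight (history h t))%:E.
Proof.
elim: t => [|t IHt].
  have -> : [set w | history (z^~ w) 0 = history h 0] = [set w | z 0 w = h 0%N].
    by apply/seteqP; split => w /= => [[]|->].
  by rewrite /= /p0 fineK// fin_num_measure.
rewrite law IHt /=; case E : (history h t) => [|y s]; last by rewrite EFinM.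
by have := size_history h t; rewrite E.
Qed.

Lemma Ex_path_weight t F :
  Ex p0 K t F = \sum_(s : t.+1.-tuple Z) path_weight s * F s.
Proof.
elim: t F => [|t IHt] F /=.
  rewrite (reindex (fun x : Z => [tuple x]))/=; last first.
    exists (@thead 0 Z) => [x _|s _]; first by [].
    by apply: val_inj; rewrite [s in RHS]tuple_eta/=; case: s => -[|? [|]].
  by [].
rewrite IHt.
rewrite [RHS](reindex (fun p : t.+1.-tuple Z * Z => cons_tuple p.2 p.1))/=; last first.
  exists (fun s : t.+2.-tuple Z => (behead_tuple s, thead s)) => [[s x] _|s _] /=.
    by congr (_, _); apply: val_inj.
  by rewrite [RHS]tuple_eta; apply: val_inj.
rewrite -(pair_bigA _ (fun (s : t.+1.-tuple Z) x =>
  path_weight (x :: s) * F (x :: s)))/=.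
apply: eq_bigr => s _; rewrite /mean mulr_sumr; apply: eq_bigr => x _.
rewrite mulrA; congr (_ * _); case: s => -[|y s] //= ss.
Qed.

Let hist_tuple t w : t.+1.-tuple Z := Tuple (introT eqP (size_history (z^~ w) t)).

Let hist_tupleE t (s : t.+1.-tuple Z) : [set w | hist_tuple t w = s] =
  [set w | history (z^~ w) t = history (fun k => nth x0 s (t - k)) t].
Proof.
have sE : history (fun k => nth x0 s (t - k)) t = s by rewrite history_nth// size_tuple.
by apply/seteqP; split => w /=; rewrite sE; [move=> <-|move=> H; exact: val_inj].
Qed.

Let measurable_hist_tuple t (s : t.+1.-tuple Z) : measurable [set w | hist_tuple t w = s].
Proof.
suff H h : measurable [set w | history (z^~ w) t = history h t] by rewrite hist_tupleE.
elim: t {s} => [|t IHt].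
  have -> : [set w | history (z^~ w) 0 = history h 0] = [set w | z 0 w = h 0%N].
    by apply/seteqP; split => w /= => [[]|->].
  exact: mz.
have -> : [set w | history (z^~ w) t.+1 = history h t.+1] =
    [set w | z t.+1 w = h t.+1] `&` [set w | history (z^~ w) t = history h t].
  by apply/seteqP; split => w /= [-> ->].
by apply: measurableI.
Qed.

Lemma measurable_history t (B : pred (seq Z)) :
  measurable [set w | B (history (z^~ w) t)].
Proof. exact: (measurable_finite_valued (fun s : t.+1.-tuple Z => B s)
  (@measurable_hist_tuple t)). Qed.

Lemma P_history_pred t (B : pred (seq Z)) :
  P [set w | B (history (z^~ w) t)] = (Ex p0 K t (fun s => (B s)%:R))%:E.
Proof.
have := measure_finite_valued P (fun s : t.+1.-tuple Z => B s) (@measurable_hist_tuple t).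
rewrite /= => ->; rewrite Ex_path_weight -sumEFin big_mkcond/=.
apply: eq_bigr => s _; case: (B s); rewrite ?mulr0 ?mulr1//.
by rewrite hist_tupleE P_history history_nth// size_tuple.
Qed.

Lemma initial_distribution : distribution_on p0.
Proof.
split=> [x|]; first by rewrite fine_ge0.
have := P_history_pred 0 xpredT; rewrite /=.
have -> : [set w | true] = [set: Om] by apply/seteqP; split.
rewrite probability_setT => /eqP; rewrite eqe => /eqP ->.
by apply: eq_bigr => x _; rewrite mulr1.
Qed.

End HistoryLaw.

Lemma ac_run_history (R : realType) (n : nat) (G : networked_mdp R n) (kappa : nat)
    (alpha eta : nat -> R) (dummy : forall i, local_state_action G kappa i)
    (theta0 : params G) (h : nat -> state_action G) (t : nat) :
  ac_run alpha eta dummy theta0 h t = ac_hist alpha eta dummy theta0 (history h t).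
Proof.
elim: t => [|t IHt] //; rewrite [history h t.+1]/=.
rewrite (ac_hist_cons _ _ _ _ (h 0%N) _ (size_history h t)) /= IHt.
by congr ac_step; case: t {IHt}.
Qed.

Lemma head_history (T : Type) (x0 : T) (h : nat -> T) t : head x0 (history h t) = h t.
Proof. by case: t. Qed.

Theorem theorem2 (R : realType) (n : nat) (n_gt0 : (0 < n)%N)
    (G : networked_mdp R n)
    (pi : params G -> state_action G -> R)
    (rbar c rho sigma muD : R) (Li Li' : 'I_n -> R) (L' : R)
    (kappa : nat) (kappa_ge1 : (1 <= kappa)%N)
    (alpha eta : nat -> R)
    (A1 : bounded_rewards G rbar)
    (A2 : exp_decay pi c rho)
    (A3 : step_sizes alpha eta)
    (A4 : uniformly_ergodic pi sigma muD)
    (A5 : smooth pi Li Li' L')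
    (dummy : forall i, local_state_action G kappa i)
    (theta0 : params G)
    (d : measure_display) (Om : measurableType d) (P : probability Om R)
    (z : nat -> Om -> state_action G)
    (Hz : ac_trajectory alpha eta dummy theta0 P z) :
  {ae P, forall w,
    (limn_einf (fun T : nat =>
       (enorm (gradient (J pi)
          (param (ac_run alpha eta dummy theta0 (fun t => z t w) T))))%:E)
     <= (Num.sqrt (\sum_i Li i ^+ 2) * (c * rho ^+ kappa.+1 / (1 - muD)))%:E)%E}.
Proof.
have [mz Pz] := Hz.
(* A probability space is nonempty, so the trajectory itself provides the default state. *)
have [z0 _] : exists z0 : state_action G, True.
  have [w _] : exists w : Om, True.
    apply: contrapT => noOm; have := probability_setT P.
    rewrite (_ : [set: Om] = set0) ?measure0; last first.
      by apply/seteqP; split => // w _; apply: noOm; exists w.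
    by move/eqP; rewrite eqe eq_sym oner_eq0.
  by exists (z 0%N w).
pose K := K_hist alpha eta dummy theta0 z0.
have hist_set (h : nat -> state_action G) t :
    [set w | forall k, (k <= t)%N -> z k w = h k] =
    [set w | history (z^~ w) t = history h t].
  by apply/seteqP; split => w /= /eq_history.
have law (h : nat -> state_action G) t :
    (P [set w | history (z^~ w) t.+1 = history h t.+1] =
     P [set w | history (z^~ w) t = history h t] * (K (history h t) (h t.+1))%:E)%E.
  rewrite -!hist_set Pz ac_run_history; congr (_ * (_)%:E)%E.
  by rewrite /K /K_hist head_history.
have dp0 := initial_distribution z0 mz law.
pose e := Num.sqrt (\sum_i Li i ^+ 2) * (c * rho ^+ kappa.+1 / (1 - muD)).
pose g w T := enorm (gradient (J pi)
  (param (ac_run alpha eta dummy theta0 (fun t => z t w) T))).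
pose bad m k := [set w | forall T, (m <= T)%N -> e + k.+1%:R^-1 < g w T].
suff bad0 m k : P.-negligible (bad m k).
  apply: (@negligibleS _ _ _ _ (\bigcup_m \bigcup_k bad m k)); last first.
    by do 2!apply: negligible_bigcup => ?; exact: bad0.
  move=> w /= /lime_inf_gt[m [k H]].
  by exists m => //; exists k.
pose stays := stays_above pi c rho muD Li alpha eta dummy theta0 (k.+1%:R^-1 : R) m.
(* A measurable event containing [bad m k], cut out by conditions on finite histories, so that its
   probability is bounded by [Ex] at every time. *)
pose A := \bigcap_T [set w | stays (history (z^~ w) T)].
have mstays T := measurable_history z0 mz T stays.
have mA : measurable A by apply: bigcapT_measurable.
have P_A T : (P A <= (Ex (fun x => fine (P [set w | z 0%N w = x])) K T
    (fun s => (stays s)%:R))%:E)%E.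
  rewrite -(P_history_pred z0 mz law) le_measure ?inE//.
  exact: bigcap_inf.
exists A; split => //; last first.
  move=> w bw T _ /=.
  have big t : (t < m)%N || (e + k.+1%:R^-1 < enorm (policy_gradient pi
      (param (ac_hist alpha eta dummy theta0 (history (z^~ w) t))))).
    case: ltnP => //= mt; have := bw t mt; rewrite /g ac_run_history.
    by rewrite (gradient_J n_gt0 A1 A4 A5 z0).
  have stays_cons y s : stays (y :: s) = stays s && ((size s < m)%N ||
      (e + k.+1%:R^-1 < enorm (policy_gradient pi
        (param (ac_hist alpha eta dummy theta0 (y :: s)))))) by [].
  elim: T => [|T IHT]; first exact: (big 0%N).
  by rewrite [history _ _]/= stays_cons IHT size_history; exact: (big T.+1).
have PAfin : P A \is a fin_num by exact: fin_num_measure.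
have [PA0|PA0] := eqVneq (fine (P A)) 0; first by rewrite -(fineK PAfin) PA0.
(* A positive probability would be a lower bound, uniform in time, for the expectation of the
   indicator. *)
have pA : 0 < fine (P A) by rewrite lt_neqAle eq_sym PA0 fine_ge0.
have k0 : 0 < k.+1%:R^-1 :> R by rewrite invr_gt0.
have stay T : fine (P A) <= Ex (fun x => fine (P [set w | z 0%N w = x])) K T
    (fun s => (stays s)%:R).
  by rewrite -lee_fin fineK// P_A.
by case: (stays_above_null n_gt0 kappa_ge1 A1 A2 A3 A4 A5 dp0 k0 pA stay).
Qed.
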